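(* Let $\alpha\in\mathbb R\setminus\{0\}$, $s>1$, $u_0\in H^s_+(\mathbb S^1)$, and let $u$ be the solution of $i\partial_tu=\Pi(|u|^2u)+\alpha(u|1)$ with $u(0)=u_0$; assume $t\mapsto(1|u(t))$ is not identically zero. Let $\sigma_k>0$ be a singular value of $K_u$ and let $T_c\subset\mathbb R$ be the discrete set of times of crossing at $\sigma_k$. For any open interval $\Omega$ contained in the complement of $T_c$, and $\sigma_k\in\Sigma_K(u(t))$ with $t\in\Omega$, write $$K_{u(t)}u_k'(t)=\sigma_k\Psi_k(t)u_k'(t),$$ with $\Psi_k(t)$ a finite Blaschke product. Then there exists a function $\psi_k:\Omega\to\mathbb S^1$ such that $$\Psi_k(t)=e^{i\psi_k(t)}\Psi_k(0),\qquad t\in\Omega .$$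
   Context: $L^2_+=L^2_+(\mathbb S^1)$ is the Hardy space of $L^2$ functions on the unit circle with only nonnegative frequencies, $H^s_+=H^s(\mathbb S^1)\cap L^2_+$; $\Pi:L^2(\mathbb S^1)\to L^2_+$ is the orthogonal projector; $(u|v)=\int_{\mathbb S^1}u\bar v\,\frac{d\theta}{2\pi}$. $H_u(h)=\Pi(u\bar h)$ is an antilinear operator on $L^2_+$, $S$ is the shift $Sh=zh$, and $K_u:=S^*H_u$. The eigenvalues of $K_{u(t)}^2$, with multiplicities, do not depend on $t$; singular values of $K_u$ are their square roots. $E_u(\tau)=\ker(H_u^2-\tau^2I)$, $F_u(\tau)=\ker(K_u^2-\tau^2I)$, $\Sigma_H(u)=\{\tau>0:u\not\perp E_u(\tau)\}$, $\Sigma_K(u)=\{\tau\ge0:u\not\perp F_u(\tau)\}$. Crossing at $\sigma_k$ at time $t$ means $\sigma_k\in\Sigma_H(u(t))$ with $\dim E_{u(t)}(\sigma_k)\ge2$; outside the crossing times, $\sigma_k\in\Sigma_K(u(t))$. $u_k'(t)$ is the orthogonal projection of $u(t)$ onto $F_{u(t)}(\sigma_k)$. A finite Blaschke product of degree $d$ is $\Psi(z)=e^{-i\psi}P(z)/D(z)$, where $\psi\in\mathbb S^1$ is its angle ($\mathbb S^1$ being identified with the circle of angles), $P$ is a monic polynomial of degree $d$ with all roots in the open unit disc and $D(z)=z^d\overline P(1/z)$. Known fact (Gérard–Grellier): if $\sigma_k\in\Sigma_K(u)$, $\sigma_k>0$, $m=\dim F_u(\sigma_k)$, there is a Blaschke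 product $\Psi_k$ of degree $m-1$ with $K_u(u_k')=\sigma_k\Psi_ku_k'$. $\Psi_k(0)$ denotes this Blaschke product at time $t=0$. *)

(* Defs.v *)
From HB Require Import structures.
From mathcomp Require Import all_boot all_order all_algebra.
From mathcomp Require Import all_classical all_reals all_analysis.
From mathcomp Require Import complex.
Set Implicit Arguments.
Unset Strict Implicit.
Unset Printing Implicit Defensive.
Import Order.TTheory GRing.Theory Num.Theory.
Import numFieldNormedType.Exports.
Local Open Scope classical_set_scope.
Local Open Scope ring_scope.
Local Open Scope complex_scope.

(* A function on the circle is represented by a total function C -> C of which
   only the values at the points e^{i theta} matter.  Elements of L^2 are such
   functions, to be compared with [eq_ae] and never with [=]. *)

Definition expi (R : realType) (x : R) : R[i] := cos x +i* sin x.

Definition angles (R : realType) : set R := `[0, 2 * pi]%classic.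
Arguments angles R : clear implicits.

Definition eq_ae (R : realType) (f g : R[i] -> R[i]) : Prop :=
  {ae @lebesgue_measure R,
    forall x, x \in angles R -> f (expi x) = g (expi x)}.

Definition L2 (R : realType) : set (R[i] -> R[i]) := [set f : R[i] -> R[i] |
  [/\ measurable_fun (angles R) (fun x : R => complex.Re (f (expi x))),
      measurable_fun (angles R) (fun x : R => complex.Im (f (expi x))) &
      (\int[@lebesgue_measure R]_(x in angles R)
         (Normc.normc (f (expi x)) ^+ 2)%:E < +oo)%E]].

(* integral against the normalized measure d theta / (2 pi) *)
Definition circle_int (R : realType) (f : R[i] -> R[i]) : R[i] :=
  ((\int[@lebesgue_measure R]_(x in angles R) complex.Re (f (expi x)))%R
     / (2 * pi)) +i*
  ((\int[@lebesgue_measure R]_(x in angles R) complex.Im (f (expi x)))%R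
     / (2 * pi)).

Definition inner (R : realType) (f g : R[i] -> R[i]) : R[i] :=
  circle_int (fun z => f z * (g z)^*).

Definition fourier (R : realType) (f : R[i] -> R[i]) (n : int) : R[i] :=
  inner f (fun z => z ^ n).

Definition hardy (R : realType) : set (R[i] -> R[i]) :=
  [set f : R[i] -> R[i] | L2 f /\ forall n : int, n < 0 -> fourier f n = 0].

Definition sobolev_sqnorm (R : realType) (s : R) (f : R[i] -> R[i]) : \bar R :=
  (\esum_(n in [set: int])
    ((1 + n%:~R ^+ 2) `^ s * Normc.normc (fourier f n) ^+ 2)%:E)%E.

Definition sobolev (R : realType) (s : R) : set (R[i] -> R[i]) :=
  [set f : R[i] -> R[i] | L2 f /\ (sobolev_sqnorm s f < +oo)%E].

Definition sobolev_plus (R : realType) (s : R) : set (R[i] -> R[i]) :=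
  sobolev s `&` @hardy R.

(* Orthogonal projection onto the (closed) subspace V of L^2.  The projection is
   unique up to [eq_ae]; [xget] picks a representative, and would return the
   zero function if there were none. *)
Definition orthproj (R : realType) (V : set (R[i] -> R[i])) (f : R[i] -> R[i]) :
    R[i] -> R[i] :=
  xget (fun=> 0) [set g : R[i] -> R[i] | V g /\ forall h, V h -> inner (fun z => f z - g z) h = 0].

Definition szego (R : realType) (f : R[i] -> R[i]) : R[i] -> R[i] :=
  orthproj (@hardy R) f.

Definition shift (R : realType) (h : R[i] -> R[i]) : R[i] -> R[i] :=
  fun z => z * h z.

(* adjoint of [shift] on the Hardy space *)
Definition shift_adj (R : realType) (h : R[i] -> R[i]) : R[i] -> R[i] :=
  xget (fun=> 0)
    [set g : R[i] -> R[i] | hardy g /\ forall f, hardy f -> inner (shift f) h = inner f g].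

Definition Hankel (R : realType) (u h : R[i] -> R[i]) : R[i] -> R[i] :=
  szego (fun z => u z * (h z)^*).

Definition sHankel (R : realType) (u h : R[i] -> R[i]) : R[i] -> R[i] :=
  shift_adj (Hankel u h).

Definition E_ (R : realType) (u : R[i] -> R[i]) (tau : R) :
    set (R[i] -> R[i]) :=
  [set h : R[i] -> R[i] | hardy h /\
     eq_ae (Hankel u (Hankel u h)) (fun z => (tau ^+ 2)%:C * h z)].

Definition F_ (R : realType) (u : R[i] -> R[i]) (tau : R) :
    set (R[i] -> R[i]) :=
  [set h : R[i] -> R[i] | hardy h /\
     eq_ae (sHankel u (sHankel u h)) (fun z => (tau ^+ 2)%:C * h z)].

Definition orthogonal_to (R : realType) (u : R[i] -> R[i])
    (V : set (R[i] -> R[i])) : Prop :=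
  forall h, V h -> inner u h = 0.

Definition Sigma_H (R : realType) (u : R[i] -> R[i]) : set R :=
  [set tau | 0 < tau /\ ~ orthogonal_to u (E_ u tau)].

Definition Sigma_K (R : realType) (u : R[i] -> R[i]) : set R :=
  [set tau | 0 <= tau /\ ~ orthogonal_to u (F_ u tau)].

Definition K_singular_value (R : realType) (u : R[i] -> R[i]) (tau : R) : Prop :=
  0 <= tau /\ exists2 h, F_ u tau h & ~ eq_ae h (fun=> 0).

Definition dim_ge (R : realType) (V : set (R[i] -> R[i])) (n : nat) : Prop :=
  exists2 e : 'I_n -> (R[i] -> R[i]), (forall j, V (e j)) &
    forall c : 'I_n -> R[i],
      eq_ae (fun z => \sum_(j < n) c j * e j z) (fun=> 0) -> forall j, c j = 0.

Definition crossing_times (R : realType) (u : R -> R[i] -> R[i]) (sigma : R) :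
    set R :=
  [set t | Sigma_H (u t) sigma /\ dim_ge (E_ (u t) sigma) 2].

Definition K_component (R : realType) (u : R[i] -> R[i]) (sigma : R) :
    R[i] -> R[i] :=
  orthproj (F_ u sigma) u.

(* D(z) = z^d conj(P)(1/z), expanded as a polynomial so that it also has the
   right value at z = 0 *)
Definition reciprocal_poly (R : realType) (d : nat) (P : {poly R[i]}) :
    {poly R[i]} :=
  \poly_(j < d.+1) (P`_(d - j))^*.

(* The equality is required on the closed unit disc, where D has no zero. *)
Definition finite_blaschke (R : realType) (Psi : R[i] -> R[i]) : Prop :=
  exists (d : nat) (psi : R) (P : {poly R[i]}),
    [/\ P \is monic, size P = d.+1, (forall w, root P w -> Normc.normc w < 1) &
        forall z, Normc.normc z <= 1 ->
          Psi z = expi (- psi) * (P.[z] / (reciprocal_poly d P).[z])].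

Definition sobolev_deriv (R : realType) (s : R) (u : R -> R[i] -> R[i]) (t : R)
    (v : R[i] -> R[i]) : Prop :=
  sobolev_sqnorm s (fun z => (u (t + h) z - u t z) / h%:C - v z)
    @[h --> (0 : R)^'] --> (0 : \bar R).

(* u is a differentiable curve in H^s_+ solving, at every time,
   i u_t = Pi(|u|^2 u) + alpha (u|1). *)
Definition szego_solution (R : realType) (alpha s : R)
    (u : R -> R[i] -> R[i]) : Prop :=
  forall t, sobolev_plus s (u t) /\
    exists v, [/\ sobolev_plus s v, sobolev_deriv s u t v &
      eq_ae (fun z => 'i * v z)
        (fun z => szego (fun w => (Normc.normc (u t w) ^+ 2)%:C * u t w) z
                  + alpha%:C * inner (u t) (fun=> 1))].

(* Main.v *)
Require Import Defs.
From HB Require Import structures.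
From mathcomp Require Import all_boot all_order all_algebra.
From mathcomp Require Import all_classical all_reals all_analysis.
From mathcomp Require Import complex.
From mathcomp Require Import measurable_realfun.
From mathcomp Require Import ring lra.
Set Implicit Arguments.
Unset Strict Implicit.
Unset Printing Implicit Defensive.
Import Order.TTheory GRing.Theory Num.Theory.
Import numFieldNormedType.Exports.
Local Open Scope classical_set_scope.
Local Open Scope ring_scope.
Local Open Scope complex_scope.
Import Normc.
Local Notation "z ^*" := (conjc z) : ring_scope.
Local Notation "''i'" := (Complex 0 1) : ring_scope.

(** The Fourier coefficients of the solution carry the whole argument. As s > 1, they are
    summable, even with the weight [sqrt (p + 1)] ([sob_wl1]); therefore the operators
    H_u and K_u, their eigenspaces and the components of u on these can be described on
    summable sequences ([Hankel_spec], [sHankel_spec], [F_spec], [K_component_spec]), and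
    the equation becomes a differential equation in l^1 ([sol_dcurve]). This translation
    rests on the density of trigonometric polynomials in L^2 ([dens_L2a]).

    Let T be the Toeplitz operator of symbol |u|^2, let F be the eigenspace of K_u^2 for
    sigma^2, and consider the solutions of y' = - i T y. The constant alpha (u | 1) is
    killed by the backward shift, so K_u satisfies the Lax equation of the Szegö flow
    ([Kop_Lax], [Kop_curve]). Consequently the propagator of y' = - i T y is unitary, maps
    F at time 0 onto F at time t ([sol_dot], [sol_eigK]), and exp (- i sigma^2 t) K_u y is
    a solution if y is one in F ([sol_Kop]). Although u itself is not transported, the
    orthogonality to u is: for a solution f in F the products (f | u) and (f | 1) solve a
    closed linear system ([sol_vanish]), and for f in F orthogonality to u implies
    orthogonality to 1 unless u is orthogonal to F ([eigK_vanish]). On the solutions in F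
    orthogonal to u and 1, the backward shift commutes with T and K_u^2, hence gives
    solutions in F again ([sol_sh], [eigK_sh]).

    Now let y be the solution starting from the component a of u(0) on F, and divide
    exp (- i sigma^2 t) K_u y by y as power series. Each coefficient of the quotient is
    an inner product of two solutions, hence constant; the remainder is orthogonal to y,
    so it vanishes at the origin and its backward shift is a solution in F, to which the
    same applies. The quotient is thus independent of time. The component of u(t) is a
    scalar multiple of y(t), and as K_u is antilinear this scalar only changes the
    quotient by a phase ([component_quotient]). But the quotient of K_u a by a is
    sigma Psi, so Psi(t) is a unimodular multiple of Psi(0) ([blaschke_evolution]).

    The components are not zero: at time t because sigma belongs to Sigma_K, and at time 0
    because u(0) orthogonal to F would produce an eigenvector of H_u^2 orthogonal to u
    whose image by H_u is not, that is, a crossing ([component_neq0_init]). *)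

(** * Moduli of complex numbers *)

Section Modulus.
Variable R : realType.
Implicit Types x y z : R[i].

Lemma normc_ge0 z : 0 <= normc z.
Proof. by case: z => a b; rewrite /= sqrtr_ge0. Qed.

Lemma normcD x y : normc (x + y) <= normc x + normc y.
Proof. exact: le_normcD. Qed.

Lemma normcB x y : normc (x - y) <= normc x + normc y.
Proof. by rewrite -(normcN y) normcD. Qed.

Lemma normc_distC x y : normc (x - y) = normc (y - x).
Proof. by rewrite -normcN opprB. Qed.

Lemma normc_sum (I : Type) (r : seq I) (P : pred I) (F : I -> R[i]) :
  normc (\sum_(i <- r | P i) F i) <= \sum_(i <- r | P i) normc (F i).
Proof.
elim/big_ind2: _ => [|x a y b xa yb|//]; first by rewrite normc0.
by apply: le_trans (normcD _ _) _; rewrite lerD.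
Qed.

Lemma normc_conj z : normc z^* = normc z.
Proof. by case: z => a b; rewrite /= sqrrN. Qed.

Lemma normc_real (r : R) : normc r%:C = `|r|.
Proof. by rewrite /= expr0n /= addr0 sqrtr_sqr. Qed.

Lemma sqr_normcE z : normc z ^+ 2 = complex.Re z ^+ 2 + complex.Im z ^+ 2.
Proof. by case: z => a b; rewrite /= sqr_sqrtr // addr_ge0 // sqr_ge0. Qed.

Lemma mulc_conj z : z * z^* = (normc z ^+ 2)%:C.
Proof.
by rewrite sqr_normcE; case: z => a b; apply/eqP; rewrite eq_complex /=; apply/andP;
  split; apply/eqP; ring.
Qed.

Lemma Re_le_normc z : `|complex.Re z| <= normc z.
Proof.
by rewrite -(ler_pXn2r (n := 2)) ?nnegrE ?normc_ge0 // sqr_normcE real_normK ?num_real //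
  lerDl sqr_ge0.
Qed.

Lemma Im_le_normc z : `|complex.Im z| <= normc z.
Proof.
by rewrite -(ler_pXn2r (n := 2)) ?nnegrE ?normc_ge0 // sqr_normcE real_normK ?num_real //
  lerDr sqr_ge0.
Qed.

Lemma normc_le_ReIm z : normc z <= `|complex.Re z| + `|complex.Im z|.
Proof.
rewrite -(ler_pXn2r (n := 2)) ?nnegrE ?normc_ge0 // ?addr_ge0 // sqr_normcE.
rewrite -[X in X + _](real_normK (num_real _)) -[X in _ + X](real_normK (num_real _)).
by rewrite sqrrD lerD2r lerDl mulrn_wge0 // mulr_ge0.
Qed.

Lemma normc_eq0 z : (normc z == 0) = (z == 0).
Proof.
apply/eqP/eqP => [|->]; first exact: eq0_normc.
exact: normc0.
Qed.

Lemma normc_gt0 z : (0 < normc z) = (z != 0).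
Proof. by rewrite lt_neqAle normc_ge0 andbT eq_sym normc_eq0. Qed.

Lemma normc_small z : (forall e, 0 < e -> normc z <= e) -> z = 0.
Proof.
move=> H; apply/eqP; rewrite -normc_eq0 eq_le normc_ge0 andbT.
by apply/ler_addgt0Pl => e e0; rewrite addr0 H.
Qed.

Lemma ReD x y : complex.Re (x + y) = complex.Re x + complex.Re y.
Proof. by case: x; case: y. Qed.
Lemma ImD x y : complex.Im (x + y) = complex.Im x + complex.Im y.
Proof. by case: x; case: y. Qed.
Lemma ReB x y : complex.Re (x - y) = complex.Re x - complex.Re y.
Proof. by case: x; case: y. Qed.
Lemma ImB x y : complex.Im (x - y) = complex.Im x - complex.Im y.
Proof. by case: x; case: y. Qed.
Lemma Re_sum (I : Type) (r : seq I) (P : pred I) (F : I -> R[i]) :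
  complex.Re (\sum_(i <- r | P i) F i) = \sum_(i <- r | P i) complex.Re (F i).
Proof. exact: (big_morph _ ReD). Qed.
Lemma Im_sum (I : Type) (r : seq I) (P : pred I) (F : I -> R[i]) :
  complex.Im (\sum_(i <- r | P i) F i) = \sum_(i <- r | P i) complex.Im (F i).
Proof. exact: (big_morph _ ImD). Qed.

Lemma conjcM x y : (x * y)^* = x^* * y^*.
Proof. exact: rmorphM. Qed.

Lemma conjcD x y : (x + y)^* = x^* + y^*.
Proof. exact: rmorphD. Qed.

Lemma conjcN x : (- x)^* = - x^*.
Proof. exact: rmorphN. Qed.

Lemma conjc_sum (I : Type) (r : seq I) (P : pred I) (F : I -> R[i]) :
  (\sum_(i <- r | P i) F i)^* = \sum_(i <- r | P i) (F i)^*.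
Proof. exact: (big_morph _ (rmorphD _) (rmorph0 _)). Qed.

End Modulus.

Arguments Normc.normc : simpl never.

(** * Absolutely convergent complex series *)

Section Series.
Variable R : realType.
Implicit Types (x y : nat -> R[i]) (B : R).

(** The l^1 norm enters the estimates through its upper bounds: [bd] means that the
    norm of [x] is at most [B]. *)
Definition bd x B : Prop := forall N, \sum_(k < N) normc (x k) <= B.
Definition l1 x : Prop := exists B, bd x B.

Definition sums x (l : R[i]) : Prop :=
  forall e, 0 < e -> exists N0, forall N, (N0 <= N)%N -> normc (\sum_(k < N) x k - l) <= e.

Definition csum x : R[i] :=
  limn (fun N => \sum_(k < N) complex.Re (x k)) +i* limn (fun N => \sum_(k < N) complex.Im (x k)).
Arguments csum : simpl never.

Lemma bd_ge0 x B : bd x B -> 0 <= B.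
Proof. by move=> /(_ 0%N); rewrite big_ord0. Qed.

Lemma bd_le x B B' : bd x B -> B <= B' -> bd x B'.
Proof. by move=> xB BB' N; apply: le_trans BB'. Qed.

Lemma bd_ext x y B : bd x B -> x =1 y -> bd y B.
Proof. by move=> xB xy N; apply: le_trans (xB N); under eq_bigr do rewrite -xy. Qed.

Lemma bd_coord x B k : bd x B -> normc (x k) <= B.
Proof.
move=> /(_ k.+1); rewrite big_ord_recr /=; apply: le_trans.
by rewrite lerDr sumr_ge0 // => i _; rewrite normc_ge0.
Qed.

Lemma bdD x y B B' : bd x B -> bd y B' -> bd (fun k => x k + y k) (B + B').
Proof.
move=> xB yB N; apply: le_trans (lerD (xB N) (yB N)).
by rewrite -big_split /=; apply: ler_sum => k _; rewrite normcD.
Qed.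

Lemma bdZ (c : R[i]) x B : bd x B -> bd (fun k => c * x k) (normc c * B).
Proof.
move=> xB N; under eq_bigr do rewrite normcM.
by rewrite -mulr_sumr ler_wpM2l // normc_ge0.
Qed.

Lemma bdN x B : bd x B -> bd (fun k => - x k) B.
Proof. by move=> xB N; under eq_bigr do rewrite normcN. Qed.

Lemma bdB x y B B' : bd x B -> bd y B' -> bd (fun k => x k - y k) (B + B').
Proof. by move=> xB /bdN yB; apply: bdD xB yB. Qed.

Lemma bd_conj x B : bd x B -> bd (fun k => (x k)^*) B.
Proof. by move=> xB N; under eq_bigr do rewrite normc_conj. Qed.

Lemma bd0 : bd (fun=> 0) 0.
Proof. by move=> N; rewrite big1 // => k _; rewrite normc0. Qed.

Lemma bd_sum_nat x B m n : bd x B -> \sum_(m <= k < n) normc (x k) <= B.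
Proof.
move=> xB; apply: le_trans (xB n); rewrite -(big_mkord xpredT (fun k => normc (x k))).
have [mn|nm] := leqP m n; last first.
  rewrite [leLHS]big_geq ?(ltnW nm) //; apply: sumr_ge0 => k _; exact: normc_ge0.
rewrite (@big_cat_nat _ _ _ m 0 n) //= lerDr sumr_ge0 // => k _.
exact: normc_ge0.
Qed.

Lemma l1D x y : l1 x -> l1 y -> l1 (fun k => x k + y k).
Proof. by move=> [B xB] [B' yB]; exists (B + B'); apply: bdD. Qed.
Lemma l1Z c x : l1 x -> l1 (fun k => c * x k).
Proof. by move=> [B xB]; exists (normc c * B); apply: bdZ. Qed.
Lemma l1N x : l1 x -> l1 (fun k => - x k).
Proof. by move=> [B xB]; exists B; apply: bdN. Qed.
Lemma l1B x y : l1 x -> l1 y -> l1 (fun k => x k - y k).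
Proof. by move=> lx /l1N; apply: l1D lx. Qed.
Lemma l1_conj x : l1 x -> l1 (fun k => (x k)^*).
Proof. by move=> [B xB]; exists B; apply: bd_conj. Qed.
Lemma l1_ext x y : l1 x -> x =1 y -> l1 y.
Proof. by move=> [B xB] xy; exists B; apply: bd_ext xB _. Qed.
Lemma l1_0 : l1 (fun=> 0).
Proof. by exists 0; apply: bd0. Qed.

Lemma l1_add x y : l1 x -> l1 y -> l1 (x + y).
Proof. exact: l1D. Qed.
Lemma l1_sub x y : l1 x -> l1 y -> l1 (x - y).
Proof. exact: l1B. Qed.
Lemma l1_scale c x : l1 x -> l1 (c *: x).
Proof. exact: l1Z. Qed.
Lemma bd_add x y B B' : bd x B -> bd y B' -> bd (x + y) (B + B').
Proof. exact: bdD. Qed.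
Lemma bd_scale c x B : bd x B -> bd (c *: x) (normc c * B).
Proof. exact: bdZ. Qed.

Lemma cvg_abs_real (r : nat -> R) B : (forall N, \sum_(k < N) `|r k| <= B) ->
  (\sum_(k < N) r k) @[N --> \oo] --> limn (fun N => \sum_(k < N) r k).
Proof.
move=> rB.
have E (f : nat -> R) : (fun N => \sum_(k < N) f k) = series f.
  by apply/funext => N; rewrite /series /= big_mkord.
rewrite E; apply: normed_cvg.
apply: nondecreasing_is_cvgn.
  by apply/nondecreasing_seqP => n; rewrite /normed_series_of /series /= big_nat_recr //= lerDl.
by exists B => _ [N _ <-]; rewrite /normed_series_of /series /= big_mkord.
Qed.

Lemma csumP x : l1 x -> sums x (csum x).
Proof.
move=> [B xB] e e0.
have hR : forall N, \sum_(k < N) `|complex.Re (x k)| <= B.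
  by move=> N; apply: le_trans (xB N); apply: ler_sum => k _; apply: Re_le_normc.
have hI : forall N, \sum_(k < N) `|complex.Im (x k)| <= B.
  by move=> N; apply: le_trans (xB N); apply: ler_sum => k _; apply: Im_le_normc.
have e2 : 0 < e / 2 by rewrite divr_gt0.
have /cvgrPdist_le /(_ _ e2) [N1 _ H1] := @cvg_abs_real (fun k => complex.Re (x k)) B hR.
have /cvgrPdist_le /(_ _ e2) [N2 _ H2] := @cvg_abs_real (fun k => complex.Im (x k)) B hI.
exists (maxn N1 N2) => N; rewrite geq_max => /andP[h1 h2].
apply: le_trans (normc_le_ReIm _) _; rewrite ReB ImB Re_sum Im_sum.
rewrite (splitr e) lerD // distrC; [exact: H1|exact: H2].
Qed.

Lemma sums_unique x l l' : sums x l -> sums x l' -> l = l'.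
Proof.
move=> H H'; apply/eqP; rewrite -subr_eq0; apply/eqP; apply: normc_small => e e0.
have e2 : 0 < e / 2 by rewrite divr_gt0.
have [N1 h1] := H _ e2; have [N2 h2] := H' _ e2.
rewrite (splitr e) -[l](subrK (\sum_(k < maxn N1 N2) x k)) -addrA.
apply: le_trans (normcD _ _) _; apply: lerD.
  by rewrite normc_distC h1 // leq_maxl.
by rewrite h2 // leq_maxr.
Qed.

Lemma csum_eq x l : l1 x -> sums x l -> csum x = l.
Proof. by move=> /csumP H; apply: sums_unique. Qed.

Lemma normc_sums x l B : sums x l -> bd x B -> normc l <= B.
Proof.
move=> H xB; apply/ler_addgt0Pl => e e0; have [N h] := H _ e0.
rewrite -[l](subrK (\sum_(k < N) x k)); apply: le_trans (normcD _ _) _.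
rewrite lerD //; first by rewrite normc_distC h.
exact: le_trans (normc_sum _ _ _) (xB N).
Qed.

Lemma normc_csum x B : bd x B -> normc (csum x) <= B.
Proof. by move=> xB; apply: (normc_sums _ xB); apply: csumP; exists B. Qed.

Lemma csum_ext x y : x =1 y -> csum x = csum y.
Proof. by move=> /funext ->. Qed.

Lemma sumsD x y l l' : sums x l -> sums y l' -> sums (fun k => x k + y k) (l + l').
Proof.
move=> H H' e e0.
have e2 : 0 < e / 2 by rewrite divr_gt0.
have [N1 h1] := H _ e2; have [N2 h2] := H' _ e2.
exists (maxn N1 N2) => N; rewrite geq_max => /andP[k1 k2].
rewrite big_split /= opprD addrACA (splitr e).
by apply: le_trans (normcD _ _) _; rewrite lerD ?h1 ?h2.
Qed.

Lemma sumsZ c x l : sums x l -> sums (fun k => c * x k) (c * l).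
Proof.
move=> H e e0.
have c0 : 0 < normc c + 1 by rewrite ltr_wpDl ?normc_ge0.
have [N h] := H _ (divr_gt0 e0 c0); exists N => M NM.
rewrite -mulr_sumr -mulrBr normcM.
apply: le_trans (ler_wpM2l (normc_ge0 c) (h _ NM)) _.
by rewrite mulrCA ler_piMr ?(ltW e0) // ler_pdivrMr // mul1r lerDl.
Qed.

Lemma csumD x y : l1 x -> l1 y -> csum (fun k => x k + y k) = csum x + csum y.
Proof.
by move=> lx ly; apply: csum_eq; [exact: l1D|apply: sumsD; exact: csumP].
Qed.

Lemma csumZ c x : l1 x -> csum (fun k => c * x k) = c * csum x.
Proof. by move=> lx; apply: csum_eq; [exact: l1Z|apply: sumsZ; exact: csumP]. Qed.

Lemma csum_conj x : l1 x -> csum (fun k => (x k)^*) = (csum x)^*.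
Proof.
move=> lx; apply: csum_eq; first exact: l1_conj.
move=> e /(csumP lx) [N h]; exists N => M /h.
by rewrite -conjc_sum -rmorphB normc_conj.
Qed.

Lemma bd_shift x B : bd x B -> bd (fun k => x k.+1) B.
Proof.
move=> xB N; apply: le_trans (xB N.+1); rewrite big_ord_recl lerDr.
exact: normc_ge0.
Qed.

Lemma l1_shift x : l1 x -> l1 (fun k => x k.+1).
Proof. by move=> [B xB]; exists B; apply: bd_shift. Qed.

Lemma csum_shift x : l1 x -> csum x = x 0%N + csum (fun k => x k.+1).
Proof.
move=> lx; apply: csum_eq => // e e0.
have [N h] := csumP (l1_shift lx) e0; exists N.+1 => -[//|M] /h H.
by rewrite big_ord_recl opprD addrACA subrr add0r.
Qed.

Lemma csum0 : csum (fun=> 0) = 0 :> R[i].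
Proof.
apply: csum_eq; first exact: l1_0.
by move=> e e0; exists 0%N => N _; rewrite big1 // subr0 normc0 ltW.
Qed.

Lemma csum_finite x N : (forall k, (N <= k)%N -> x k = 0) -> csum x = \sum_(k < N) x k.
Proof.
elim: N x => [|N IH] x H; first by rewrite big_ord0 -csum0; apply: csum_ext => k; rewrite H.
rewrite big_ord_recl csum_shift; last first.
  exists (\sum_(k < N.+1) normc (x k)) => M.
  have [MN|NM] := leqP M N.+1.
    rewrite -!(big_mkord xpredT (fun k => normc (x k))) [leRHS](@big_cat_nat _ _ _ M) //= lerDl.
    by rewrite sumr_ge0 // => k _; rewrite normc_ge0.
  rewrite -!(big_mkord xpredT (fun k => normc (x k))) (@big_cat_nat _ _ _ N.+1 0 M) ?(ltnW NM) //=.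
  rewrite [X in _ + X]big_nat [X in _ + X]big1 ?addr0 // => k /andP[Nk _].
  by rewrite H ?normc0 // ltnW.
by rewrite IH // => k Nk; rewrite H.
Qed.

Lemma bd_sumr (I : Type) (r : seq I) (F : I -> nat -> R[i]) (b : I -> R) :
  (forall i, bd (F i) (b i)) -> bd (fun k => \sum_(i <- r) F i k) (\sum_(i <- r) b i).
Proof.
move=> H; elim: r => [|i r IH].
  by rewrite big_nil; apply: (bd_ext bd0) => k; rewrite big_nil.
rewrite big_cons; apply: (bd_ext (bdD (H i) IH)) => k; by rewrite big_cons.
Qed.

Lemma l1_sumr (I : Type) (r : seq I) (F : I -> nat -> R[i]) :
  (forall i, l1 (F i)) -> l1 (fun k => \sum_(i <- r) F i k).
Proof.
move=> H; elim: r => [|i r IH]; first by apply: (l1_ext l1_0) => k; rewrite big_nil.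
by apply: (l1_ext (l1D (H i) IH)) => k; rewrite big_cons.
Qed.

Lemma csum_sumr (I : Type) (r : seq I) (F : I -> nat -> R[i]) :
  (forall i, l1 (F i)) -> csum (fun k => \sum_(i <- r) F i k) = \sum_(i <- r) csum (F i).
Proof.
move=> H; elim: r => [|i r IH].
  by rewrite big_nil -[RHS]csum0; apply: csum_ext => k; rewrite big_nil.
rewrite big_cons -IH -csumD //; last exact: l1_sumr.
by apply: csum_ext => k; rewrite big_cons.
Qed.

Lemma bounded_mono_cauchy (b : nat -> R) B : {homo b : N M / (N <= M)%N >-> N <= M} ->
  (forall N, b N <= B) ->
  forall e, 0 < e -> exists N0, forall N M, (N0 <= N)%N -> b M - b N <= e.
Proof.
move=> mono bB e e0.
have cv : b @ \oo --> limn b.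
  by apply: nondecreasing_is_cvgn => //; exists B => _ [N _ <-].
have ub M : b M <= limn b.
  by apply: nondecreasing_cvgn_le => //; apply/cvg_ex; exists (limn b).
have /cvgrPdist_le /(_ _ e0) [N0 _ H] := cv.
exists N0 => N M /H /= h; apply: le_trans h.
by apply: le_trans (ler_norm _); rewrite lerD2r.
Qed.

Lemma l1_tail x : l1 x -> forall e, 0 < e -> exists N0, forall N P, (N0 <= N)%N -> (N <= P)%N ->
  \sum_(N <= k < P) normc (x k) <= e.
Proof.
move=> [B xB] e e0; pose b N := \sum_(k < N) normc (x k).
have mono : {homo b : N M / (N <= M)%N >-> N <= M}.
  move=> N M NM; rewrite /b -!(big_mkord xpredT (fun k => normc (x k))).
  rewrite [leRHS](@big_cat_nat _ _ _ N) //= lerDl sumr_ge0 // => k _.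
  exact: normc_ge0.
have [N0 H] := bounded_mono_cauchy mono xB e0; exists N0 => N P NN NP.
have := H N P NN; rewrite /b -!(big_mkord xpredT (fun k => normc (x k))).
by rewrite (@big_cat_nat _ _ _ N 0 P) //= addrAC subrr add0r.
Qed.

(** ** Rearrangement of double series *)

Lemma sum_triangle (V : zmodType) (g : nat -> nat -> V) N :
  \sum_(p < N) \sum_(i < p.+1) g i (p - i)%N = \sum_(i < N) \sum_(j < N - i) g i j.
Proof.
elim: N => [|N IH]; first by rewrite !big_ord0.
rewrite big_ord_recr /= IH big_ord_recr /= [RHS]big_ord_recr /= subSnn big_ord1 subnn.
rewrite addrA -big_split /=; congr (_ + _); apply: eq_bigr => i _.
by rewrite subSn ?(ltnW (ltn_ord i)) // big_ord_recr.
Qed.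

Section Double.
Variables (g : nat -> nat -> R[i]) (B : R).
Hypothesis gB : forall N, \sum_(i < N) \sum_(j < N) normc (g i j) <= B.

Let box N := \sum_(i < N) \sum_(j < N) normc (g i j).

Lemma box_rect N M : \sum_(i < N) \sum_(j < M) normc (g i j) <= box (maxn N M).
Proof.
have S (h : nat -> R) P Q : (forall k, 0 <= h k) -> (P <= Q)%N ->
    \sum_(k < P) h k <= \sum_(k < Q) h k.
  move=> h0 PQ; rewrite -!(big_mkord xpredT h) (big_cat_nat _ PQ) //= lerDl.
  by rewrite sumr_ge0.
apply: (@le_trans _ _ (\sum_(i < N) \sum_(j < maxn N M) normc (g i j))).
  apply: ler_sum => i _; apply: (S (fun j => normc (g i j))); rewrite ?leq_maxr //.
  by move=> j; apply: normc_ge0.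
apply: (S (fun i => \sum_(j < maxn N M) normc (g i j))); rewrite ?leq_maxl // => k.
by rewrite sumr_ge0 // => j _; apply: normc_ge0.
Qed.

Lemma double_row i : bd (g i) B.
Proof.
move=> M; apply: le_trans (gB (maxn i.+1 M)); apply: le_trans (box_rect i.+1 M).
rewrite big_ord_recr /= lerDr sumr_ge0 // => k _.
by rewrite sumr_ge0 // => j _; apply: normc_ge0.
Qed.

(** For finitely many rows, the inner sums are approximated simultaneously by
    truncations of a common length. *)
Lemma double_csum : bd (fun i => csum (g i)) B.
Proof.
move=> N; apply/ler_addgt0Pl => e e0.
suff [M HM] : exists M, \sum_(i < N) normc (csum (g i)) <=
    e + \sum_(i < N) \sum_(j < M) normc (g i j).
  by apply: le_trans HM _; rewrite lerD2l; apply: le_trans (box_rect _ _) (gB _).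
suff [M HM] : exists M, forall M', (M <= M')%N -> \sum_(i < N) normc (csum (g i)) <=
    e + \sum_(i < N) \sum_(j < M') normc (g i j) by exists M; apply: HM.
elim: N e e0 => [|N IH] e e0; first by exists 0%N => M' _; rewrite !big_ord0 addr0 ltW.
have e2 : 0 < e / 2 by rewrite divr_gt0.
have [M1 h1] := IH _ e2.
have [M2 h2] := csumP (ex_intro _ _ (double_row N)) e2.
exists (maxn M1 M2) => M'; rewrite geq_max => /andP[k1 k2].
rewrite !big_ord_recr /= {1}(splitr e) addrACA lerD ?h1 //.
rewrite -[csum (g N)](subrK (\sum_(k < M') g N k)).
apply: le_trans (normcD _ _) _; rewrite lerD ?normc_sum //.
by rewrite normc_distC h2.
Qed.

Lemma triangle_bd : bd (fun p => \sum_(i < p.+1) g i (p - i)%N) B.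
Proof.
move=> N; apply: le_trans (gB N).
apply: (@le_trans _ _ (\sum_(p < N) \sum_(i < p.+1) normc (g i (p - i)%N))).
  by apply: ler_sum => p _; apply: normc_sum.
rewrite (sum_triangle (fun i j => normc (g i j))); apply: ler_sum => i _.
rewrite -!(big_mkord xpredT (fun j => normc (g i j))).
rewrite [leRHS](@big_cat_nat _ _ _ (N - i)) //= ?leq_subr // lerDl.
by rewrite sumr_ge0 // => j _; apply: normc_ge0.
Qed.

Lemma box_cauchy e : 0 < e -> exists N0, forall N M, (N0 <= N)%N -> box M - box N <= e.
Proof.
move=> e0.
have mono : {homo box : N M / (N <= M)%N >-> N <= M}.
  move=> N M NM; apply: (@le_trans _ _ (\sum_(i < N) \sum_(j < M) normc (g i j))).
    apply: ler_sum => i _; rewrite -!(big_mkord xpredT (fun j => normc (g i j))).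
    rewrite [leRHS](@big_cat_nat _ _ _ N) //= lerDl sumr_ge0 // => j _.
    exact: normc_ge0.
  by apply: le_trans (box_rect N M) _; rewrite (maxn_idPr NM).
exact: (bounded_mono_cauchy mono gB).
Qed.

(** Both iterated sums are compared with a large square, which contains the
   triangle of half its size. *)
Lemma csum_triangle :
  csum (fun i => csum (g i)) = csum (fun p => \sum_(i < p.+1) g i (p - i)%N).
Proof.
symmetry; apply: csum_eq; first by exists B; apply: triangle_bd.
move=> e e0; have e2 : 0 < e / 2 by rewrite divr_gt0.
have e4 : 0 < e / 2 / 2 by rewrite divr_gt0.
have [N1 h1] := csumP (ex_intro _ _ double_csum) e2.
have [N2 h2] := box_cauchy e4.
exists (maxn N1 (N2 + N2)) => N; rewrite geq_max => /andP[k1 k2].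
rewrite -[X in normc (X - _)](subrK (\sum_(i < N) csum (g i))) -addrA (splitr e).
apply: le_trans (normcD _ _) _; apply: lerD (h1 _ k1).
have [M HM] : exists M, forall M', (M <= M')%N ->
    normc (\sum_(i < N) (\sum_(j < M') g i j) - \sum_(i < N) csum (g i)) <= e / 2 / 2.
  move: (N) => P; elim: P (e / 2 / 2) e4 => [|P IH] d d0.
    by exists 0%N => M' _; rewrite !big_ord0 subr0 normc0 ltW.
  have d2 : 0 < d / 2 by rewrite divr_gt0.
  have [M1 H1] := IH _ d2.
  have [M2 H2] := csumP (ex_intro _ _ (double_row P)) d2.
  exists (maxn M1 M2) => M'; rewrite geq_max => /andP[l1 l2].
  rewrite !big_ord_recr /= opprD addrACA (splitr d).
  by apply: le_trans (normcD _ _) _; rewrite lerD ?H1 ?H2.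
have {}HM := HM (maxn M N) (leq_maxl _ _).
rewrite -[X in normc (X - _)](subrK (\sum_(i < N) (\sum_(j < maxn M N) g i j))) -addrA.
rewrite (splitr (e / 2)).
apply: le_trans (normcD _ _) _; apply: lerD HM.
rewrite normc_distC sum_triangle -sumrB.
set M' := maxn M N.
have NM' : (N <= M')%N by rewrite leq_maxr.
apply: le_trans (normc_sum _ _ _) _.
apply: (@le_trans _ _ (\sum_(i < N) \sum_(N - i <= j < M') normc (g i j))).
  apply: ler_sum => i _.
  rewrite -!(big_mkord xpredT (g i)) (@big_cat_nat _ _ _ (N - i) 0 M') //=; last first.
    by rewrite (leq_trans (leq_subr _ _)).
  by rewrite addrAC subrr add0r normc_sum.
apply: (le_trans _ (h2 N2 M' (leqnn _))).
rewrite lerBrDr.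
apply: (@le_trans _ _ (\sum_(i < N) \sum_(j < M') normc (g i j))); last first.
  by apply: le_trans (box_rect _ _) _; rewrite (maxn_idPr NM').
have N2N : (N2 <= N)%N by apply: leq_trans k2; rewrite leq_addr.
rewrite /box -!(big_mkord xpredT (fun i => \sum_(N - i <= j < M') normc (g i j))).
rewrite -!(big_mkord xpredT (fun i => \sum_(j < N2) normc (g i j))).
rewrite -!(big_mkord xpredT (fun i => \sum_(j < M') normc (g i j))).
rewrite (@big_cat_nat _ _ _ N2 0 N) //= [leRHS](@big_cat_nat _ _ _ N2 0 N) //=.
rewrite addrAC lerD //.
  rewrite -big_split /= !big_nat; apply: ler_sum => i /andP[_ iN2].
  rewrite -!(big_mkord xpredT (fun j => normc (g i j))).
  have a1 : (N - i <= M')%N by rewrite (leq_trans (leq_subr _ _)).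
  rewrite [leRHS](@big_cat_nat _ _ _ (N - i)) //= addrC lerD2r.
  have a2 : (N2 <= N - i)%N.
    by rewrite leq_subRL ?(leq_trans (ltnW iN2)) // (leq_trans _ k2) // leq_add2r ltnW.
  rewrite [leRHS](@big_cat_nat _ _ _ N2) //= lerDl sumr_ge0 // => j _.
  exact: normc_ge0.
apply: ler_sum => i _.
rewrite -!(big_mkord xpredT (fun j => normc (g i j))).
have a1 : (N - i <= M')%N by rewrite (leq_trans (leq_subr _ _)).
rewrite [leRHS](@big_cat_nat _ _ _ (N - i)) //= lerDr sumr_ge0 // => j _.
exact: normc_ge0.
Qed.

End Double.

Lemma csum_exchange (g : nat -> nat -> R[i]) (B : R) :
  (forall N, \sum_(i < N) \sum_(j < N) normc (g i j) <= B) ->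
  csum (fun i => csum (g i)) = csum (fun j => csum (fun i => g i j)).
Proof.
move=> gB; rewrite (csum_triangle gB) (@csum_triangle (fun j i => g i j) B).
  apply: csum_ext => p; rewrite (reindex_inj rev_ord_inj) /=.
  by apply: eq_bigr => i _; rewrite subSS subKn // -ltnS.
by move=> N; rewrite exchange_big.
Qed.

End Series.

Global Opaque csum.

(** * Convolution, correlation and the operators of the Lax pair *)

Section Operators.
Variable R : realType.
Implicit Types (x y z u v w f : nat -> R[i]) (A B : R).

Definition convol x y : nat -> R[i] := fun n => \sum_(i < n.+1) x i * y (n - i)%N.
Definition dot x y : R[i] := csum (fun r => x r * (y r)^*).
Definition tl n x : nat -> R[i] := fun k => x (n + k)%N.
(** The coefficients of nonnegative index of the product of the series [y] with the
    conjugate of [x] on the unit circle: the Toeplitz operator with symbol conj(x). *)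
Definition corr x y : nat -> R[i] := fun n => dot (tl n y) x.
Definition sh x : nat -> R[i] := fun k => x k.+1.
Definition delta0 : nat -> R[i] := fun k => (k == 0%N)%:R.

Lemma bd_mul x y A B : bd x A -> (forall k, normc (y k) <= B) -> bd (fun k => x k * y k) (A * B).
Proof.
move=> xA yB N; apply: (@le_trans _ _ ((\sum_(k < N) normc (x k)) * B)).
  rewrite mulr_suml; apply: ler_sum => k _; rewrite normcM ler_wpM2l //.
  exact: normc_ge0.
by rewrite ler_wpM2r // (le_trans (normc_ge0 _) (yB 0%N)).
Qed.

Lemma l1_mul x y : l1 x -> l1 y -> l1 (fun k => x k * y k).
Proof. by move=> [A xA] [B yB]; exists (A * B); apply: bd_mul => // k; apply: bd_coord. Qed.

Lemma l1_mulJ x y : l1 x -> l1 y -> l1 (fun k => x k * (y k)^*).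
Proof. by move=> lx /l1_conj; apply: l1_mul. Qed.

Lemma bd_tl n x B : bd x B -> bd (tl n x) B.
Proof.
move=> xB N; rewrite /tl.
have := bd_sum_nat n (n + N)%N xB; rewrite -{1}(add0n n) big_addn addnC addnK big_mkord.
by under eq_bigr do rewrite addnC.
Qed.

Lemma l1_tl n x : l1 x -> l1 (tl n x).
Proof. by move=> [B xB]; exists B; apply: bd_tl. Qed.

Lemma bd_sh x B : bd x B -> bd (sh x) B.
Proof. exact: bd_shift. Qed.
Lemma l1_sh x : l1 x -> l1 (sh x).
Proof. exact: l1_shift. Qed.

Lemma bd_conv x y A B : bd x A -> bd y B -> bd (convol x y) (A * B).
Proof.
move=> xA yB; apply: (@triangle_bd _ (fun i j => x i * y j)) => N.
under eq_bigr => i _ do under eq_bigr do rewrite normcM.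
under eq_bigr do rewrite -mulr_sumr.
rewrite -mulr_suml ler_pM ?sumr_ge0 // => i _; exact: normc_ge0.
Qed.

Lemma l1_conv x y : l1 x -> l1 y -> l1 (convol x y).
Proof. by move=> [A xA] [B yB]; exists (A * B); apply: bd_conv. Qed.

Lemma corr_box x y A B : bd x A -> bd y B -> forall N,
  \sum_(n < N) \sum_(r < N) normc (tl n y r * (x r)^*) <= A * B.
Proof.
move=> xA yB N; rewrite exchange_big /=.
apply: (@le_trans _ _ (\sum_(r < N) normc (x r) * B)); last first.
  by rewrite -mulr_suml ler_wpM2r // (bd_ge0 yB).
apply: ler_sum => r _; under eq_bigr do rewrite normcM normc_conj mulrC /tl addnC.
by rewrite -mulr_sumr ler_wpM2l ?normc_ge0 // (bd_tl r yB).
Qed.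

Lemma bd_corr x y A B : bd x A -> bd y B -> bd (corr x y) (A * B).
Proof.
move=> xA yB; apply: (@double_csum _ (fun n r => tl n y r * (x r)^*)).
exact: corr_box.
Qed.

Lemma l1_corr x y : l1 x -> l1 y -> l1 (corr x y).
Proof. by move=> [A xA] [B yB]; exists (A * B); apply: bd_corr. Qed.

(** ** The sesquilinear pairing *)

Lemma dotC x y : l1 x -> l1 y -> dot x y = (dot y x)^*.
Proof.
move=> lx ly; rewrite -csum_conj; last exact: l1_mulJ.
by apply: csum_ext => k; rewrite rmorphM /= conjcK mulrC.
Qed.

Lemma dotDl x y z : l1 x -> l1 y -> l1 z -> dot (x + y) z = dot x z + dot y z.
Proof.
move=> lx ly lz; rewrite -csumD; try exact: l1_mulJ.
by apply: csum_ext => k; rewrite -mulrDl.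
Qed.

Lemma dotZl c x y : l1 x -> l1 y -> dot (c *: x) y = c * dot x y.
Proof.
move=> lx ly; rewrite -csumZ; last exact: l1_mulJ.
by apply: csum_ext => k; rewrite mulrA.
Qed.

Lemma dot0l x : dot 0 x = 0.
Proof. by rewrite /dot -[RHS]csum0; apply: csum_ext => k; rewrite mul0r. Qed.

Lemma dot0r x : dot x 0 = 0.
Proof. by rewrite /dot -[RHS]csum0; apply: csum_ext => k; rewrite conjc0 mulr0. Qed.

Lemma dotNl x y : l1 x -> l1 y -> dot (- x) y = - dot x y.
Proof. by move=> lx ly; rewrite -scaleN1r dotZl // mulN1r. Qed.

Lemma dotBl x y z : l1 x -> l1 y -> l1 z -> dot (x - y) z = dot x z - dot y z.
Proof. by move=> lx ly lz; rewrite dotDl ?dotNl //; exact: l1N. Qed.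

Lemma dotDr x y z : l1 x -> l1 y -> l1 z -> dot z (x + y) = dot z x + dot z y.
Proof.
move=> lx ly lz; rewrite dotC ?dotDl ?rmorphD //=; last exact: l1_add.
by rewrite -!dotC.
Qed.

Lemma dotZr c x y : l1 x -> l1 y -> dot x (c *: y) = c^* * dot x y.
Proof.
move=> lx ly; rewrite dotC ?dotZl ?rmorphM //=; last exact: l1_scale.
by rewrite -dotC.
Qed.

Lemma dotBr x y z : l1 x -> l1 y -> l1 z -> dot z (x - y) = dot z x - dot z y.
Proof.
move=> lx ly lz; rewrite dotC ?dotBl ?rmorphB //=; last exact: l1_sub.
by rewrite -!dotC.
Qed.

Lemma dot_sqr_ge x N : l1 x -> \sum_(k < N) normc (x k) ^+ 2 <= complex.Re (dot x x).
Proof.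
move=> lx; apply/ler_addgt0Pl => e e0; have [M HM] := csumP (l1_mulJ lx lx) e0.
have := HM (maxn M N) (leq_maxl _ _).
have E : \sum_(k < maxn M N) x k * (x k)^* = (\sum_(k < maxn M N) normc (x k) ^+ 2)%:C.
  by rewrite rmorph_sum; apply: eq_bigr => k _; rewrite mulc_conj.
rewrite E -/(dot x x) => H.
have := le_trans (ler_norm _) (le_trans (Re_le_normc _) H); rewrite ReB /= => {}H.
apply: (@le_trans _ _ (\sum_(k < maxn M N) normc (x k) ^+ 2)); last by rewrite -lerBlDr.
rewrite -!(big_mkord xpredT (fun k => normc (x k) ^+ 2)).
rewrite [leRHS](@big_cat_nat _ _ _ N) ?leq_maxr //= lerDl sumr_ge0 // => k _.
exact: sqr_ge0.
Qed.

Lemma dot_sqr_real x : l1 x -> dot x x = (complex.Re (dot x x))%:C.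
Proof.
move=> lx; have := dotC lx lx; case: (dot x x) => a b [] /eqP.
rewrite -addr_eq0 -mulr2n mulrn_eq0 /= => /eqP ->.
by [].
Qed.

Lemma dot_sqr_ge0 x : l1 x -> 0 <= complex.Re (dot x x).
Proof. by move=> lx; have := dot_sqr_ge 0 lx; rewrite big_ord0. Qed.

Lemma dot_eq0 x : l1 x -> dot x x = 0 -> x = 0.
Proof.
move=> lx H; apply/funext => k; apply/eqP; rewrite -normc_eq0 -sqrf_eq0 eq_le sqr_ge0 andbT.
have := dot_sqr_ge k.+1 lx; rewrite H /= big_ord_recr /=; apply: le_trans.
by rewrite lerDr sumr_ge0 // => i _; rewrite sqr_ge0.
Qed.

(** ** Algebra of convolutions and correlations *)

Lemma convolC x y : convol x y = convol y x.
Proof.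
apply/funext => n; rewrite /convol (reindex_inj rev_ord_inj) /=.
by apply: eq_bigr => i _; rewrite subSS subKn -1?ltnS // mulrC.
Qed.

Lemma conv_shift x y n : convol x y n.+1 = convol x (sh y) n + x n.+1 * y 0%N.
Proof.
rewrite /convol big_ord_recr /= subnn; congr (_ + _); apply: eq_bigr => i _.
by rewrite /sh subSn // -ltnS.
Qed.

Lemma convolDr x y z : convol x (y + z) = convol x y + convol x z.
Proof.
apply/funext => n; rewrite /convol -[RHS]/(_ n + _ n) /convol -big_split /=.
by apply: eq_bigr => i _; rewrite -mulrDr.
Qed.

Lemma convolZr c x y : convol x (c *: y) = c *: convol x y.
Proof.
apply/funext => n; rewrite /convol -[RHS]/(c * _ n) /convol mulr_sumr.
by apply: eq_bigr => i _; rewrite mulrCA.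
Qed.

Lemma convolDl x y z : convol (x + y) z = convol x z + convol y z.
Proof. by rewrite convolC convolDr !(convolC z). Qed.
Lemma convolZl c x y : convol (c *: x) y = c *: convol x y.
Proof. by rewrite convolC convolZr (convolC y). Qed.

Lemma tl_corr n x y : tl n (corr x y) = corr x (tl n y).
Proof.
by apply/funext => k; apply: csum_ext => r; rewrite /tl addnA.
Qed.

Lemma sh_corr x y : sh (corr x y) = corr x (sh y).
Proof. by apply/funext => k. Qed.

Lemma corrDr x y z : l1 x -> l1 y -> l1 z -> corr x (y + z) = corr x y + corr x z.
Proof. by move=> lx ly lz; apply/funext => n; apply: dotDl => //; exact: l1_tl. Qed.
Lemma corrZr c x y : l1 x -> l1 y -> corr x (c *: y) = c *: corr x y.
Proof. by move=> lx ly; apply/funext => n; apply: dotZl => //; exact: l1_tl. Qed.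
Lemma corrBr x y z : l1 x -> l1 y -> l1 z -> corr x (y - z) = corr x y - corr x z.
Proof. by move=> lx ly lz; apply/funext => n; apply: dotBl => //; exact: l1_tl. Qed.
Lemma corrDl x y z : l1 x -> l1 y -> l1 z -> corr (x + y) z = corr x z + corr y z.
Proof. by move=> lx ly lz; apply/funext => n; apply: dotDr => //; exact: l1_tl. Qed.
Lemma corrBl x y z : l1 x -> l1 y -> l1 z -> corr (x - y) z = corr x z - corr y z.
Proof. by move=> lx ly lz; apply/funext => n; apply: dotBr => //; exact: l1_tl. Qed.
Lemma corrZl c x y : l1 x -> l1 y -> corr (c *: x) y = c^* *: corr x y.
Proof. by move=> lx ly; apply/funext => n; apply: dotZr => //; exact: l1_tl. Qed.

(** Both sides sum the terms [x_j w_l conj(f_(l + j))], the left one by antidiagonals. *)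
Lemma dot_conv x w f : l1 x -> l1 w -> l1 f -> dot (convol x w) f = dot w (corr x f).
Proof.
move=> [A xA] [B wB] lf; have [F fF] := lf.
set g := fun j l => x j * w l * (f (l + j)%N)^*.
have gB N : \sum_(j < N) \sum_(l < N) normc (g j l) <= A * B * F.
  apply: (@le_trans _ _ (\sum_(j < N) \sum_(l < N) normc (x j) * (normc (w l) * F))).
    apply: ler_sum => j _; apply: ler_sum => l _.
    rewrite /g !normcM normc_conj -mulrA ler_wpM2l ?normc_ge0 //.
    by rewrite ler_wpM2l ?normc_ge0 // (bd_coord _ fF).
  under eq_bigr do rewrite -mulr_sumr -mulr_suml.
  rewrite -mulr_suml -mulrA ler_pM // ?mulr_ge0 ?sumr_ge0 ?(bd_ge0 fF) //.
  - by move=> i _; apply: normc_ge0.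
  - by move=> i _; apply: normc_ge0.
  by rewrite ler_wpM2r // (bd_ge0 fF).
transitivity (csum (fun p => \sum_(i < p.+1) g i (p - i)%N)).
  apply: csum_ext => p; rewrite /convol mulr_suml; apply: eq_bigr => i _.
  by rewrite /g subnK // -ltnS.
rewrite -(csum_triangle gB) (csum_exchange gB); apply: csum_ext => l.
have -> : (corr x f l)^* = csum (fun k => (tl l f k * (x k)^*)^*).
  by rewrite csum_conj //; apply: l1_mulJ; [exact: l1_tl|exists A].
rewrite -csumZ; last by apply/l1_conj/l1_mulJ; [exact: l1_tl|exists A].
apply: csum_ext => j; rewrite /g /tl rmorphM /= conjcK; ring.
Qed.

Lemma corr_corr x y w : l1 x -> l1 y -> l1 w -> corr x (corr y w) = corr (convol x y) w.
Proof.
move=> lx ly lw; apply/funext => n; rewrite /corr -/(corr y w) tl_corr.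
have lt : l1 (tl n w) by apply: l1_tl.
rewrite dotC //; last exact: l1_corr.
rewrite -dot_conv // -dotC ?(convolC x) //; exact: l1_conv.
Qed.

(** A product is split according to whether the index in [u] exceeds [n]. *)
Lemma conv_split u v n m :
  convol u v (n + m.+1)%N =
  \sum_(i < n.+1) u i * v (n - i + m.+1)%N + convol v (tl n.+1 u) m.
Proof.
rewrite [convol v (tl _ _)]convolC /convol.
rewrite -(big_mkord xpredT (fun i => u i * v (n + m.+1 - i)%N)).
rewrite (@big_cat_nat _ _ _ n.+1) //=; last by rewrite ltnS leq_addr.
rewrite big_mkord; congr (_ + _).
  by apply: eq_bigr => i _; rewrite addnC [in RHS]addnC addnBA // -ltnS.
rewrite -{1}(add0n n.+1) big_addn.
have -> : ((n + m.+1).+1 - n.+1 = m.+1)%N by rewrite subSS addKn.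
rewrite big_mkord; apply: eq_bigr => i _; rewrite /tl addnC; congr (_ * v _).
by rewrite -addSnnS subnDl.
Qed.

(** Moving the product past the correlation, frequency by frequency: the low
    frequencies of [u] simply factor out, its high ones form a Hankel term. *)
Lemma corr_sh_conv x u v : l1 x -> l1 u -> l1 v ->
  corr x (sh (convol u v)) = convol u (corr x (sh v)) + corr (corr v x) (sh u).
Proof.
move=> lx lu lv; apply/funext => n.
have lt := l1_tl n.+1 lu; have lxv := l1_corr lv lx.
transitivity (\sum_(i < n.+1) u i * corr x (sh v) (n - i)%N + dot (tl n.+1 u) (corr v x)) => //.
have L i : l1 (fun m => v (n - i + m.+1)%N * (x m)^*).
  apply: l1_mulJ lx; apply: (l1_ext (l1_tl (n - i).+1 lv)) => m.
  by rewrite /tl addSnnS.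
rewrite -dot_conv //.
transitivity (csum (fun m => (\sum_(i < n.+1) u i * (v (n - i + m.+1)%N * (x m)^*))
   + convol v (tl n.+1 u) m * (x m)^*)).
  apply: csum_ext => m; rewrite /tl /sh -addnS conv_split mulrDl mulr_suml; congr (_ + _).
  by apply: eq_bigr => i _; rewrite mulrA.
rewrite csumD; last by apply: l1_mulJ lx; apply: l1_conv.
  congr (_ + _); rewrite csum_sumr => [|i]; last exact: l1Z.
  apply: eq_bigr => i _; rewrite csumZ //; congr (_ * _).
  by apply: csum_ext => m; rewrite /tl /sh addnS.
by apply: l1_sumr => i; exact: l1Z.
Qed.

(** The commutator of a multiplication with a Toeplitz operator is a product of two
    Hankel operators. *)
Lemma corr_conv u v x : l1 u -> l1 v -> l1 x ->
  corr u (convol v x) = convol v (corr u x) + corr (corr x (sh u)) (sh v).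
Proof.
move=> lu lv lx; apply/funext => n.
have lt := l1_tl n.+1 lv; have lxu := l1_corr lx (l1_sh lu).
transitivity (\sum_(i < n.+1) v i * corr u x (n - i)%N + dot (tl n.+1 v) (corr x (sh u))) => //.
rewrite -dot_conv //; last exact: l1_sh.
have L i : l1 (fun m => x (n - i + m)%N * (u m)^*).
  by apply: l1_mulJ lu; apply: l1_tl.
have lc : l1 (fun r => tl n (convol v x) r * (u r)^*).
  by apply: l1_mulJ lu; apply/l1_tl/l1_conv.
rewrite /corr /dot (csum_shift lc).
transitivity ((\sum_(i < n.+1) v i * (x (n - i)%N * (u 0%N)^*)) +
  csum (fun m => (\sum_(i < n.+1) v i * (x (n - i + m.+1)%N * (u m.+1)^*))
   + convol x (tl n.+1 v) m * (u m.+1)^*)).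
  congr (_ + _).
    rewrite /tl addn0 /convol mulr_suml; by apply: eq_bigr => i _; rewrite mulrA.
  apply: csum_ext => m; rewrite /tl conv_split mulrDl mulr_suml; congr (_ + _).
  by apply: eq_bigr => i _; rewrite mulrA.
have L' i : l1 (fun m => v i * (x (n - i + m.+1)%N * (u m.+1)^*)).
  by apply/l1Z/(l1_shift (L i)).
rewrite csumD; last by apply: l1_mulJ; [apply: l1_conv|apply: l1_sh].
  rewrite addrA; congr (_ + _); rewrite csum_sumr => [|i]; last exact: L'.
  rewrite -big_split /=; apply: eq_bigr => i _; rewrite csumZ; last exact: (l1_shift (L i)).
  by rewrite -mulrDr (csum_shift (L i)) /tl addn0.
by apply: l1_sumr => i; exact: L'.
Qed.

(** ** The operators H_u, K_u and the Toeplitz operator of symbol |u|^2 *)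

Definition Hop u x := corr x u.
Definition Kop u x := corr x (sh u).
Definition Top u x := corr u (convol u x).

Lemma bd_delta0 : bd delta0 1.
Proof.
move=> [|N]; first by rewrite big_ord0.
rewrite big_ord_recl big1 ?addr0; first by rewrite normc1.
by move=> i _; rewrite /delta0 /= normc0.
Qed.

Lemma l1_delta0 : l1 delta0. Proof. by exists 1; apply: bd_delta0. Qed.

Lemma conv_delta0 x : convol x delta0 = x.
Proof.
apply/funext => n; rewrite /convol big_ord_recr /= subnn /delta0 mulr1 big1 ?add0r // => i _.
by rewrite subn_eq0 leqNgt ltn_ord mulr0.
Qed.

Lemma dot_delta0 x : dot x delta0 = x 0%N.
Proof.
rewrite /dot (csum_finite (N := 1)); first by rewrite big_ord1 /delta0 conjc_nat mulr1.
by move=> [//|k] _; rewrite /delta0 conjc_nat mulr0.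
Qed.

Section Fixed.
Variable u : nat -> R[i].
Hypothesis lu : l1 u.
Let lsu := l1_sh lu.
Local Notation H := (Hop u).
Local Notation K := (Kop u).
Local Notation T := (Top u).

Lemma l1_Hop x : l1 x -> l1 (H x). Proof. by move=> lx; apply: l1_corr. Qed.
Lemma l1_Kop x : l1 x -> l1 (K x). Proof. by move=> lx; apply: l1_corr. Qed.
Lemma l1_Top x : l1 x -> l1 (T x). Proof. by move=> lx; apply/l1_corr/l1_conv. Qed.
Hint Resolve l1_Hop l1_Kop l1_Top : core.

Lemma KopD x y : l1 x -> l1 y -> K (x + y) = K x + K y.
Proof. by move=> lx ly; apply: corrDl. Qed.
Lemma KopB x y : l1 x -> l1 y -> K (x - y) = K x - K y.
Proof. by move=> lx ly; apply: corrBl. Qed.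
Lemma KopZ c x : l1 x -> K (c *: x) = c^* *: K x.
Proof. by move=> lx; apply: corrZl. Qed.
Lemma HopZ c x : l1 x -> H (c *: x) = c^* *: H x.
Proof. by move=> lx; apply: corrZl. Qed.
Lemma TopD x y : l1 x -> l1 y -> T (x + y) = T x + T y.
Proof. by move=> lx ly; rewrite /Top convolDr corrDr //; exact: l1_conv. Qed.
Lemma TopZ c x : l1 x -> T (c *: x) = c *: T x.
Proof. by move=> lx; rewrite /Top convolZr corrZr //; exact: l1_conv. Qed.
Lemma TopB x y : l1 x -> l1 y -> T (x - y) = T x - T y.
Proof. by move=> lx ly; rewrite -scaleN1r TopD ?TopZ ?scaleN1r //; exact: l1N. Qed.

Lemma Kop0 : K 0 = 0.
Proof. by apply/funext => n; exact: dot0r. Qed.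
Lemma Hop0 : H 0 = 0.
Proof. by apply/funext => n; exact: dot0r. Qed.

Lemma Kop_sym x y : l1 x -> l1 y -> dot (K x) y = dot (K y) x.
Proof.
move=> lx ly; rewrite -[LHS]/(corr y (corr x (sh u)) 0) -[RHS]/(corr x (corr y (sh u)) 0).
by rewrite !corr_corr // convolC.
Qed.

Lemma Kop2_sym x y : l1 x -> l1 y -> dot (K (K x)) y = dot x (K (K y)).
Proof.
move=> lx ly; have lKx := l1_Kop lx; have lKy := l1_Kop ly.
by rewrite Kop_sym // dotC // Kop_sym // -dotC //; exact: l1_Kop.
Qed.

Lemma Top_sym x y : l1 x -> l1 y -> dot (T x) y = dot x (T y).
Proof.
move=> lx ly; have lcx := l1_conv lu lx; have lcy := l1_conv lu ly.
by rewrite dotC -?dot_conv // -?dotC // ?dot_conv //; apply: l1_Top.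
Qed.

(** The commutator of multiplication by [u] with its adjoint. *)
Lemma Kop2E x : l1 x -> convol u (corr u x) = T x - K (K x).
Proof. by move=> lx; rewrite /Top corr_conv // addrK. Qed.

Lemma Top_delta0 : T delta0 = H u.
Proof. by rewrite /Top conv_delta0. Qed.

(** With [w = T u] this is the Lax equation satisfied by [K_u] along the flow. *)
Lemma Kop_Lax x : l1 x -> Kop (T u) x = T (K x) + K (T x) - K (K (K x)).
Proof.
move=> lx; have lux := l1_corr lu lx; have lcu := l1_conv lu lu.
rewrite /Kop /Top sh_corr corr_corr //; last exact: l1_sh.
rewrite convolC -corr_corr //; last exact: l1_sh.
rewrite corr_sh_conv // corrDr //; try by [apply: l1_conv => //; apply: l1_corr|apply: l1_corr].
rewrite -addrA; congr (_ + _).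
rewrite [LHS]corr_corr //.
by rewrite Kop2E // -/(K _) KopB //; auto.
Qed.

Lemma HopE x : l1 x -> H x = (x 0%N)^* *: u + K (sh x).
Proof.
move=> lx; apply/funext => n.
have l : l1 (fun r => tl n u r * (x r)^*) by apply: l1_mulJ => //; apply: l1_tl.
rewrite -[LHS]/(csum _) (csum_shift l) /tl addn0 mulrC; congr (_ + _).
by apply: csum_ext => k; rewrite /tl /sh addnS.
Qed.

Lemma sh_Hop x : sh (H x) = K x.
Proof. exact: sh_corr. Qed.

Lemma Hop2E x : l1 x -> H (H x) = dot x u *: u + K (K x).
Proof.
move=> lx; rewrite HopE; last exact: l1_Hop.
by rewrite sh_Hop -[H x 0%N]/(dot u x) -dotC.
Qed.

(** Together with the symmetry of [T], this expresses the coefficient [(T f | 1)] by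
    [(f | u)] and [(K^2 f | 1)]. *)
Lemma Top_delta0E : T delta0 = (u 0%N)^* *: u + K (K delta0).
Proof.
rewrite Top_delta0 HopE //; congr (_ + _).
by congr (K _); rewrite -sh_Hop /Hop; congr sh; rewrite -[LHS](conv_delta0 u); apply/funext => n;
  rewrite /corr dot_delta0 conv_delta0 /tl addn0.
Qed.

(** The backward shift commutes with [T] up to rank one, and with [K^2] up to rank two
    ([Kop2_sh]); the defects vanish on the sequences orthogonal to [u] and to the
    constants. *)
Lemma sh_Top x : l1 x -> sh (T x) = T (sh x) + x 0%N *: K u.
Proof.
move=> lx; rewrite /Top sh_corr.
have -> : sh (convol u x) = convol u (sh x) + x 0%N *: sh u.
  by apply/funext => n; rewrite /sh conv_shift mulrC.
rewrite corrDr ?corrZr //; last by apply: l1_scale.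
exact/l1_conv/l1_sh.
Qed.

Lemma Kop2_sh x : l1 x ->
  K (K (sh x)) = sh (K (K x)) + dot x u *: sh u - x 0%N *: K u.
Proof.
move=> lx; have lsx := l1_sh lx; have lHx := l1_Hop lx.
have -> : K (sh x) = H x - (x 0%N)^* *: u by rewrite HopE // addrC addKr.
rewrite KopB //; last exact: l1_scale.
rewrite KopZ // conjcK; congr (_ - _).
by rewrite -sh_Hop Hop2E // addrC.
Qed.

End Fixed.

End Operators.

(** * Eigenspaces of K_u^2 *)

Section Eigenspaces.
Variables (R : realType) (u : nat -> R[i]) (s2 : R).
Hypotheses (lu : l1 u) (s2_gt0 : 0 < s2).
Implicit Types (x y z f g a : nat -> R[i]).
Local Notation H := (Hop u).
Local Notation K := (Kop u).

Definition eigK x : Prop := l1 x /\ K (K x) = s2%:C *: x.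

Let s2C : s2%:C != 0 :> R[i].
Proof. by rewrite (eq_complex (s2%:C) 0) /= eqxx andbT gt_eqF. Qed.

Lemma eigK_l1 x : eigK x -> l1 x. Proof. by case. Qed.

Lemma eigK_scale c x : eigK x -> eigK (c *: x).
Proof.
move=> [lx Kx]; split; first exact: l1_scale.
by rewrite !KopZ //; [rewrite conjcK Kx !scalerA mulrC|exact: l1_Kop].
Qed.

Lemma eigK_add x y : eigK x -> eigK y -> eigK (x + y).
Proof.
move=> [lx Kx] [ly Ky]; split; first exact: l1_add.
by rewrite !KopD //; [rewrite Kx Ky scalerDr|exact: l1_Kop|exact: l1_Kop].
Qed.

Lemma eigK_sub x y : eigK x -> eigK y -> eigK (x - y).
Proof. by move=> Fx Fy; rewrite -scaleN1r; apply/eigK_add/eigK_scale. Qed.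

Lemma eigK_Kop x : eigK x -> eigK (K x).
Proof.
move=> [lx Kx]; split; first exact: l1_Kop.
by rewrite Kx KopZ // conjc_real.
Qed.

Lemma eigK_0 : eigK 0.
Proof. by split; [exact: l1_0|rewrite !Kop0 scaler0]. Qed.

(** Let [F = ker (K^2 - s2)]. If [f] in [F] is orthogonal to [u], then [H^2 f = s2 f],
    so [H f] is an eigenvector of [H^2 = K^2 + ( . | u) u] as well. Pairing it with [a]
    in [F] gives [(H f | u) (u | a) = 0], and [(H f | u)] is conjugate to [(u | H f)],
    the coefficient of index zero of [H^2 f]. *)
Lemma eigK_vanish a f : eigK a -> dot u a != 0 -> eigK f -> dot f u = 0 -> f 0%N = 0.
Proof.
move=> [la Ka] ua [lf Kf] fu.
have lHf := l1_Hop lu lf.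
have HHf : H (H f) = s2%:C *: f by rewrite Hop2E // fu scale0r add0r.
have HHg : H (H (H f)) = s2%:C *: H f by rewrite HHf HopZ // conjc_real.
have : s2%:C * f 0%N = 0; last by move/eqP; rewrite mulf_eq0 (negPf s2C) => /eqP.
rewrite -[s2%:C * f 0%N]/((s2%:C *: f) 0%N) -HHf -[LHS]/(dot u (H f)).
apply/eqP; rewrite dotC // conjc_eq0.
have E := Hop2E lu lHf; rewrite HHg in E.
have := Kop2_sym lu lHf la; rewrite Ka dotZr // conjc_real.
have -> : K (K (H f)) = s2%:C *: H f - dot (H f) u *: u by rewrite E addrC addKr.
rewrite dotBl ?dotZl //; try exact: l1_scale.
move/eqP; rewrite -subr_eq0 addrAC subrr add0r oppr_eq0 mulf_eq0 (negPf ua) orbF.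
by [].
Qed.

(** Both defects in the commutator of the backward shift with [K^2] vanish on [f]. *)
Lemma eigK_sh f : eigK f -> dot f u = 0 -> f 0%N = 0 -> eigK (sh f).
Proof.
move=> [lf Kf] fu f0; split; first exact: l1_sh.
by rewrite Kop2_sh // fu f0 !scale0r addr0 subr0 Kf.
Qed.

Definition eigH x : Prop := l1 x /\ H (H x) = s2%:C *: x.

(** If [u] is orthogonal to [F], then [H^2 = K^2] on [F]. Were [u] also orthogonal to
    [H f] for all nonzero [f] in [F], then every element of [F] would vanish at
    frequency zero, so that [F] would be stable by the backward shift, and all the
    coefficients of [x] would vanish. *)
Lemma eigH_dominant x : eigK x -> x <> 0 -> (forall f, eigK f -> dot f u = 0) ->
  exists f, [/\ eigH f, eigH (H f), f <> 0, dot f u = 0 & dot (H f) u != 0].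
Proof.
move=> Fx x0 uF; apply: contrapT => /forallNP N.
have EF f : eigK f -> H (H f) = s2%:C *: f.
  by move=> Ff; case: (Ff) => lf Kf; rewrite Hop2E // uF // scale0r add0r.
have Z f : eigK f -> f 0%N = 0.
  move=> Ff; case: (Ff) => lf Kf.
  have : s2%:C * f 0%N = 0; last by move/eqP; rewrite mulf_eq0 (negPf s2C) => /eqP.
  rewrite -[s2%:C * f 0%N]/((s2%:C *: f) 0%N) -EF // -[LHS]/(dot u (H f)).
  have lHf := l1_Hop lu lf.
  apply/eqP; rewrite dotC // conjc_eq0; apply: contrapT => /negP h.
  have [E|f0] := pselect (f = 0).
    by move: h; rewrite E Hop0 dot0l // eqxx.
  apply: (N f); split => //; [by split; rewrite ?EF| |exact: uF].
  by split; rewrite // (EF f Ff) HopZ // conjc_real.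
have S n : forall f, eigK f -> eigK (iter n (@sh R) f).
  elim: n => [//|n IH] f Ff /=; apply: eigK_sh; [exact: IH|exact/uF/IH|exact/Z/IH].
apply: x0; apply/funext => n; have := Z _ (S n _ Fx).
suff -> : forall k, iter n (@sh R) x k = x (n + k)%N by rewrite addn0.
by elim: (n) => [//|m IH] k; rewrite /= /sh IH addSnnS.
Qed.

(** ** Orthogonal projection on an eigenspace *)

Definition orthonormal (e : nat -> nat -> R[i]) N : Prop :=
  forall i j, (i < N)%N -> (j < N)%N -> dot (e i) (e j) = (i == j)%:R.

Lemma l1_sumZ N (c : nat -> R[i]) (e : nat -> nat -> R[i]) : (forall i, (i < N)%N -> l1 (e i)) ->
  l1 (\sum_(i < N) c i *: e i).
Proof.
elim: N => [|N IH] le; first by rewrite big_ord0; exact: l1_0.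
rewrite big_ord_recr /=; apply: l1_add; first by apply: IH => i iN; apply/le/ltnW.
exact/l1_scale/le.
Qed.

Lemma dot_sumZl N (c : nat -> R[i]) (e : nat -> nat -> R[i]) x :
  (forall i, (i < N)%N -> l1 (e i)) -> l1 x ->
  dot (\sum_(i < N) c i *: e i) x = \sum_(i < N) c i * dot (e i) x.
Proof.
elim: N => [|N IH] le lx.
  by rewrite !big_ord0 dot0l.
have le' i : (i < N)%N -> l1 (e i) by move=> iN; apply/le/ltnW.
rewrite !big_ord_recr /= dotDl //; last by apply/l1_scale/le.
  by rewrite IH // dotZl //; exact: le.
exact: l1_sumZ.
Qed.

Lemma dot_proj (e : nat -> nat -> R[i]) N x j : (forall i, (i < N)%N -> l1 (e i)) ->
  orthonormal e N -> l1 x -> (j < N)%N ->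
  dot (x - \sum_(i < N) dot x (e i) *: e i) (e j) = 0.
Proof.
move=> le on lx jN.
have lj := le _ jN.
rewrite dotBl //; last exact: (@l1_sumZ N (fun i => dot x (e i))).
rewrite (@dot_sumZl N (fun i => dot x (e i))) //.
rewrite (bigD1 (Ordinal jN)) //= on // eqxx mulr1 big1 ?addr0 ?subrr // => i /negPf ij.
by rewrite on // -[(_ == j :> nat)]/(i == Ordinal jN) ij mulr0.
Qed.

Lemma bessel (e : nat -> nat -> R[i]) N x : (forall i, (i < N)%N -> l1 (e i)) ->
  orthonormal e N -> l1 x ->
  \sum_(i < N) normc (dot x (e i)) ^+ 2 <= complex.Re (dot x x).
Proof.
move=> le on lx; set p := \sum_(i < N) dot x (e i) *: e i.
have lp : l1 p by apply: (@l1_sumZ N (fun i => dot x (e i))).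
have lxp : l1 (x - p) by apply: l1_sub.
have := dot_sqr_ge0 lxp.
have xpp : dot (x - p) p = 0.
  rewrite dotC // /p (@dot_sumZl N (fun i => dot x (e i))) // big1 ?conjc0 // => i _.
  by rewrite (dotC (le _ (ltn_ord i)) lxp) dot_proj // conjc0 mulr0.
rewrite dotBr // xpp subr0 dotBl // ReB subr_ge0; apply: le_trans.
rewrite /p (@dot_sumZl N (fun i => dot x (e i))) // Re_sum ler_sum // => i _.
by rewrite (dotC (le _ _)) // mulc_conj.
Qed.

Lemma dot_sumr_le N (F : nat -> nat -> R[i]) C : (forall i, (i < N)%N -> l1 (F i)) ->
  (forall P, \sum_(i < N) \sum_(n < P) normc (F i n) ^+ 2 <= C) ->
  \sum_(i < N) complex.Re (dot (F i) (F i)) <= C.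
Proof.
move=> lF FC; rewrite -Re_sum.
have lG (i : 'I_N) : l1 (fun n => F i n * (F i n)^*) by apply: l1_mulJ; apply: lF.
have -> : \sum_(i < N) dot (F i) (F i) = csum (fun n => \sum_(i < N) F i n * (F i n)^*).
  by rewrite csum_sumr.
apply: le_trans (le_trans (ler_norm _) (Re_le_normc _)) _; apply: normc_csum => P.
apply: le_trans (FC P); rewrite exchange_big /=; apply: ler_sum => n _.
apply: le_trans (normc_sum _ _ _) _; apply: ler_sum => i _.
by rewrite mulc_conj normc_real ger0_norm // sqr_ge0.
Qed.

(** Each element of an orthonormal family in [F] contributes [s2] to the
    Hilbert-Schmidt norm of [K]. *)
Lemma orthonormal_bound C (e : nat -> nat -> R[i]) N :
  (forall P M, \sum_(n < P) \sum_(m < M) normc (u (n + m).+1) ^+ 2 <= C) ->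
  (forall i, (i < N)%N -> eigK (e i)) -> orthonormal e N -> N%:R * s2 <= C.
Proof.
move=> HC Fe on.
have le i : (i < N)%N -> l1 (e i) by move=> /Fe [].
have -> : N%:R * s2 = \sum_(i < N) complex.Re (dot (K (e i)) (K (e i))).
  rewrite (eq_bigr (fun=> s2)) ?sumr_const ?card_ord ?mulr_natl // => i _.
  have li := le _ (ltn_ord i); have lKi := l1_Kop lu li.
  rewrite Kop_sym //; have [_ ->] := Fe _ (ltn_ord i).
  by rewrite dotZl // on // eqxx mulr1.
apply: (@dot_sumr_le N (fun i => K (e i))) => [i iN|P]; first exact/l1_Kop/le.
rewrite exchange_big /=.
apply: (@le_trans _ _ (\sum_(n < P) complex.Re (dot (tl n.+1 u) (tl n.+1 u)))).
  by apply: ler_sum => n _; apply: (@bessel e N (tl n.+1 u)) => //; exact: l1_tl.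
apply: (@dot_sumr_le P (fun n => tl n.+1 u)) => [n _|M]; first exact: l1_tl.
by apply: le_trans (HC P M); apply: ler_sum => n _; apply: ler_sum => m _; rewrite /tl addSn.
Qed.

(** Orthonormal families in [F] have bounded size; one of maximal size spans [F]. *)
Lemma eigK_proj C x :
  (forall P M, \sum_(n < P) \sum_(m < M) normc (u (n + m).+1) ^+ 2 <= C) -> l1 x ->
  exists2 a, eigK a & forall f, eigK f -> dot (x - a) f = 0.
Proof.
move=> HC lx.
pose P N := `[< exists e, (forall i, (i < N)%N -> eigK (e i)) /\ orthonormal e N >].
have P0 : exists N, P N by exists 0%N; apply/asboolP; exists (fun=> x).
have PC N : P N -> (N <= Num.truncn (C / s2))%N.
  move=> /asboolP [e [Fe on]]; have := orthonormal_bound HC Fe on.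
  by rewrite -ler_pdivlMr // => h; rewrite truncn_ge_nat // (le_trans _ h).
case: (ex_maxnP P0 PC) => N /asboolP [e [Fe on]] Nmax.
have le i : (i < N)%N -> l1 (e i) by move=> /Fe [].
have Fp y : eigK (\sum_(i < N) dot y (e i) *: e i).
  elim: (N) Fe => [|M IH] Fe.
    by rewrite big_ord0; exact: eigK_0.
  rewrite big_ord_recr /=; apply: eigK_add; first by apply: IH => i iM; apply/Fe/ltnW.
  exact/eigK_scale/Fe.
exists (\sum_(i < N) dot x (e i) *: e i) => // f Ff; have [lf _] := Ff.
set q := f - \sum_(i < N) dot f (e i) *: e i.
have Fq : eigK q by apply: eigK_sub.
have lq := eigK_l1 Fq.
have [q0|q0] := pselect (q = 0).
  have -> : f = \sum_(i < N) dot f (e i) *: e i by apply/eqP; rewrite -subr_eq0; apply/eqP.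
  have lxp : l1 (x - \sum_(i < N) dot x (e i) *: e i).
    by apply: l1_sub => //; exact/eigK_l1/Fp.
  rewrite dotC; [|by []|exact/eigK_l1/Fp].
  rewrite (@dot_sumZl N (fun i => dot f (e i))) // big1 ?conjc0 // => i _.
  by rewrite (dotC (le _ (ltn_ord i)) lxp) dot_proj // conjc0 mulr0.
exfalso; suff /Nmax : P N.+1 by rewrite ltnn.
have r0 : 0 < complex.Re (dot q q).
  rewrite lt_neqAle dot_sqr_ge0 // andbT eq_sym; apply/negP => /eqP h; apply: q0.
  by apply: dot_eq0 => //; rewrite dot_sqr_real // h.
pose c := (Num.sqrt (complex.Re (dot q q)))^-1.
apply/asboolP; exists (fun i => if i == N then c%:C *: q else e i); split.
  move=> i iN; case: eqP => [_|/eqP iN']; first exact: eigK_scale.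
  by apply: Fe; rewrite ltn_neqAle iN' -ltnS.
have qe i : (i < N)%N -> dot q (e i) = 0 by move=> iN; apply: dot_proj.
move=> i j; rewrite !ltnS => iN jN.
have [iE|iN'] := eqVneq i N; have [jE|jN'] := eqVneq j N.
- rewrite iE jE eqxx dotZl ?dotZr //; last exact: l1_scale.
  rewrite dot_sqr_real // conjc_real -!rmorphM /=.
  have -> : c * (c * complex.Re (dot q q)) = 1; last by [].
  have w0 : 0 < Num.sqrt (complex.Re (dot q q)) by rewrite sqrtr_gt0.
  rewrite -[in X in _ * X](sqr_sqrtr (ltW r0)) /c; field.
  by rewrite gt_eqF.
- have jN2 : (j < N)%N by rewrite ltn_neqAle jN'.
  by rewrite iE dotZl ?qe ?mulr0 ?(gtn_eqF jN2) //; exact: le.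
- have iN2 : (i < N)%N by rewrite ltn_neqAle iN'.
  rewrite jE dotC; [|exact: le|exact: l1_scale].
  by rewrite dotZl ?qe ?mulr0 ?conjc0 ?(ltn_eqF iN2) //; exact: le.
by apply: on; rewrite ltn_neqAle ?iN' ?jN'.
Qed.

End Eigenspaces.

(** * Formal power series *)

Section PowerSeries.
Variable R : realType.
Implicit Types (x y z : nat -> R[i]).

Definition truncp N x : {poly R[i]} := \poly_(i < N.+1) x i.

Lemma conv_truncp N x y n : (n <= N)%N -> convol x y n = (truncp N x * truncp N y)`_n.
Proof.
move=> nN; rewrite coefM; apply: eq_bigr => i _.
have iN : (i <= N)%N by apply: leq_trans nN; rewrite -ltnS.
by rewrite !coef_poly !ltnS iN (leq_trans (leq_subr _ _) nN).
Qed.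

(** Truncation to polynomials, where multiplication is known to be associative. *)
Lemma convolA x y z : convol x (convol y z) = convol (convol x y) z.
Proof.
apply/funext => n.
transitivity ((truncp n x * (truncp n y * truncp n z))`_n).
  rewrite coefM; apply: eq_bigr => i _; congr (_ * _).
    by rewrite coef_poly ltn_ord.
  by rewrite (@conv_truncp n) // leq_subr.
rewrite mulrA coefM; apply: eq_bigr => i _; congr (_ * _).
  by rewrite (@conv_truncp n) // -ltnS.
by rewrite coef_poly ltnS leq_subr.
Qed.

(** Coefficients of [x] vanish by induction, compared with the first nonzero one of [y]. *)
Lemma conv_eq0 x y : convol x y = 0 -> y <> 0 -> x = 0.
Proof.
move=> xy0 y0.
have [m ym] : exists m, y m != 0.
  apply: contrapT => /forallNP H; apply: y0; apply/funext => m.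
  by apply/eqP; apply: contrapT => /negP; exact: H.
case: (ex_minnP (ex_intro (fun m => y m != 0) m ym)) => {ym}m ym mmin.
have yz k : (k < m)%N -> y k = 0.
  by move=> km; apply/eqP; apply: contraLR km => /mmin; rewrite leqNgt.
apply/funext => n; elim/ltn_ind: n => n IH.
have := congr1 (fun f => f (n + m)%N) xy0; rewrite /convol /=.
have nm : (n < (n + m).+1)%N by rewrite ltnS leq_addr.
rewrite (bigD1 (Ordinal nm)) //= addKn big1 ?addr0 => [/eqP|i /eqP iN].
  by rewrite mulf_eq0 (negPf ym) orbF => /eqP.
have {iN} : i != n :> nat by apply/eqP => E; apply: iN; apply: val_inj.
rewrite neq_ltn => /orP[/IH ->|ni]; first by rewrite mul0r.
rewrite [y _]yz ?mulr0 // ltn_subLR; first by rewrite ltn_add2r.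
by rewrite -ltnS.
Qed.

(** Division with remainder by [y], iterated: [th n] is the quotient of [b n] by [y]
   at order zero, and [b n.+1] is the remainder divided by the variable. *)
Lemma conv_quotient y (th : nat -> R[i]) (b : nat -> nat -> R[i]) :
  (forall n, b n 0%N = th n * y 0%N) -> (forall n, b n.+1 = sh (b n - th n *: y)) ->
  b 0%N = convol th y.
Proof.
move=> b0 bS; apply/funext => k.
suff H n : b n k = \sum_(i < k.+1) th (n + i)%N * y (k - i)%N by rewrite H.
elim: k n => [|k IH] n; first by rewrite big_ord1 addn0 b0.
rewrite big_ord_recl addn0 subn0.
have -> : b n k.+1 = th n * y k.+1 + b n.+1 k.
  by rewrite bS /sh addrC subrK.
by rewrite IH; congr (_ + _); apply: eq_bigr => i _; rewrite addSnnS.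
Qed.

End PowerSeries.

(** * Differential calculus for curves of summable sequences *)

Section RealDerivative.
Variable R : realType.
Implicit Types (f g : R -> R) (t v e d h a b : R).

(** Differentiability is stated with its remainder, in the form that carries over to
    curves of sequences. *)
Definition rder f t v : Prop := forall e, 0 < e -> exists2 d, 0 < d &
  forall h, `|h| <= d -> `|f (t + h) - f t - h * v| <= e * `|h|.

Lemma rder_is_derive f t v : rder f t v -> is_derive t 1 f v.
Proof.
move=> H.
have C : (fun h => h^-1 *: (f (h *: 1 + t) - f t)) @ 0^' --> v.
  apply/cvgrPdist_le => e e0; have [d d0 Hd] := H _ e0.
  near=> h.
  have h0 : h != 0 by near: h; exact: nbhs_dnbhs_neq.
  have hd : `|h| <= d.
    near: h; apply: nbhs_dnbhs; apply/nbhs_ballP; exists d => //= x.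
    by rewrite /ball /= sub0r normrN => /ltW.
  have := Hd _ hd.
  have -> : h *: 1 + t = t + h by rewrite [h *: 1]mulr1 addrC.
  have -> : v - h^-1 *: (f (t + h) - f t) = - (h^-1 * (f (t + h) - f t - h * v)).
    by rewrite /GRing.scale /=; field.
  rewrite normrN normrM normfV => k.
  by rewrite mulrC ler_pdivrMr ?normr_gt0.
split; first by apply/cvg_ex; exists v.
exact/cvg_lim.
Unshelve. all: by end_near. Qed.

Lemma is_derive_rder f t v : is_derive t 1 f v -> rder f t v.
Proof.
move=> [D E] e e0.
have C : (fun h => h^-1 *: (f (h *: 1 + t) - f t)) @ 0^' --> v by rewrite -E; exact: D.
have /cvgrPdist_le /(_ _ e0) := C.
rewrite near_withinE => /nbhs_ballP [d /= d0 Hd].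
exists (d / 2); first by rewrite divr_gt0.
move=> h hd; have [->|h0] := eqVneq h 0.
  by rewrite addr0 subrr sub0r mul0r oppr0 normr0 mulr0.
have bh : ball (0 : R) d h.
  rewrite /ball /= sub0r normrN; apply: le_lt_trans hd _.
  by rewrite ltr_pdivrMr // ltr_pMr // ltr1n.
have := Hd _ bh h0.
have -> : h *: 1 + t = t + h by rewrite [h *: 1]mulr1 addrC.
move=> k.
have -> : f (t + h) - f t - h * v = - (h * (v - h^-1 *: (f (t + h) - f t))).
  by rewrite /GRing.scale /=; field.
by rewrite normrN normrM mulrC ler_wpM2r.
Qed.

Lemma rder_mono f f' a b : a <= b ->
  (forall t, a <= t <= b -> rder f t (f' t)) -> (forall t, a <= t <= b -> 0 <= f' t) ->
  f a <= f b.
Proof.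
move=> ab Df f'0.
have D t : t \in `]a, b[ -> is_derive t 1 f (f' t).
  by rewrite in_itv /= => /andP[h1 h2]; apply/rder_is_derive/Df; rewrite !ltW.
have C : {within `[a, b], continuous f}.
  apply: derivable_within_continuous => t; rewrite in_itv /= => h.
  by have [] := rder_is_derive (Df t h).
have [c /[!in_itv] /= cab E] := MVT_segment ab D C.
by rewrite -subr_ge0 E mulr_ge0 ?f'0 ?subr_ge0.
Qed.

Lemma rder_ext f g t v : f =1 g -> rder f t v -> rder g t v.
Proof. by move=> /funext ->. Qed.

Lemma rderD f g t v w : rder f t v -> rder g t w -> rder (fun s => f s + g s) t (v + w).
Proof.
move=> H H' e e0; have e2 : 0 < e / 2 by rewrite divr_gt0.
have [d d0 h1] := H _ e2; have [d' d'0 h2] := H' _ e2.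
exists (Num.min d d'); first by rewrite lt_min d0.
move=> h; rewrite le_min => /andP[k1 k2].
have -> : f (t + h) + g (t + h) - (f t + g t) - h * (v + w) =
  (f (t + h) - f t - h * v) + (g (t + h) - g t - h * w) by ring.
by rewrite [e]splitr mulrDl; apply: le_trans (ler_normD _ _) _; rewrite lerD ?h1 ?h2.
Qed.

Lemma rderZ c f t v : rder f t v -> rder (fun s => c * f s) t (c * v).
Proof.
move=> H e e0; have c0 : 0 < `|c| + 1 by rewrite ltr_wpDl.
have [d d0 Hd] := H _ (divr_gt0 e0 c0); exists d => // h /Hd k.
have -> : c * f (t + h) - c * f t - h * (c * v) = c * (f (t + h) - f t - h * v) by ring.
rewrite normrM; apply: (@le_trans _ _ (`|c| * (e / (`|c| + 1) * `|h|))).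
  by rewrite ler_wpM2l.
rewrite !mulrA ler_wpM2r // ler_pdivrMr // [_ * e]mulrC ler_wpM2l ?(ltW e0) //.
by rewrite lerDl.
Qed.

Lemma rder_id t : rder id t 1.
Proof. by move=> e e0; exists 1 => // h _; rewrite /= mulr1 (addrC t) addrK subrr normr0 mulr_ge0 ?(ltW e0). Qed.

Lemma rder_cst c t : rder (fun=> c) t 0.
Proof. by move=> e e0; exists 1 => // h _; rewrite mulr0 subr0 subrr normr0 mulr_ge0 ?(ltW e0). Qed.

Lemma rder_expR c t0 t : rder (fun s => expR (c * (s - t0))) t (c * expR (c * (t - t0))).
Proof.
apply: is_derive_rder.
have H : is_derive t 1 (fun s : R => c * (s - t0)) c.
  apply: rder_is_derive; have := rderZ c (rderD (rder_id t) (rder_cst (- t0) t)).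
  by rewrite addr0 mulr1.
have := @is_derive1_comp _ (@expR R) (fun s => c * (s - t0)) t _ _ (is_derive_expR _) H.
by move=> h; apply: is_derive_eq; rewrite mulrC.
Qed.

(** ** Primitives *)

Definition rcont f : Prop := forall t e, 0 < e -> exists2 d, 0 < d &
  forall h, `|h| <= d -> `|f (t + h) - f t| <= e.

Lemma rcont_continuous f : rcont f -> continuous f.
Proof.
move=> H t; apply/cvgrPdist_le => e e0; have [d d0 Hd] := H t _ e0.
near=> x; rewrite distrC -[x](subrK t) [_ - t + t]addrC; apply: Hd.
near: x; apply/nbhs_ballP; exists d => //= x.
by rewrite /ball /= distrC => /ltW.
Unshelve. all: by end_near. Qed.

Lemma primitive_local f (n : nat) : rcont f ->
  exists2 F, F 0 = 0 & forall t, `|t| < n%:R -> rder F t (f t).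
Proof.
move=> cf; have Cf := rcont_continuous cf.
pose F0 x := (\int[@lebesgue_measure R]_(t in `[- n%:R - 1, x]) f t)%R.
exists (fun x => F0 x - F0 0); first by rewrite subrr.
move=> t; rewrite ltr_norml => /andP[h1 h2].
rewrite -[f t]addr0; apply: rderD; last exact: rder_cst.
apply: is_derive_rder.
have I : (@lebesgue_measure R).-integrable `[- n%:R - 1, n%:R] (EFin \o f).
  apply: continuous_compact_integrable; first exact: segment_compact.
  exact/continuous_subspaceT.
have a1 : - n%:R - 1 < t by apply: lt_trans h1; rewrite ltrBlDr ltrDl.
have [D E] := @continuous_FTC1_closed R f _ _ _ h2 I a1 (Cf t).
by apply: DeriveDef => //; rewrite -derive1E.
Qed.

Lemma rder0_eq f a b : a <= b -> (forall t, a <= t <= b -> rder f t 0) -> f a = f b.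
Proof.
move=> ab H; apply/eqP; rewrite eq_le; apply/andP; split.
  exact: (rder_mono (f' := fun=> 0)).
rewrite -lerN2; apply: (@rder_mono (fun s => - f s) (fun=> 0)) => // t /H.
by move=> /(rderZ (-1)); rewrite mulr0; apply: rder_ext => s; rewrite mulN1r.
Qed.

(** The primitives on the intervals ]-n, n[ that vanish at zero agree with each other. *)
Lemma primitive f : rcont f -> exists2 F, F 0 = 0 & forall t, rder F t (f t).
Proof.
move=> cf.
have /choice [G HG] : forall n : nat, exists G, G 0 = 0 /\ forall t, `|t| < n%:R -> rder G t (f t).
  by move=> n; have [F F0 DF] := primitive_local n cf; exists F.
have agree n m t : `|t| < n%:R -> `|t| < m%:R -> G n t = G m t.
  move=> tn tm; have [Gn DGn] := HG n; have [Gm DGm] := HG m.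
  have D s : `|s| <= `|t| -> rder (fun x => G n x - G m x) s 0.
    move=> st; rewrite -(subrr (f s)).
    have := rderD (DGn s (le_lt_trans st tn)) (rderZ (-1) (DGm s (le_lt_trans st tm))).
    by rewrite mulN1r; apply: rder_ext => x; rewrite mulN1r.
  have E0 : G n 0 - G m 0 = 0 by rewrite Gn Gm subrr.
  apply/eqP; rewrite -subr_eq0; apply/eqP; rewrite -E0.
  have [t0|t0] := leP 0 t.
    symmetry; apply: (rder0_eq (f := fun x => G n x - G m x)) => // s /andP[s0 st]; apply: D.
    by rewrite (ger0_norm s0) (ger0_norm t0).
  apply: (rder0_eq (f := fun x => G n x - G m x)); first exact: ltW.
  move=> s /andP[ts s0]; apply: D.
  by rewrite (ler0_norm s0) (ltr0_norm t0) lerN2.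
pose N t := (Num.truncn `|t|).+2.
exists (fun t => G (N t) t); first by have [] := HG (N 0).
move=> t e e0; have tN : `|t| + 1 < (N t)%:R.
  by rewrite /N -addn1 natrD ltrD2r truncnS_gt.
have tN' : `|t| < (N t)%:R by apply: lt_trans tN; rewrite ltrDl.
have [d d0 Hd] := (HG (N t)).2 t tN' e e0.
exists (Num.min d 1); first by rewrite lt_min d0 ltr01.
move=> h; rewrite le_min => /andP[hd h1].
have thN : `|t + h| < (N t)%:R.
  by apply: le_lt_trans tN; apply: le_trans (ler_normD _ _) _; rewrite lerD2l.
rewrite (agree (N (t + h)) (N t)) //; first exact: Hd.
by apply: lt_trans (truncnS_gt _) _; rewrite ltr_nat.
Qed.

End RealDerivative.

(** ** Curves of sequences *)

Section Curves.
Variable R : realType.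
Implicit Types (x y z v w : nat -> R[i]) (f g : R -> nat -> R[i]) (p q : R -> R[i]).
Implicit Types (t e d h : R).

Definition sder p t (v : R[i]) : Prop := forall e, 0 < e -> exists2 d, 0 < d &
  forall h, `|h| <= d -> normc (p (t + h) - p t - h%:C * v) <= e * `|h|.

Definition dcurve f t v : Prop := forall e, 0 < e -> exists2 d, 0 < d &
  forall h, `|h| <= d -> bd (f (t + h) - f t - h%:C *: v) (e * `|h|).

Definition ccurve f t : Prop := forall e, 0 < e -> exists2 d, 0 < d &
  forall h, `|h| <= d -> bd (f (t + h) - f t) e.

Lemma dcurve_coord f t v k : dcurve f t v -> sder (fun s => f s k) t (v k).
Proof. by move=> H e /H [d d0 Hd]; exists d => // h /Hd /(bd_coord k). Qed.

Lemma sder_Re p t (v : R[i]) : sder p t v -> rder (fun s => complex.Re (p s)) t (complex.Re v).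
Proof.
move=> H e /H [d d0 Hd]; exists d => // h /Hd; apply: le_trans.
apply: le_trans (Re_le_normc _); rewrite !ReB.
by case: v {Hd H} => a b /=; rewrite mul0r subr0.
Qed.

Lemma sder_Im p t (v : R[i]) : sder p t v -> rder (fun s => complex.Im (p s)) t (complex.Im v).
Proof.
move=> H e /H [d d0 Hd]; exists d => // h /Hd; apply: le_trans.
apply: le_trans (Im_le_normc _); rewrite !ImB.
by case: v {Hd H} => a b /=; rewrite mul0r addr0.
Qed.

Lemma sder_ReIm p t (v : R[i]) : rder (fun s => complex.Re (p s)) t (complex.Re v) ->
  rder (fun s => complex.Im (p s)) t (complex.Im v) -> sder p t v.
Proof.
move=> H H' e e0; have e2 : 0 < e / 2 by rewrite divr_gt0.
have [d d0 h1] := H _ e2; have [d' d'0 h2] := H' _ e2.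
exists (Num.min d d'); first by rewrite lt_min d0.
move=> h; rewrite le_min => /andP[k1 k2].
apply: le_trans (normc_le_ReIm _) _; rewrite [e]splitr mulrDl !ReB !ImB lerD //.
  by have := h1 _ k1; case: v {h1 h2 H H'} => a b /=; rewrite mul0r subr0.
by have := h2 _ k2; case: v {h1 h2 H H'} => a b /=; rewrite mul0r addr0.
Qed.

Lemma sder0_eq p a b : a <= b -> (forall t, a <= t <= b -> sder p t 0) -> p a = p b.
Proof.
move=> ab H; apply/eqP; rewrite eq_complex; apply/andP; split; apply/eqP.
  by apply: (@rder0_eq _ (fun s => complex.Re (p s))) => // t /H /sder_Re.
by apply: (@rder0_eq _ (fun s => complex.Im (p s))) => // t /H /sder_Im.
Qed.

(** Mean value inequality for the l^1 norm: a finite sum of moduli is the real part of a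
   linear combination with unimodular coefficients. *)
Lemma mean_value (G g : R -> nat -> R[i]) (phi phi' : R -> R) a b : a <= b ->
  (forall s k, a <= s <= b -> sder (fun s => G s k) s (g s k)) ->
  (forall s, a <= s <= b -> bd (g s) (phi' s)) ->
  (forall s, a <= s <= b -> rder phi s (phi' s)) ->
  bd (G b - G a) (phi b - phi a).
Proof.
move=> ab DG gB Dphi N.
have /choice [c Hc] : forall k, exists c : R[i], normc c <= 1 /\
    normc ((G b - G a) k) = complex.Re (c * (G b - G a) k).
  move=> k; set z := (G b - G a) k.
  have [z0|z0] := eqVneq z 0.
    by exists 0; rewrite normc0 z0 normc0 mul0r ler01.
  exists (z^* / (normc z)%:C); rewrite normcM normc_conj normcV normc_real.
  have n0 : 0 < normc z by rewrite normc_gt0.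
  rewrite ger0_norm ?normc_ge0 // divff ?gt_eqF //; split => //.
  rewrite mulrAC [_ * z]mulrC mulc_conj -fmorphV -rmorphM /=.
  by rewrite expr2 mulfK ?gt_eqF.
have -> : \sum_(k < N) normc ((G b - G a) k) =
    \sum_(k < N) complex.Re (c k * G b k) - \sum_(k < N) complex.Re (c k * G a k).
  rewrite -sumrB; apply: eq_bigr => k _; rewrite (Hc k).2 -ReB -mulrBr.
  by [].
pose F s := phi s - \sum_(k < N) complex.Re (c k * G s k).
suff : F a <= F b by rewrite /F => h; lra.
apply: (@rder_mono _ F (fun s => phi' s - \sum_(k < N) complex.Re (c k * g s k))) => // s sab.
  apply: (rder_ext (f := fun s => phi s + -1 * \sum_(k < N) complex.Re (c k * G s k))).
    by move=> x; rewrite mulN1r.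
  rewrite -[- \sum_(k < N) _]mulN1r; apply: rderD; first exact: Dphi.
  apply: rderZ.
  elim: N {F} => [|N IH].
    rewrite big_ord0; apply: (rder_ext (f := fun=> 0)) (rder_cst _ _) => x.
    by rewrite big_ord0.
  rewrite big_ord_recr /=.
  apply: (rder_ext (f := fun s => (\sum_(k < N) complex.Re (c k * G s k)) + complex.Re (c N * G s N))).
    by move=> x; rewrite big_ord_recr.
  apply: rderD IH _.
  suff X : sder (fun r => c N * G r N) s (c N * g s N) by exact: (sder_Re X).
  move=> e e0; have c0 : 0 < normc (c N) + 1 by rewrite ltr_wpDl ?normc_ge0.
  have [d d0 Hd] := DG s N sab _ (divr_gt0 e0 c0); exists d => // h /Hd k.
  have -> : c N * G (s + h) N - c N * G s N - h%:C * (c N * g s N) =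
    c N * (G (s + h) N - G s N - h%:C * g s N) by ring.
  rewrite normcM; apply: le_trans (ler_wpM2l (normc_ge0 _) k) _.
  rewrite !mulrA ler_wpM2r // ler_pdivrMr // [_ * e]mulrC ler_wpM2l ?(ltW e0) //.
  by rewrite lerDl.
rewrite subr_ge0; apply: le_trans (gB s sab N); apply: ler_sum => k _.
apply: le_trans (ler_norm _) (le_trans (Re_le_normc _) _).
by rewrite normcM ler_piMl ?normc_ge0 // (Hc k).1.
Qed.

End Curves.

(** * Linear differential equations in l^1 *)

Section Picard.
Variable R : realType.
Implicit Types (x y z v w : nat -> R[i]) (f g : R -> nat -> R[i]) (p q : R -> R[i]).
Implicit Types (t e d h : R).

(** Fatou: an l^1 bound passes to coordinatewise limits. *)
Lemma bd_lim (Z : nat -> nat -> R[i]) z C :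
  (forall k e, 0 < e -> exists P0, forall P, (P0 <= P)%N -> normc (Z P k - z k) <= e) ->
  (exists P0, forall P, (P0 <= P)%N -> bd (Z P) C) -> bd z C.
Proof.
move=> Zz [Q HQ] N; apply/ler_addgt0Pl => e e0.
suff [P0 H] : exists P0, forall P, (P0 <= P)%N -> \sum_(k < N) normc (Z P k - z k) <= e.
  have h := H _ (leq_maxl P0 Q); have h' := HQ _ (leq_maxr P0 Q) N.
  apply: le_trans (lerD h h'); rewrite -big_split /=; apply: ler_sum => k _.
  rewrite -[X in normc X <= _](subKr (Z (maxn P0 Q) k)).
  by rewrite addrC; apply: normcB.
elim: N e e0 => [|N IH] e e0; first by exists 0%N => P _; rewrite big_ord0 ltW.
have e2 : 0 < e / 2 by rewrite divr_gt0.
have [P1 h1] := IH _ e2; have [P2 h2] := Zz N _ e2.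
exists (maxn P1 P2) => P; rewrite geq_max => /andP[k1 k2].
by rewrite big_ord_recr /= [e]splitr lerD ?h1 ?h2.
Qed.

Lemma primitive_curve g (t0 : R) x : (forall t, ccurve g t) ->
  exists2 Y, Y t0 = x & forall t k, sder (fun s => Y s k) t (g t k).
Proof.
move=> cg.
have cR k : rcont (fun s => complex.Re (g s k)).
  move=> t e e0; have [d d0 Hd] := cg t e e0; exists d => // h /Hd /(bd_coord k).
  by apply: le_trans; apply: le_trans (Re_le_normc _); rewrite ReB.
have cI k : rcont (fun s => complex.Im (g s k)).
  move=> t e e0; have [d d0 Hd] := cg t e e0; exists d => // h /Hd /(bd_coord k).
  by apply: le_trans; apply: le_trans (Im_le_normc _); rewrite ImB.
have /choice [F HF] : forall k, exists F, forall t, rder F t (complex.Re (g t k)).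
  by move=> k; have [F _ DF] := primitive (cR k); exists F.
have /choice [G HG] : forall k, exists F, forall t, rder F t (complex.Im (g t k)).
  by move=> k; have [G _ DG] := primitive (cI k); exists G.
exists (fun t k => x k + ((F k t - F k t0) +i* (G k t - G k t0))).
  by apply/funext => k; rewrite !subrr -[RHS]addr0.
move=> t k; apply: sder_ReIm.
  apply: (rder_ext (f := fun s => F k s + (complex.Re (x k) - F k t0))).
    by move=> s; rewrite ReD /= addrCA.
  by rewrite -[complex.Re (g t k)]addr0; apply: rderD (HF k t) (rder_cst _ _).
apply: (rder_ext (f := fun s => G k s + (complex.Im (x k) - G k t0))).
  by move=> s; rewrite ImD /= addrCA.
by rewrite -[complex.Im (g t k)]addr0; apply: rderD (HG k t) (rder_cst _ _).
Qed.

Variables (T : R -> (nat -> R[i]) -> nat -> R[i]) (M : R).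
(** The vector field is a family of linear operators on l^1, of norm at most [M] at
    all times and continuous in time for the operator norm. *)
Hypothesis TM : forall t x B, bd x B -> bd (T t x) (M * B).
Hypothesis TB : forall t x y, l1 x -> l1 y -> T t (x - y) = T t x - T t y.
Hypothesis Tc : forall t e, 0 < e -> exists2 d, 0 < d & forall h, `|h| <= d ->
  forall x B, bd x B -> bd (T (t + h) x - T t x) (e * B).
Hypothesis M0 : 0 < M.

Variables (t0 : R) (x0 : nat -> R[i]) (B0 : R).
Hypothesis x0B : bd x0 B0.

(** Exponential weight making the integral operator a contraction of ratio 1/2. *)
Let E t := expR (2 * M * `|t - t0|).

Let E_ge1 t : 1 <= E t.
Proof. by rewrite -expR0 ler_expR !mulr_ge0 // ltW. Qed.

Let B0_ge0 : 0 <= B0. Proof. exact: bd_ge0 x0B. Qed.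

Lemma picard_weight G (g : R -> nat -> R[i]) C : 0 <= C ->
  (forall s k, sder (fun r => G r k) s (g s k)) ->
  (forall s, bd (g s) (M * (C * E s))) -> forall t, bd (G t - G t0) (C / 2 * (E t - 1)).
Proof.
move=> C0 DG gB t; have [tt|tt] := leP t0 t.
  have := @mean_value _ G g (fun s => C / 2 * expR (2 * M * (s - t0)))
    (fun s => C / 2 * ((2 * M) * expR (2 * M * (s - t0)))) _ _ tt.
  rewrite subrr mulr0 expR0 -mulrBr [E t]/E ger0_norm ?subr_ge0 //; apply.
  - by move=> s k _; exact: DG.
  - move=> s /andP[s0 _]; apply: bd_le (gB s) _.
    rewrite /E ger0_norm ?subr_ge0 // le_eqVlt; apply/orP; left; apply/eqP; by field.
  - by move=> s _; apply/rderZ/rder_expR.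
have := @mean_value _ G g (fun s => - (C / 2) * expR (- (2 * M) * (s - t0)))
    (fun s => - (C / 2) * (- (2 * M) * expR (- (2 * M) * (s - t0)))) _ _ (ltW tt).
have EE s : s <= t0 -> E s = expR (- (2 * M) * (s - t0)).
  by move=> st; rewrite /E ler0_norm ?subr_le0 // mulrN mulNr.
rewrite subrr mulr0 expR0 => H.
have {}H : bd (G t0 - G t) (- (C / 2) * 1 - - (C / 2) * expR (- (2 * M) * (t - t0))).
  apply: H.
  - by move=> s k _; exact: DG.
  - move=> s /andP[_ s0]; apply: bd_le (gB s) _.
    rewrite EE // le_eqVlt; apply/orP; left; apply/eqP; by field.
  - by move=> s _; apply/rderZ/rder_expR.
apply: bd_ext (bdN (bd_le H _)) _; last by move=> k; exact: opprB.
by rewrite -EE ?(ltW tt) // le_eqVlt; apply/orP; left; apply/eqP; by ring.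
Qed.

Let good (Y : R -> nat -> R[i]) := (forall t, bd (Y t) (B0 * E t)) /\ forall t, ccurve Y t.

Lemma ccurve_op Y t : good Y -> ccurve (fun s => T s (Y s)) t.
Proof.
move=> [YB cY] e e0.
have e1 : 0 < e / 2 / M by rewrite !divr_gt0.
have C1 : 0 < B0 * E t + 1 by rewrite ltr_wpDl // mulr_ge0 // ltW ?expR_gt0.
have e2 : 0 < e / 2 / (B0 * E t + 1) by rewrite !divr_gt0.
have [d d0 H1] := cY t _ e1; have [d' d'0 H2] := Tc t e2.
exists (Num.min d d'); first by rewrite lt_min d0.
move=> h; rewrite le_min => /andP[k1 k2].
have lY s : l1 (Y s) by eexists; exact: YB.
have Yt : bd (Y t) (B0 * E t + 1) by apply: bd_le (YB t) _; rewrite lerDl ler01.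
apply: bd_ext (bd_le (bdD (TM (t + h) (H1 _ k1)) (H2 _ k2 _ _ Yt)) _) _.
  by rewrite mulrC divfK ?gt_eqF // divfK ?gt_eqF // -splitr.
by move=> k; rewrite TB // -[LHS]/(_ - _ + (_ - _)) addrA subrK.
Qed.

Lemma picard_step Y : good Y -> exists Y', good Y' /\ (Y' t0 = x0 /\
  forall t k, sder (fun s => Y' s k) t (T t (Y t) k)).
Proof.
move=> gY; have [YB cY] := gY.
have [Y' Y'0 DY] := primitive_curve t0 x0 (fun t => @ccurve_op Y t gY).
exists Y'; split => //; split.
  move=> t; have := picard_weight B0_ge0 DY (fun s => TM s (YB s)) t.
  rewrite Y'0 => H.
  apply: bd_ext (bd_le (bdD x0B H) _) _; last by move=> k; rewrite addrC subrK.
  rewrite -[leLHS]addr0 -subr_ge0.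
  have -> : B0 * E t - (B0 + B0 / 2 * (E t - 1) + 0) = B0 / 2 * (E t - 1) by field.
  by rewrite mulr_ge0 ?divr_ge0 // subr_ge0.
move=> t e e0.
pose C := M * (B0 * expR (2 * M * (`|t - t0| + 1))) + 1.
have C0 : 0 < C by rewrite ltr_wpDl // !mulr_ge0 ?(ltW M0) ?expR_ge0.
have EC s : `|s - t| <= 1 -> M * (B0 * E s) <= C.
  move=> st; rewrite /C -[leLHS]addr0 lerD ?ler01 // ler_wpM2l ?(ltW M0) // ler_wpM2l //.
  rewrite ler_expR ler_wpM2l ?mulr_ge0 ?(ltW M0) //.
  by rewrite -[s](subrK t) -addrA addrC; apply: le_trans (ler_normD _ _) _; rewrite lerD2l.
exists (Num.min 1 (e / C)); first by rewrite lt_min ltr01 divr_gt0.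
move=> h; rewrite le_min ler_pdivlMr // => /andP[h1 hC].
have D s : rder (fun r => C * r) s C by have := rderZ C (rder_id s); rewrite mulr1.
have [h0|h0] := leP 0 h.
  have := @mean_value _ Y' (fun s => T s (Y s)) _ (fun=> C) t (t + h) _ (fun s k _ => DY s k) _
    (fun s _ => D s).
  rewrite lerDl => /(_ h0) H; apply: bd_le (H _) _.
    move=> s /andP[s1 s2]; apply: bd_le (TM s (YB s)) (EC _ _).
    rewrite ger0_norm ?subr_ge0 //; apply: le_trans h1; rewrite (ger0_norm h0).
    by rewrite lerBlDl.
  by rewrite -mulrBr addrAC subrr add0r mulrC; apply: le_trans hC; rewrite ler_wpM2r ?(ltW C0) // ler_norm.
have := @mean_value _ Y' (fun s => T s (Y s)) _ (fun=> C) (t + h) t _ (fun s k _ => DY s k) _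
    (fun s _ => D s).
rewrite gerDl (ltW h0) => /(_ isT) H; apply: bd_ext (bdN (bd_le (H _) _)) _.
- move=> s /andP[s1 s2]; apply: bd_le (TM s (YB s)) (EC _ _).
  rewrite distrC ger0_norm ?subr_ge0 //; apply: le_trans h1; rewrite (ltr0_norm h0).
  by move: s1; lra.
- by move: hC; rewrite (ltr0_norm h0); lra.
- by move=> k; rewrite /= -[LHS]/(- (_ - _)) opprB.
Qed.

(** The Picard iterates satisfy [|Y_(n+1) - Y_n| <= B0 2^-n E], and since [M] bounds
    the vector field at all times the solution is global. *)
Lemma picard : exists Y, [/\ Y t0 = x0, forall t, l1 (Y t) & forall t, dcurve Y t (T t (Y t))].
Proof.
have /choice [Phi HPhi] : forall Y, exists Y', good Y -> good Y' /\ (Y' t0 = x0 /\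
    forall t k, sder (fun s => Y' s k) t (T t (Y t) k)).
  move=> Y; have [gY|ngY] := pselect (good Y); last by exists Y.
  by have [Y' H] := picard_step gY; exists Y'.
pose Y n := iter n Phi (fun=> x0).
have gY n : good (Y n).
  elim: n => [|n IH]; last by have [] := HPhi _ IH.
  split=> [t|t e e0]; first by apply: bd_le x0B _; rewrite ler_peMr // E_ge1.
  by exists 1 => // h _; apply: bd_ext (bd_le (bd0 R) (ltW e0)) _ => k; rewrite /= -[RHS]/(_ - _) subrr.
have Y0 n : Y n t0 = x0 by case: n => [//|n]; have [_ []] := HPhi _ (gY n).
have DY n t k : sder (fun s => Y n.+1 s k) t (T t (Y n t) k).
  by have [_ [_ H]] := HPhi _ (gY n); exact: H.
have lY n t : l1 (Y n t) by eexists; exact: (gY n).1.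
pose D n t := Y n.+1 t - Y n t.
have DB n t : bd (D n t) (B0 * 2^-1 ^+ n * E t).
  elim: n t => [|n IH] t.
    have := picard_weight B0_ge0 (DY 0) (fun s => TM s ((gY 0).1 s)) t.
    rewrite Y0 expr0 mulr1 => H; apply: bd_le H _.
    rewrite -subr_ge0; have -> : B0 * E t - B0 / 2 * (E t - 1) = B0 / 2 * E t + B0 / 2 by field.
    by rewrite addr_ge0 ?mulr_ge0 ?divr_ge0 ?expR_ge0.
  have C0 : 0 <= B0 * 2^-1 ^+ n by rewrite mulr_ge0 // exprn_ge0 // invr_ge0.
  have dD s k : sder (fun r => D n.+1 r k) s (T s (D n s) k).
    rewrite TB //; move=> e e0; have e2 : 0 < e / 2 by rewrite divr_gt0.
    have [d d0 H1] := DY n.+1 s k _ e2; have [d' d'0 H2] := DY n s k _ e2.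
    exists (Num.min d d'); first by rewrite lt_min d0.
    move=> h; rewrite le_min => /andP[k1 k2].
    have -> : D n.+1 (s + h) k - D n.+1 s k - h%:C * (T s (Y n.+1 s) - T s (Y n s)) k =
       (Y n.+2 (s + h) k - Y n.+2 s k - h%:C * T s (Y n.+1 s) k) -
       (Y n.+1 (s + h) k - Y n.+1 s k - h%:C * T s (Y n s) k).
      by rewrite /D -[(_ - _) k]/(_ k - _ k) -[(Y n.+2 s - _) k]/(_ k - _ k)
        -[(T s (Y n.+1 s) - _) k]/(_ k - _ k); ring.
    by apply: le_trans (normcB _ _) _; rewrite [e]splitr mulrDl lerD ?H1 ?H2.
  have := picard_weight C0 dD (fun s => TM s (IH s)) t.
  rewrite /D !Y0 subrr subr0 => H; apply: bd_le H _.
  rewrite exprS; have -> : B0 * (2^-1 * 2^-1 ^+ n) * E t = B0 * 2^-1 ^+ n / 2 * E t by field.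
  by rewrite ler_wpM2l ?divr_ge0 // gerBl.
have Ysum n P t k : Y (n + P)%N t k = Y n t k + \sum_(m < P) D (n + m)%N t k.
  elim: P => [|P IH]; first by rewrite addn0 big_ord0 addr0.
  by rewrite big_ord_recr /= addrA -IH /D addnS -[(_ - _) k]/(_ k - _ k) addrC subrK.
have geo n P : \sum_(m < P) (2^-1 : R) ^+ (n + m) <= 2 * 2^-1 ^+ n.
  suff -> : \sum_(m < P) (2^-1 : R) ^+ (n + m) = 2 * 2^-1 ^+ n - 2 * 2^-1 ^+ (n + P).
    by rewrite gerBl mulr_ge0 // exprn_ge0 // invr_ge0.
  elim: P => [|P IH]; first by rewrite addn0 subrr big_ord0.
  by rewrite big_ord_recr /= IH addnS exprS; field.
have YP n P t : bd (Y (n + P)%N t - Y n t) (B0 * (2 * 2^-1 ^+ n) * E t).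
  apply: bd_ext (bd_le (bd_sumr (index_enum 'I_P) (F := fun m : 'I_P => D (n + m)%N t) (fun m => DB (n + m)%N t)) _) _.
    by rewrite -mulr_suml -mulr_sumr ler_wpM2r ?expR_ge0 // ler_wpM2l // geo.
  by move=> k; rewrite -[RHS]/(_ k - _ k) Ysum addrC addKr.
have lD t k : l1 (fun n => D n t k).
  exists (B0 * (2 * 2^-1 ^+ 0) * E t) => P.
  apply: le_trans (_ : \sum_(m < P) B0 * 2^-1 ^+ m * E t <= _).
    by apply: ler_sum => m _; exact: bd_coord (DB m t).
  by rewrite -mulr_suml -mulr_sumr ler_wpM2r ?expR_ge0 // ler_wpM2l // (geo 0).
pose y t k := x0 k + csum (fun n => D n t k).
have Ylim t k e : 0 < e -> exists P0, forall P, (P0 <= P)%N -> normc (Y P t k - y t k) <= e.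
  move=> e0; have [P0 H] := csumP (lD t k) e0; exists P0 => P /H.
  by rewrite -[P]add0n Ysum /= /y opprD addrACA subrr add0r.
have yY n t : bd (y t - Y n t) (B0 * (2 * 2^-1 ^+ n) * E t).
  apply: (@bd_lim (fun P => Y P t - Y n t)).
    move=> k e /(Ylim t k) [P0 H]; exists P0 => P /H.
    by rewrite -[(Y P t - _) k]/(_ k - _ k) -[(y t - _) k]/(_ k - _ k) opprB addrA subrK.
  by exists n => P nP; rewrite -(subnKC nP); exact: YP.
have yl t : l1 (y t).
  apply: (l1_ext (l1_add (ex_intro _ _ (yY 0%N t)) (lY 0%N t))) => k.
  by rewrite -[LHS]/(_ - _ + _) subrK.
have yE : y t0 = x0.
  apply/funext => k; rewrite /y.
  have -> : csum (fun n => D n t0 k) = 0.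
    by rewrite -[RHS]csum0; apply: csum_ext => n; rewrite /D !Y0 subrr.
  by rewrite addr0.
have small (C e : R) : 0 <= C -> 0 < e -> exists n0, forall n, (n0 <= n)%N -> B0 * (2 * 2^-1 ^+ n) * C <= e.
  move=> C0 e0.
  have A0 : 0 < B0 * 2 * C + 1 by rewrite ltr_wpDl // !mulr_ge0.
  have c : (fun n => (2^-1 : R) ^+ n) @ \oo --> 0.
    by apply: cvg_expr; rewrite ger0_norm ?invr_ge0 // invf_lt1 // ltr1n.
  have /cvgrPdist_le /(_ _ (divr_gt0 e0 A0)) [n0 _ H] := c.
  exists n0 => n /H /=; rewrite sub0r normrN ger0_norm ?exprn_ge0 ?invr_ge0 // => k.
  have -> : B0 * (2 * 2^-1 ^+ n) * C = B0 * 2 * C * 2^-1 ^+ n by ring.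
  apply: le_trans (ler_wpM2l _ k) _; first by rewrite !mulr_ge0.
  by rewrite mulrA ler_pdivrMr // [_ * e]mulrC ler_wpM2l ?(ltW e0) // lerDl.
have Eloc t h : `|h| <= 1 -> E (t + h) <= expR (2 * M * (`|t - t0| + 1)).
  move=> h1; rewrite ler_expR ler_wpM2l ?mulr_ge0 ?(ltW M0) //.
  by rewrite addrAC; apply: le_trans (ler_normD _ _) _; rewrite lerD2l.
have yclose t e : 0 < e -> exists2 d, 0 < d & exists n0, forall n h, (n0 <= n)%N -> `|h| <= d ->
    bd (Y n (t + h) - y t) e.
  move=> e0; have e2 : 0 < e / 2 by rewrite divr_gt0.
  have e4 : 0 < e / 2 / 2 by rewrite divr_gt0.
  have e8 : 0 < e / 2 / 2 / 2 by rewrite divr_gt0.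
  have [n0 Hn] := small _ _ (expR_ge0 (2 * M * (`|t - t0| + 1))) e8.
  have [d d0 Hd] := (gY n0).2 t _ e4.
  exists (Num.min 1 d); first by rewrite lt_min ltr01.
  exists n0 => n h nn; rewrite le_min => /andP[h1 hd].
  have b1 := YP n0 (n - n0)%N (t + h); rewrite subnKC // in b1.
  have b2 := Hd _ hd.
  have b3 := bdN (yY n0 t).
  apply: bd_ext (bd_le (bdD (bdD b1 b2) b3) _) _; last first.
    by move=> k; rewrite -[LHS]/(_ - _ + (_ - _) - (_ - _)) !addrA subrK opprB addrA subrK.
  have A0 : 0 <= B0 * (2 * 2^-1 ^+ n0) by rewrite !mulr_ge0 // exprn_ge0 // invr_ge0.
  have i1 : B0 * (2 * 2^-1 ^+ n0) * E (t + h) <= e / 2 / 2 / 2.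
    by apply: le_trans (Hn _ (leqnn _)); rewrite ler_wpM2l // Eloc.
  have i2 : B0 * (2 * 2^-1 ^+ n0) * E t <= e / 2 / 2 / 2.
    apply: le_trans (Hn _ (leqnn _)); rewrite ler_wpM2l //.
    by have := @Eloc t 0; rewrite normr0 addr0; apply.
  by move: i1 i2; lra.
exists y; split => // t e e0.
have e2 : 0 < e / 2 / M by rewrite !divr_gt0.
have [C HC] := yl t; have C0 := bd_ge0 HC.
have C1 : 0 < C + 1 by rewrite ltr_wpDl.
have e3 : 0 < e / 2 / (C + 1) by rewrite !divr_gt0.
have [d d0 [n0 H1]] := yclose t _ e2; have [d' d'0 H2] := Tc t e3.
exists (Num.min d d'); first by rewrite lt_min d0.
have Tclose n r : (n0 <= n)%N -> `|r| <= Num.min d d' -> bd (T (t + r) (Y n (t + r)) - T t (y t)) e.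
  move=> nn; rewrite le_min => /andP[k1 k2].
  apply: bd_ext (bd_le (bdD (TM (t + r) (H1 n r nn k1)) (H2 _ k2 _ _ HC)) _) _.
    rewrite mulrC divfK ?gt_eqF //.
    have : e / 2 / (C + 1) * C <= e / 2.
      by rewrite mulrAC ler_pdivrMr // ler_wpM2l ?divr_ge0 ?(ltW e0) // lerDl ler01.
    lra.
  by move=> k; rewrite TB // -[LHS]/(_ - _ + (_ - _)) addrA subrK.
move=> h hd.
apply: (@bd_lim (fun P => Y P.+1 (t + h) - Y P.+1 t - h%:C *: T t (y t))).
  move=> k e1 e10; have e12 : 0 < e1 / 2 by rewrite divr_gt0.
  have [P1 h1] := Ylim (t + h) k _ e12; have [P2 h2] := Ylim t k _ e12.
  exists (maxn P1 P2) => P; rewrite geq_max => /andP[l1 l2].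
  have := normcB (Y P.+1 (t + h) k - y (t + h) k) (Y P.+1 t k - y t k).
  move=> B; rewrite [e1]splitr; apply: le_trans (le_trans B _).
    rewrite le_eqVlt; apply/orP; left; apply/eqP; congr normc.
    rewrite -[LHS]/(Y P.+1 (t + h) k - Y P.+1 t k - h%:C * T t (y t) k -
       (y (t + h) k - y t k - h%:C * T t (y t) k)); ring.
  by rewrite lerD ?h1 ?h2 // (leq_trans _ (leqnSn P)).
exists n0 => P nP.
pose G s := Y P.+1 s - (s%:C) *: T t (y t).
pose g s := T s (Y P s) - T t (y t).
have DG s k : sder (fun r => G r k) s (g s k).
  move=> e1 /(DY P s k) [d1 d10 K]; exists d1 => // r /K.
  rewrite (_ : G (s + r) k - G s k - r%:C * g s k =
    Y P.+1 (s + r) k - Y P.+1 s k - r%:C * T s (Y P s) k) //.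
  rewrite -[LHS]/(Y P.+1 (s + r) k - (s + r)%:C * T t (y t) k -
    (Y P.+1 s k - s%:C * T t (y t) k) - r%:C * (T s (Y P s) k - T t (y t) k)).
  by rewrite rmorphD; ring.
have gE s : `|s - t| <= Num.min d d' -> bd (g s) e.
  by move=> st; have := Tclose P (s - t) nP st; rewrite (addrC t) subrK.
have De s : rder (fun r => e * r) s e by have := rderZ e (rder_id s); rewrite mulr1.
have Gh : G (t + h) - G t = Y P.+1 (t + h) - Y P.+1 t - h%:C *: T t (y t).
  apply/funext => k.
  rewrite -[LHS]/(Y P.+1 (t + h) k - (t + h)%:C * T t (y t) k -
    (Y P.+1 t k - t%:C * T t (y t) k)) -[RHS]/(Y P.+1 (t + h) k - Y P.+1 t k - h%:C * T t (y t) k).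
  by rewrite rmorphD; ring.
rewrite -Gh; have [h0|h0] := leP 0 h.
  have := @mean_value _ G g _ (fun=> e) t (t + h) _ (fun s k _ => DG s k) _ (fun s _ => De s).
  rewrite lerDl => /(_ h0) H; apply: bd_le (H _) _.
    move=> s /andP[s1 s2]; apply: gE; apply: le_trans hd.
    by rewrite ger0_norm ?subr_ge0 // (ger0_norm h0) lerBlDl.
  by rewrite -mulrBr addrAC subrr add0r (ger0_norm h0).
have := @mean_value _ G g _ (fun=> e) (t + h) t _ (fun s k _ => DG s k) _ (fun s _ => De s).
rewrite gerDl (ltW h0) => /(_ isT) H; apply: bd_ext (bdN (bd_le (H _) _)) _.
- move=> s /andP[s1 s2]; apply: gE; apply: le_trans hd.
  by rewrite distrC ger0_norm ?subr_ge0 // (ltr0_norm h0); move: s1; lra.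
- by rewrite (ltr0_norm h0); lra.
by move=> k; rewrite /= -[LHS]/(- (_ - _)) opprB.
Qed.

End Picard.

(** * Products of curves *)

Ltac seqring := apply/funext => ?; rewrite !fctE /GRing.scale /=; ring.

Section CurveCalculus.
Variable R : realType.
Implicit Types (x y z v w : nat -> R[i]) (f g : R -> nat -> R[i]) (p : R -> R[i]).
Implicit Types (t e d h : R).

Lemma normc_h h : normc h%:C = `|h|. Proof. exact: normc_real. Qed.

Lemma dcurve_eq f t v w : v = w -> dcurve f t v -> dcurve f t w.
Proof. by move=> ->. Qed.

Lemma dcurve_ext f g t v : f =1 g -> dcurve f t v -> dcurve g t v.
Proof. by move=> /funext ->. Qed.

Lemma dcurveD f g t v w : dcurve f t v -> dcurve g t w ->
  dcurve (fun s => f s + g s) t (v + w).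
Proof.
move=> H H' e e0; have e2 : 0 < e / 2 by rewrite divr_gt0.
have [d d0 h1] := H _ e2; have [d' d'0 h2] := H' _ e2.
exists (Num.min d d'); first by rewrite lt_min d0.
move=> h; rewrite le_min => /andP[k1 k2].
rewrite [e]splitr mulrDl.
have -> : f (t + h) + g (t + h) - (f t + g t) - h%:C *: (v + w) =
  (f (t + h) - f t - h%:C *: v) + (g (t + h) - g t - h%:C *: w).
  by seqring.
exact: bd_add (h1 _ k1) (h2 _ k2).
Qed.

Lemma dcurve_linear (A : (nat -> R[i]) -> nat -> R[i]) (c : R) f t v : 0 <= c ->
  (forall x B, bd x B -> bd (A x) (c * B)) ->
  (forall x y, A (x - y) = A x - A y) -> (forall h x, A (h%:C *: x) = h%:C *: A x) ->
  dcurve f t v -> dcurve (fun s => A (f s)) t (A v).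
Proof.
move=> c0 AB AD AZ H e e0; have c1 : 0 < c + 1 by rewrite ltr_wpDl.
have [d d0 Hd] := H _ (divr_gt0 e0 c1); exists d => // h /Hd k.
rewrite -AZ -!AD; apply: bd_le (AB _ _ k) _.
rewrite mulrA ler_wpM2r // mulrA ler_pdivrMr // [c * e]mulrC ler_wpM2l ?(ltW e0) //.
by rewrite lerDl.
Qed.

Lemma dcurveZ c f t v : dcurve f t v -> dcurve (fun s => c *: f s) t (c *: v).
Proof.
apply: (@dcurve_linear (fun x => c *: x) (normc c)); first exact: normc_ge0.
- by move=> x B; exact: bd_scale.
- by move=> x y; exact: scalerBr.
by move=> h x; rewrite !scalerA mulrC.
Qed.

Lemma dcurve_sh f t v : dcurve f t v -> dcurve (fun s => sh (f s)) t (sh v).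
Proof.
apply: (@dcurve_linear (@sh R) 1) => //; by move=> x B xB; rewrite mul1r; exact: bd_sh.
Qed.

Lemma dcurveB f g t v w : dcurve f t v -> dcurve g t w ->
  dcurve (fun s => f s - g s) t (v - w).
Proof.
move=> Df /(dcurveZ (-1)) Dg; rewrite -[- w]scaleN1r.
by apply: dcurve_ext (dcurveD Df Dg) => s; rewrite scaleN1r.
Qed.

Lemma dcurve_ccurve f t v : l1 v -> dcurve f t v -> ccurve f t.
Proof.
move=> [V vV] H e e0; have V0 := bd_ge0 vV.
have [d d0 Hd] := H 1 ltr01; have V1 : 0 < 1 + V by rewrite ltr_pwDl.
exists (Num.min d (e / (1 + V))); first by rewrite lt_min d0 divr_gt0.
move=> h; rewrite le_min ler_pdivlMr // => /andP[hd he].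
apply: bd_ext (bd_le (bdD (Hd _ hd) (bdZ h%:C vV)) _) _.
  by rewrite normc_h; move: he; lra.
by move=> k; rewrite -[LHS]/(f (t + h) k - f t k - h%:C * v k + h%:C * v k) subrK.
Qed.

Section Bilinear.
Variable b : (nat -> R[i]) -> (nat -> R[i]) -> nat -> R[i].
Hypothesis bB : forall x y A B, bd x A -> bd y B -> bd (b x y) (A * B).
Hypothesis bDl : forall x y z, l1 x -> l1 y -> l1 z -> b (x + y) z = b x z + b y z.
Hypothesis bDr : forall x y z, l1 x -> l1 y -> l1 z -> b x (y + z) = b x y + b x z.
Hypothesis bZl : forall h x y, l1 x -> l1 y -> b (h%:C *: x) y = h%:C *: b x y.
Hypothesis bZr : forall h x y, l1 x -> l1 y -> b x (h%:C *: y) = h%:C *: b x y.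

(** The increment of [b (f s) (g s)] is the expected linear part plus three terms
    that are quadratically small. *)
Lemma dcurve_bilinear f g t v w : (forall s, l1 (f s)) -> (forall s, l1 (g s)) ->
  l1 v -> l1 w -> dcurve f t v -> dcurve g t w ->
  dcurve (fun s => b (f s) (g s)) t (b v (g t) + b (f t) w).
Proof.
move=> lf lg lv lw Df Dg e e0.
have [F fF] := lf t; have [G gG] := lg t; have [V vV] := lv; have [W wW] := lw.
have F0 := bd_ge0 fF; have G0 := bd_ge0 gG; have V0 := bd_ge0 vV; have W0 := bd_ge0 wW.
pose C := 4 * (1 + F + G + V + W).
have C0 : 0 < C by rewrite /C; lra.
pose e1 := Num.min 1 (e / C); have e10 : 0 < e1 by rewrite lt_min ltr01 divr_gt0.
have [d d0 H1] := Df _ e10; have [d' d'0 H2] := Dg _ e10.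
pose e3 := e / (C * (1 + V + W)).
have e30 : 0 < e3 by rewrite divr_gt0 // mulr_gt0 //; lra.
have [d3 d30 H3] := dcurve_ccurve lw Dg e30.
exists (Num.min (Num.min d d') d3); first by rewrite !lt_min d0 d'0.
move=> h; rewrite !le_min => /andP[/andP[k1 k2] k3].
set r := f (t + h) - f t - h%:C *: v; set q := g (t + h) - g t - h%:C *: w.
have rB : bd r (e1 * `|h|) := H1 _ k1.
have qB : bd q (e1 * `|h|) := H2 _ k2.
have gB : bd (g (t + h) - g t) e3 := H3 _ k3.
have lr : l1 r by eexists; exact: rB.
have lq : l1 q by eexists; exact: qB.
have lgd : l1 (g (t + h) - g t) by eexists; exact: gB.
have Ef : f (t + h) = f t + (h%:C *: v + r).
  by rewrite /r; seqring.
have Eg : g (t + h) = g t + (h%:C *: w + q).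
  by rewrite /q; seqring.
have Eg' : g (t + h) = g t + (g (t + h) - g t) by seqring.
have lhv : l1 (h%:C *: v) by exact: l1_scale.
have lhw : l1 (h%:C *: w) by exact: l1_scale.
have -> : b (f (t + h)) (g (t + h)) - b (f t) (g t) - h%:C *: (b v (g t) + b (f t) w) =
    b (f t) q + h%:C *: b v (g (t + h) - g t) + b r (g (t + h)).
  have l2 := l1_add lhv lr; have l3 := l1_add lhw lq.
  rewrite {1}Ef (bDl (lf t) l2 (lg _)) (bDl lhv lr (lg _)) (bZl h lv (lg _)).
  have -> : b (f t) (g (t + h)) = b (f t) (g t) + (h%:C *: b (f t) w + b (f t) q).
    by rewrite Eg (bDr (lf t) (lg t) l3) (bDr (lf t) lhw lq) (bZr h (lf t) lw).
  have -> : b v (g (t + h)) = b v (g t) + b v (g (t + h) - g t) by rewrite -bDr // -Eg'.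
  by seqring.
have gB' : bd (g (t + h)) (G + e3) by rewrite Eg'; exact: bd_add.
apply: bd_le (bd_add (bd_add (bB fF qB) (bd_scale h%:C (bB vV gB))) (bB rB gB')) _.
rewrite normc_h.
have -> : F * (e1 * `|h|) + `|h| * (V * e3) + e1 * `|h| * (G + e3) =
   (F * e1 + V * e3 + e1 * (G + e3)) * `|h| by ring.
apply: ler_wpM2r => //.
have a1 : e1 <= e / C by rewrite ge_min lexx orbT.
have a2 : e1 <= 1 by rewrite ge_min lexx.
have a3 : e3 * (1 + V + W) = e / C by rewrite /e3; field; rewrite !gt_eqF //; lra.
have a4 : C * (e / C) = e by rewrite mulrC divfK // gt_eqF.
have b1 : F * e1 <= F * (e / C) by rewrite ler_wpM2l.
have b2 : V * e3 <= e / C by rewrite -a3; have := mulr_ge0 (ltW e30) W0; lra.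
have b3 : e1 * G <= e / C * G by rewrite ler_wpM2r.
have b4 : e1 * e3 <= e / C.
  apply: (@le_trans _ _ (1 * e3)); first by rewrite ler_wpM2r ?(ltW e30).
  by rewrite -a3; have := mulr_ge0 (ltW e30) W0; have := mulr_ge0 (ltW e30) V0; lra.
have c0 : 0 < e / C by rewrite divr_gt0.
have b5 := mulr_ge0 (ltW c0) F0; have b6 := mulr_ge0 (ltW c0) G0.
have b7 := mulr_ge0 (ltW c0) V0; have b8 := mulr_ge0 (ltW c0) W0.
rewrite /C in a4 *; move: a4; rewrite -/C => a4.
have {}a4 : 4 * (e / C + (e / C) * F + e / C * G + e / C * V + e / C * W) = e.
  by rewrite -[RHS]a4; rewrite {6}/C; ring.
rewrite mulrDr; move: b1; rewrite [F * (e / C)]mulrC; lra.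
Qed.

End Bilinear.

Lemma dcurve_convol f g t v w : (forall s, l1 (f s)) -> (forall s, l1 (g s)) ->
  l1 v -> l1 w -> dcurve f t v -> dcurve g t w ->
  dcurve (fun s => convol (f s) (g s)) t (convol v (g t) + convol (f t) w).
Proof.
apply: dcurve_bilinear.
- exact: bd_conv.
- by move=> *; exact: convolDl.
- by move=> *; exact: convolDr.
- by move=> *; exact: convolZl.
by move=> *; exact: convolZr.
Qed.

Lemma dcurve_corr f g t v w : (forall s, l1 (f s)) -> (forall s, l1 (g s)) ->
  l1 v -> l1 w -> dcurve f t v -> dcurve g t w ->
  dcurve (fun s => corr (f s) (g s)) t (corr v (g t) + corr (f t) w).
Proof.
apply: dcurve_bilinear.
- exact: bd_corr.
- exact: corrDl.
- exact: corrDr.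
- by move=> h x y lx ly; rewrite corrZl // conjc_real.
by move=> h x y lx ly; exact: corrZr.
Qed.

Lemma sder_dot f g t v w : (forall s, l1 (f s)) -> (forall s, l1 (g s)) ->
  l1 v -> l1 w -> dcurve f t v -> dcurve g t w ->
  sder (fun s => dot (f s) (g s)) t (dot v (g t) + dot (f t) w).
Proof.
move=> lf lg lv lw Df Dg; rewrite addrC.
exact: (dcurve_coord 0%N (dcurve_corr lg lf lw lv Dg Df)).
Qed.

(** A scalar function is viewed as a curve of constant terms. *)
Lemma dcurve_phase p f t q v : (forall s, l1 (f s)) -> l1 v -> sder p t q -> dcurve f t v ->
  dcurve (fun s => p s *: f s) t (q *: f t + p t *: v).
Proof.
move=> lf lv Dp Df.
have conv1 (c : R[i]) x : convol (c *: delta0 R) x = c *: x.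
  by rewrite convolZl convolC conv_delta0.
rewrite -(conv1 q) -(conv1 (p t)).
apply: (dcurve_ext (f := fun s => convol (p s *: delta0 R) (f s))).
  by move=> s; rewrite conv1.
have ld (c : R[i]) : l1 (c *: delta0 R) by apply/l1_scale/l1_delta0.
apply: dcurve_convol => // e e0.
have [d d0 Hd] := Dp e e0; exists d => // h /Hd k.
rewrite scalerA -!scalerBl; apply: bd_le (bd_scale _ (@bd_delta0 R)) _.
by rewrite mulr1.
Qed.

End CurveCalculus.

(** * The flow on sequences of Fourier coefficients *)

Section Gronwall.
Variable R : realType.

Lemma rderM (f g : R -> R) t a b : rder f t a -> rder g t b ->
  rder (fun s => f s * g s) t (f t * b + g t * a).
Proof.
move=> /rder_is_derive Df /rder_is_derive Dg; apply: is_derive_rder.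
Qed.

(** [N] multiplied by [exp (- c (t - t0))] decreases, and multiplied by
    [exp (c (t - t0))] increases. *)
Lemma gronwall (N N' : R -> R) (a b t0 c : R) :
  (forall t, a < t < b -> rder N t (N' t)) -> (forall t, a < t < b -> `|N' t| <= c * N t) ->
  (forall t, 0 <= N t) -> a < t0 < b -> N t0 = 0 -> forall t, a < t < b -> N t = 0.
Proof.
move=> DN NB N0 /andP[at0 t0b] Nt0 t /andP[at_ tb]; apply/eqP; rewrite eq_le N0 andbT.
have [tt|tt] := leP t0 t.
  pose f s := - (N s * expR (- c * (s - t0))).
  have := @rder_mono R f (fun s => - (N s * (- c * expR (- c * (s - t0))) + expR (- c * (s - t0)) * N' s)) _ _ tt.
  rewrite /f Nt0 mul0r oppr0 oppr_ge0 pmulr_lle0 ?expR_gt0 //; apply.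
  - move=> s /andP[s1 s2].
    have := rderZ (-1) (rderM (DN s _) (rder_expR (- c) t0 s)).
    rewrite mulN1r (lt_le_trans at0 s1) (le_lt_trans s2 tb) => /(_ isT).
    by apply: rder_ext => x; rewrite mulN1r.
  - move=> s /andP[s1 s2].
    have := NB s; rewrite (lt_le_trans at0 s1) (le_lt_trans s2 tb) => /(_ isT).
    rewrite ler_norml => /andP[_ h].
    have -> : - (N s * (- c * expR (- c * (s - t0))) + expR (- c * (s - t0)) * N' s) =
      (c * N s - N' s) * expR (- c * (s - t0)) by ring.
    by rewrite mulr_ge0 ?expR_ge0 // subr_ge0.
pose f s := N s * expR (c * (s - t0)).
have := @rder_mono R f (fun s => (N s * (c * expR (c * (s - t0))) + expR (c * (s - t0)) * N' s)) _ _ (ltW tt).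
rewrite /f Nt0 mul0r pmulr_lle0 ?expR_gt0 //; apply.
- move=> s /andP[s1 s2].
  have := rderM (DN s _) (rder_expR c t0 s).
  by rewrite (lt_le_trans at_ s1) (le_lt_trans s2 t0b) => /(_ isT).
- move=> s /andP[s1 s2].
  have := NB s; rewrite (lt_le_trans at_ s1) (le_lt_trans s2 t0b) => /(_ isT).
  rewrite ler_norml => /andP[h _].
  have -> : N s * (c * expR (c * (s - t0))) + expR (c * (s - t0)) * N' s =
    (c * N s + N' s) * expR (c * (s - t0)) by ring.
  by rewrite mulr_ge0 ?expR_ge0 // -lerBlDl sub0r.
Qed.

Lemma sder_expi (c t : R) : sder (fun s => expi (c * s)) t ('i * c%:C * expi (c * t)).
Proof.
have H : is_derive t 1 (fun s : R => c * s) c.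
  by apply: rder_is_derive; have := rderZ c (rder_id t); rewrite mulr1.
apply: sder_ReIm; apply: is_derive_rder.
  have := @is_derive1_comp _ (@cos R) (fun s => c * s) t _ _ (is_derive_cos _) H.
  by move=> h; apply: is_derive_eq; rewrite /=; ring.
have := @is_derive1_comp _ (@sin R) (fun s => c * s) t _ _ (is_derive_sin _) H.
by move=> h; apply: is_derive_eq; rewrite /=; ring.
Qed.

Lemma normc_expi (x : R) : normc (expi x) = 1.
Proof. by rewrite /expi /normc cos2Dsin2 sqrtr1. Qed.

End Gronwall.

Section Boundedness.
Variable R : realType.
Implicit Types (x y : nat -> R[i]).

(** The l^1 norm itself serves to bound a continuous curve on a compact interval by
    the extreme value theorem. *)
Definition norm1 x : R := sup [set r | exists N, r = \sum_(k < N) normc (x k)].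

Lemma norm1_bd x : l1 x -> bd x (norm1 x).
Proof.
move=> [B xB] N; apply: ub_le_sup; last by exists N.
by exists B => _ [M ->].
Qed.

Lemma norm1_le x B : bd x B -> norm1 x <= B.
Proof.
move=> xB; apply: ge_sup; first by exists (\sum_(k < 0) normc (x k)); exists 0%N.
by move=> _ [M ->].
Qed.

Lemma ccurve_bounded (f : R -> nat -> R[i]) (L : R) : 0 < L -> (forall t, l1 (f t)) ->
  (forall t, ccurve f t) -> exists2 B, 0 < B & forall t, `|t| <= L -> bd (f t) B.
Proof.
move=> L0 lf cf.
have c : rcont (fun t => norm1 (f t)).
  move=> t e e0; have [d d0 Hd] := cf t e e0; exists d => // h /Hd k.
  have i1 : norm1 (f (t + h)) <= norm1 (f t) + e.
    apply: norm1_le; apply: bd_ext (bdD (norm1_bd (lf t)) k) _ => j.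
    by rewrite -[LHS]/(_ + (_ - _)) addrC subrK.
  have i2 : norm1 (f t) <= norm1 (f (t + h)) + e.
    apply: norm1_le; apply: bd_ext (bdB (norm1_bd (lf (t + h))) k) _ => j.
    by rewrite -[LHS]/(_ - (_ - _)) subKr.
  by rewrite ler_norml; apply/andP; split; first [lra|idtac].
have LL : - L <= L by rewrite ge0_cp ?ltW.
have := EVT_max LL (continuous_subspaceT (rcont_continuous c)).
move=> [s _ H]; exists (norm1 (f s) + 1).
  by rewrite ltr_wpDl // (bd_ge0 (norm1_bd (lf s))).
move=> t tL; apply: bd_le (norm1_bd (lf t)) _.
apply: (le_trans (H t _)); last by rewrite lerDl.
by rewrite in_itv /= -ler_norml.
Qed.

End Boundedness.

Section Flow.
Variables (R : realType) (alpha : R) (u : R -> nat -> R[i]) (s2 : R).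
Hypotheses (lu : forall t, l1 (u t)) (s2_gt0 : 0 < s2).
Let d0 := delta0 R.
Definition flow_rhs t := - 'i *: (Top (u t) (u t) + (alpha%:C * u t 0%N) *: d0).
Hypothesis Du : forall t, dcurve u t (flow_rhs t).
Implicit Types (x y z : nat -> R[i]) (f g : R -> nat -> R[i]).
Local Notation K t := (Kop (u t)).
Local Notation T t := (Top (u t)).

Let ld0 : l1 d0 := l1_delta0 R.

Lemma l1_rhs t : l1 (flow_rhs t).
Proof.
apply/l1_scale/l1_add; last exact: l1_scale.
exact: l1_Top.
Qed.

Lemma ccurve_u t : ccurve u t.
Proof. exact: dcurve_ccurve (l1_rhs t) (Du t). Qed.

Variable L : R.
Hypothesis L0 : 0 < L.

(** Solutions on the time interval ]-L, L[ of the linear equation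
    [y' = - i T_(|u|^2) y], the propagator of the Lax pair. *)
Definition sol f := (forall t, l1 (f t)) /\
  forall t, `|t| < L -> dcurve f t (- 'i *: T t (f t)).

Lemma sol_exists t0 x : `|t0| < L -> l1 x -> exists2 f, sol f & f t0 = x.
Proof.
move=> t0L [B xB].
(* Time is clamped to [-L, L], where [u] is bounded in l^1. *)
pose cl (t : R) := Num.max (- L) (Num.min L t).
have LL : - L <= L by rewrite ge0_cp ?ltW.
have clL t : `|cl t| <= L.
  by rewrite ler_norml /cl le_max lexx /= ge_max LL ge_min lexx.
have cl_id t : `|t| < L -> cl t = t.
  rewrite ltr_norml => /andP[h1 h2]; rewrite /cl (min_idPr (ltW h2)).
  exact: (max_idPr (ltW h1)).
have cl_lip t h : `|cl (t + h) - cl t| <= `|h|.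
  have h1 := ler_norm h; have := ler_norm (- h); rewrite normrN => h2.
  rewrite /cl !minEle; case: (leP L (t + h)) => a1; case: (leP L t) => a2;
    rewrite !maxEle ?LL /=; try (case: (leP (- L) (t + h)) => a3); try (case: (leP (- L) t) => a4);
    rewrite ler_norml; apply/andP; split; lra.
have [M M0 uM] := ccurve_bounded L0 lu ccurve_u.
have uc t : bd (u (cl t)) M by apply/uM/clL.
pose A t x := - 'i *: T (cl t) x.
have Ni : normc (- 'i : R[i]) = 1 by rewrite normcN /normc expr0n expr1n add0r sqrtr1.
have AM t y C : bd y C -> bd (A t y) (M * M * C).
  move=> yC; have -> : M * M * C = normc (- 'i : R[i]) * (M * (M * C)).
    by rewrite Ni mul1r mulrA.
  apply: bd_scale.
  by apply: bd_corr (uc t) _; apply: bd_conv.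
have AB t y z : l1 y -> l1 z -> A t (y - z) = A t y - A t z.
  by move=> ly lz; rewrite /A TopB // scalerBr.
have Ac t e : 0 < e -> exists2 d, 0 < d & forall h, `|h| <= d ->
    forall y C, bd y C -> bd (A (t + h) y - A t y) (e * C).
  move=> e0; have e1 : 0 < e / (2 * M) by rewrite divr_gt0 // mulr_gt0.
  have [d d_0 Hd] := ccurve_u (cl t) e1; exists d => // h hd y C yC.
  have ly : l1 y by exists C.
  have k : bd (u (cl (t + h)) - u (cl t)) (e / (2 * M)).
    have := Hd (cl (t + h) - cl t) (le_trans (cl_lip t h) hd).
    by rewrite (addrC (cl t)) subrK.
  set u1 := u (cl (t + h)) in k *; set u2 := u (cl t) in k *.
  have lu1 : l1 u1 := lu _; have lu2 : l1 u2 := lu _.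
  have -> : A (t + h) y - A t y =
      - 'i *: (corr (u1 - u2) (convol u1 y) + corr u2 (convol (u1 - u2) y)).
    rewrite /A /Top -/u1 -/u2 -scalerBr; congr (_ *: _).
    have l12 : l1 (- u2) by exact: l1N.
    rewrite corrBl //; last exact: l1_conv.
    have -> : convol (u1 - u2) y = convol u1 y - convol u2 y.
      by rewrite -(scaleN1r u2) convolDl convolZl scaleN1r.
    by rewrite corrBr ?addrA ?subrK //; exact: l1_conv.
  have -> : e * C = normc (- 'i : R[i]) * (e * C) by rewrite Ni mul1r.
  apply: bd_scale.
  apply: bd_le (bd_add (bd_corr k (bd_conv (uc _) yC)) (bd_corr (uc _) (bd_conv k yC))) _.
  rewrite le_eqVlt; apply/orP; left; apply/eqP; field.
  by rewrite gt_eqF.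
have MM0 : 0 < M * M by rewrite mulr_gt0.
have [Y [Yt0 lY DY]] := picard AM AB Ac MM0 t0 xB.
exists Y => //; split => // t tL.
by have := DY t; rewrite /A cl_id.
Qed.

Lemma sol_scale c f : sol f -> sol (fun t => c *: f t).
Proof.
move=> [lf Df]; split=> [t|t tL]; first exact: l1_scale.
apply: dcurve_eq (dcurveZ c (Df t tL)).
by rewrite TopZ // !scalerA mulrC.
Qed.

Lemma sol_sub f g : sol f -> sol g -> sol (fun t => f t - g t).
Proof.
move=> [lf Df] [lg Dg]; split=> [t|t tL]; first exact: l1_sub.
apply: dcurve_eq (dcurveB (Df t tL) (Dg t tL)).
by rewrite TopB // scalerBr.
Qed.

Lemma constant_on (p : R -> R[i]) t t' : (forall t, `|t| < L -> sder p t 0) ->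
  `|t| < L -> `|t'| < L -> p t = p t'.
Proof.
move=> Dp; wlog tt : t t' / t <= t' => [H|] tL t'L.
  by have [tt|/ltW tt] := leP t t'; [exact: H|symmetry; exact: H].
apply: sder0_eq => // s /andP[s1 s2_]; apply: Dp.
move: tL t'L; rewrite !ltr_norml => /andP[a1 a2] /andP[b1 b2].
by rewrite (lt_le_trans a1 s1) (le_lt_trans s2_ b2).
Qed.

Let Ji : (- 'i : R[i])^* = 'i.
Proof. by apply/eqP; rewrite eq_complex /= oppr0 opprK !eqxx. Qed.

Let Ji' : ('i : R[i])^* = - 'i.
Proof. by apply/eqP; rewrite eq_complex /= oppr0 !eqxx. Qed.

(** The flow is unitary because [T] is symmetric. *)
Lemma sol_dot f g t t' : sol f -> sol g -> `|t| < L -> `|t'| < L ->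
  dot (f t) (g t) = dot (f t') (g t').
Proof.
move=> [lf Df] [lg Dg]; apply: (constant_on (p := fun t => dot (f t) (g t))) => {t t'} t tL.
have l1T h : l1 h -> l1 (T t h) by move=> lh; apply: l1_Top.
have := sder_dot lf lg (l1_scale _ (l1T _ (lf t))) (l1_scale _ (l1T _ (lg t))) (Df t tL) (Dg t tL).
rewrite dotZl ?dotZr ?Top_sym //; try exact: l1T.
by rewrite Ji mulNr addNr.
Qed.

Lemma sol_eq0 f t0 : sol f -> `|t0| < L -> f t0 = 0 -> forall t, `|t| < L -> f t = 0.
Proof.
move=> sf t0L f0 t tL; apply: dot_eq0; first exact: sf.1.
by rewrite (sol_dot sf sf tL t0L) f0 dot0l.
Qed.

(** The term [alpha (u | 1)] of the equation is constant in space and disappears in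
    the backward shift of [u]; what remains is the Lax equation [Kop_Lax]. *)
Lemma Kop_curve f t v : (forall t, l1 (f t)) -> l1 v -> dcurve f t v ->
  dcurve (fun s => K s (f s)) t
    (- 'i *: (T t (K t (f t)) + K t (T t (f t)) - K t (K t (K t (f t)))) + K t v).
Proof.
move=> lf lv Df; have lut := lu t.
have lsh s : l1 (sh (u s)) by apply: l1_sh.
apply: dcurve_eq (dcurve_corr lf lsh lv (l1_sh (l1_rhs t)) Df (dcurve_sh (Du t))).
rewrite addrC; congr (_ + _).
rewrite -Kop_Lax // /Kop -corrZr //; last exact/l1_sh/l1_Top.
congr corr; apply/funext => k; rewrite /sh /flow_rhs.
by rewrite -[LHS]/(- 'i * (Top (u t) (u t) k.+1 + alpha%:C * u t 0%N * 0)) mulr0 addr0.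
Qed.

Lemma sol_Kop_curve f t : sol f -> `|t| < L ->
  dcurve (fun s => K s (f s)) t (- 'i *: T t (K t (f t)) + 'i *: K t (K t (K t (f t)))).
Proof.
move=> [lf Df] tL; have lut := lu t.
apply: dcurve_eq (Kop_curve lf (l1_scale _ (l1_Top lut (lf t))) (Df t tL)).
rewrite KopZ //; last exact: l1_Top.
by rewrite Ji; seqring.
Qed.

(** The cubic terms in [K] cancel because [K] is antilinear. *)
Lemma sol_Kop2 f : sol f -> sol (fun t => K t (K t (f t))).
Proof.
move=> sf; have [lf Df] := sf.
have lK t x : l1 x -> l1 (K t x) by move=> lx; apply: l1_Kop.
have lT t x : l1 x -> l1 (T t x) by move=> lx; apply: l1_Top.
split=> [t|t tL]; first exact/lK/lK.
have lKf s : l1 (K s (f s)) by exact: lK.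
have lK3 : l1 (K t (K t (K t (f t)))) by exact/lK/lK/lK.
have lTK : l1 (T t (K t (f t))) by apply/lT/lK.
apply: dcurve_eq (Kop_curve lKf _ (sol_Kop_curve sf tL)); last by apply: l1_add; apply: l1_scale.
rewrite KopD //; try exact: l1_scale.
by rewrite !KopZ // Ji Ji'; seqring.
Qed.

(** [K^2 f - s2 f] is a solution too, which vanishes at time [t0]. *)
Lemma sol_eigK f t0 : sol f -> `|t0| < L -> eigK (u t0) s2 (f t0) ->
  forall t, `|t| < L -> eigK (u t) s2 (f t).
Proof.
move=> sf t0L [_ E] t tL; split; first exact: sf.1.
have sz := sol_sub (sol_Kop2 sf) (sol_scale s2%:C sf).
have := sol_eq0 sz t0L; rewrite E subrr => /(_ erefl t tL) /eqP.
by rewrite subr_eq0 => /eqP.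
Qed.

(** On the eigenspace the cubic term of the Lax equation is a multiple of [K f], which
    the phase compensates. *)
Lemma sol_Kop f : sol f -> (forall t, `|t| < L -> eigK (u t) s2 (f t)) ->
  sol (fun t => expi (- s2 * t) *: K t (f t)).
Proof.
move=> sf Ff; have [lf Df] := sf.
have lK t x : l1 x -> l1 (K t x) by move=> lx; apply: l1_Kop.
have lT t x : l1 x -> l1 (T t x) by move=> lx; apply: l1_Top.
split=> [t|t tL]; first exact/l1_scale/lK.
have lv : l1 (- 'i *: T t (K t (f t)) + 'i *: K t (K t (K t (f t)))).
  by apply: l1_add; apply: l1_scale; [apply/lT/lK|apply/lK/lK/lK].
have lKf s : l1 (K s (f s)) by exact: lK.
apply: dcurve_eq (dcurve_phase lKf lv (sder_expi (- s2) t) (sol_Kop_curve sf tL)).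
rewrite (Ff t tL).2 KopZ // conjc_real TopZ //.
rewrite rmorphN /=; by seqring.
Qed.

(** Along a solution in the eigenspace, the pair [(f | u)], [(f | 1)] solves a closed
    linear system of two equations: the perturbation [alpha (u | 1)] acts on [(f | u)]
    through [(f | 1)] only. *)
Lemma sol_vanish f t0 : sol f -> `|t0| < L -> (forall t, `|t| < L -> eigK (u t) s2 (f t)) ->
  dot (f t0) (u t0) = 0 -> f t0 0%N = 0 ->
  forall t, `|t| < L -> dot (f t) (u t) = 0 /\ f t 0%N = 0.
Proof.
move=> sf t0L Ff q0 p0; have [lf Df] := sf.
have lT t x : l1 x -> l1 (T t x) by move=> lx; apply: l1_Top.
pose p t := f t 0%N; pose q t := dot (f t) (u t).
have Dp t : `|t| < L -> sder p t (- 'i * (u t 0%N * q t + s2%:C * p t)).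
  move=> tL; have := dcurve_coord 0%N (Df t tL).
  rewrite -[(_ *: _) 0%N]/(- 'i * T t (f t) 0%N) -(dot_delta0 (T t (f t))) Top_sym //.
  rewrite Top_delta0E // dotDr //; [|exact: l1_scale|by apply: (l1_Kop (lu t)); apply: (l1_Kop (lu t))].
  by rewrite dotZr // conjcK -Kop2_sym // (Ff t tL).2 dotZl // dot_delta0.
have Dq t : `|t| < L -> sder q t ('i * alpha%:C * (u t 0%N)^* * p t).
  move=> tL; have := sder_dot lf lu (l1_scale _ (lT _ _ (lf t))) (l1_rhs t) (Df t tL) (Du t).
  rewrite dotZl ?Top_sym //; try exact: lT.
  rewrite /flow_rhs dotZr ?Ji; [|by []|by apply: l1_add; [exact: lT|exact: l1_scale]].
  rewrite dotDr //; [|exact: lT|exact: l1_scale].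
  rewrite dotZr // dot_delta0 conjcM conjc_real mulNr mulrDr addKr.
  by rewrite -/(p t) !mulrA.
have [B B0 uB] := ccurve_bounded L0 lu ccurve_u.
pose N t := normc (p t) ^+ 2 + normc (q t) ^+ 2.
pose N' t := 2 * (complex.Re (p t) * complex.Re (- 'i * (u t 0%N * q t + s2%:C * p t)) +
  complex.Im (p t) * complex.Im (- 'i * (u t 0%N * q t + s2%:C * p t)) +
  (complex.Re (q t) * complex.Re ('i * alpha%:C * (u t 0%N)^* * p t) +
  complex.Im (q t) * complex.Im ('i * alpha%:C * (u t 0%N)^* * p t))).
have inI t : - L < t < L -> `|t| < L by rewrite ltr_norml.
have DN t : - L < t < L -> rder N t (N' t).
  move=> /inI tL.
  have a1 := sder_Re (Dp t tL); have a2 := sder_Im (Dp t tL).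
  have a3 := sder_Re (Dq t tL); have a4 := sder_Im (Dq t tL).
  have := rderD (rderD (rderM a1 a1) (rderM a2 a2)) (rderD (rderM a3 a3) (rderM a4 a4)).
  set w := (X in rder _ _ X) => H.
  have -> : N' t = w by rewrite /N' /w; ring.
  by apply: rder_ext H => x; rewrite /N !sqr_normcE !expr2.
have RI (a b : R[i]) : `|complex.Re a * complex.Re b + complex.Im a * complex.Im b| <= normc a * normc b.
  have -> : complex.Re a * complex.Re b + complex.Im a * complex.Im b = complex.Re (a * b^*).
    by case: a => a1 a2; case: b => b1 b2 /=; ring.
  by apply: le_trans (Re_le_normc _) _; rewrite normcM normc_conj.
have Ni : normc ('i : R[i]) = 1 by rewrite /normc expr0n expr1n add0r sqrtr1.
have NB t : - L < t < L -> `|N' t| <= (2 * (B * (1 + `|alpha|) + s2)) * N t.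
  move=> /inI tL.
  have u0 : normc (u t 0%N) <= B by apply: bd_coord (uB t (ltW tL)).
  have P0 := normc_ge0 (p t); have Q0 := normc_ge0 (q t); have U0 := normc_ge0 (u t 0%N).
  have b1 : normc (- 'i * (u t 0%N * q t + s2%:C * p t)) <= B * normc (q t) + s2 * normc (p t).
    rewrite normcM normcN Ni mul1r; apply: le_trans (normcD _ _) _.
    rewrite !normcM normc_real (gtr0_norm s2_gt0) lerD2r; exact: ler_wpM2r.
  have b2 : normc ('i * alpha%:C * (u t 0%N)^* * p t) <= `|alpha| * B * normc (p t).
    by rewrite !normcM Ni mul1r normc_real normc_conj ler_wpM2r // ler_wpM2l.
  rewrite /N' normrM [`|2|]ger0_norm //.
  have -> : 2 * (B * (1 + `|alpha|) + s2) * N t = 2 * ((B * (1 + `|alpha|) + s2) * N t) by ring.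
  rewrite ler_wpM2l //.
  apply: le_trans (ler_normD _ _) _.
  apply: le_trans (lerD (RI _ _) (RI _ _)) _.
  apply: le_trans (lerD (ler_wpM2l P0 b1) (ler_wpM2l Q0 b2)) _.
  rewrite /N; set P := normc (p t) in P0 *; set Q := normc (q t) in Q0 *.
  have A0 : 0 <= `|alpha| by [].
  have PQ : 2 * (P * Q) <= P ^+ 2 + Q ^+ 2 by have := sqr_ge0 (P - Q); rewrite !expr2; lra.
  have c1 := ler_wpM2l (ltW B0) PQ.
  have c2 := ler_wpM2l (mulr_ge0 A0 (ltW B0)) PQ.
  have c3 : 0 <= s2 * Q ^+ 2 by rewrite mulr_ge0 ?sqr_ge0 // ltW.
  have c4 : 0 <= B * (P ^+ 2 + Q ^+ 2) by rewrite mulr_ge0 ?addr_ge0 ?sqr_ge0 // ltW.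
  have c5 : 0 <= `|alpha| * B * (P ^+ 2 + Q ^+ 2) by rewrite mulr_ge0 ?mulr_ge0 ?addr_ge0 ?sqr_ge0 // ltW.
  move: c1 c2 c3 c4 c5; rewrite !expr2; lra.
move=> t tL.
have /eqP : N t = 0.
  apply: (gronwall DN NB (t0 := t0)).
  - by move=> s; rewrite addr_ge0 ?sqr_ge0.
  - by rewrite -ltr_norml.
  - by rewrite /N /p /q q0 p0 normc0 expr0n addr0.
  - by rewrite -ltr_norml.
rewrite /N paddr_eq0 ?sqr_ge0 // !sqrf_eq0 !normc_eq0 => /andP[/eqP h1 /eqP h2].
by split.
Qed.

(** The defect of commutation of the backward shift with [T] is carried by the
    coefficient of index zero. *)
Lemma sol_sh f : sol f -> (forall t, `|t| < L -> f t 0%N = 0) -> sol (fun t => sh (f t)).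
Proof.
move=> [lf Df] f0; split=> [t|t tL]; first exact/l1_sh.
apply: dcurve_eq (dcurve_sh (Df t tL)).
rewrite -[LHS]/(- 'i *: sh (T t (f t))) sh_Top //.
by rewrite f0 // scale0r addr0.
Qed.

End Flow.

(** * Invariance of the quotient of K a by a *)

Section Invariance.
Variables (R : realType) (alpha : R) (u : R -> nat -> R[i]) (s2 : R).
Hypotheses (lu : forall t, l1 (u t)) (s2_gt0 : 0 < s2).
Hypothesis Du : forall t, dcurve u t (flow_rhs alpha u t).
Implicit Types (x y z a f : nat -> R[i]).
Local Notation K t := (Kop (u t)).

Definition component t a : Prop :=
  eigK (u t) s2 a /\ forall f, eigK (u t) s2 f -> dot f (u t) = dot f a.

(** Let [y] be the solution starting from [a0] and [b 0 = exp (- i s2 t) K y], a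
    solution in the eigenspace too. Divide [b 0] by [y] as power series. The first
    coefficient of the quotient is [(b 0 | y) / (y | y)], constant in time, because the
    remainder is orthogonal to [y], hence vanishes at frequency zero at all times; its
    backward shift [b 1] is again a solution in the eigenspace, and the division
    goes on. Thus the quotient [th] does not depend on time. The component at time [t]
    is a multiple [c y], and [K (c y) = conj(c) K y] accounts for the phase. *)
Lemma component_quotient a0 a t : component 0 a0 -> a0 <> 0 -> component t a -> a <> 0 ->
  exists th gamma, [/\ normc gamma = 1, K 0 a0 = convol th a0 &
    K t a = gamma *: convol th a].
Proof.
move=> [Fa0 Pa0] a0N [Fa Pa] aN.
pose L := `|t| + 1.
have L0 : 0 < L by rewrite ltr_wpDl.
have oL : `|0 : R| < L by rewrite normr0.
have tL : `|t| < L by rewrite ltrDl.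
have la0 := eigK_l1 Fa0; have la := eigK_l1 Fa.
have lK s x : l1 x -> l1 (K s x) by move=> lx; apply: l1_Kop.
have [y sy y0] := sol_exists lu Du L0 oL la0.
have ly s : l1 (y s) := sy.1 s.
have Fy s : `|s| < L -> eigK (u s) s2 (y s).
  by apply: (sol_eigK lu Du sy oL); rewrite y0.
pose n0 := dot a0 a0.
have n0N : n0 != 0 by apply/eqP => h; apply: a0N; exact: dot_eq0.
have yy s : `|s| < L -> dot (y s) (y s) = n0.
  by move=> sL; rewrite (sol_dot lu sy sy sL oL) y0.
(* Orthogonality to [y] at time 0 entails orthogonality to [u] and to [1] at all times. *)
have perp (f : R -> nat -> R[i]) : sol u L f -> (forall s, `|s| < L -> eigK (u s) s2 (f s)) -> dot (f 0) (y 0) = 0 ->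
    forall s, `|s| < L -> dot (f s) (u s) = 0 /\ f s 0%N = 0.
  move=> sf Ff fy; rewrite y0 in fy.
  have F0 := Ff 0 oL; have fu : dot (f 0) (u 0) = 0 by rewrite Pa0.
  apply: (sol_vanish lu s2_gt0 Du L0 sf oL Ff fu).
  apply: (eigK_vanish (lu 0) s2_gt0 Fa0 _ F0 fu).
  by rewrite dotC // Pa0 // conjc_eq0.
pose th (bn : R -> nat -> R[i]) : R[i] := dot (bn 0) (y 0) / n0.
pose step (bn : R -> nat -> R[i]) : R -> nat -> R[i] := fun s => sh (bn s - th bn *: y s).
pose b n := iter n step (fun s => expi (- s2 * s) *: K s (y s)).
pose q n := th (b n).
have rem_perp n : sol u L (b n) -> dot (b n 0 - q n *: y 0) (y 0) = 0.
  move=> sb; rewrite dotBl ?dotZl //; [|exact: sb.1|exact: l1_scale].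
  by rewrite y0 -/n0 /q /th y0 divfK // subrr.
have bP n : sol u L (b n) /\ forall s, `|s| < L -> eigK (u s) s2 (b n s).
  elim: n => [|n [sb Fb]].
    split; first exact: (sol_Kop lu Du sy Fy).
    by move=> s sL; apply: eigK_scale => //; apply: eigK_Kop => //; exact: Fy.
  have sf := sol_sub lu sb (sol_scale lu (q n) sy).
  have Ff s : `|s| < L -> eigK (u s) s2 (b n s - q n *: y s).
    by move=> sL; apply: eigK_sub (Fb s sL) (eigK_scale _ _ (Fy s sL)).
  have fy := rem_perp n sb.
  have H := perp _ sf Ff fy.
  split; first by apply: (sol_sh lu sf) => s /H [].
  by move=> s sL; have [h1 h2] := H s sL; apply: eigK_sh => //; exact: Ff.
have quot s : `|s| < L -> expi (- s2 * s) *: K s (y s) = convol q (y s).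
  move=> sL; apply: (conv_quotient (b := fun n => b n s)); last by [].
  move=> n; have [sb Fb] := bP n.
  have sf := sol_sub lu sb (sol_scale lu (q n) sy).
  have Ff r : `|r| < L -> eigK (u r) s2 (b n r - q n *: y r).
    by move=> rL; apply: eigK_sub (Fb r rL) (eigK_scale _ _ (Fy r rL)).
  have fy := rem_perp n sb.
  have [_ /eqP] := perp _ sf Ff fy s sL.
  by rewrite -[(_ - _) 0%N]/(b n s 0%N - q n * y s 0%N) subr_eq0 => /eqP.
(* The part of [a] orthogonal to [y t], carried back to time 0, is orthogonal to [a0]. *)
have [c aE] : exists c, a = c *: y t.
  pose c := dot a (y t) / n0.
  exists c; apply/eqP; rewrite -subr_eq0; apply/eqP; set r := a - c *: y t.
  have lr : l1 r by apply: l1_sub => //; exact: l1_scale.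
  have Fr : eigK (u t) s2 r by apply: eigK_sub => //; apply: eigK_scale => //; exact: Fy.
  have ry : dot r (y t) = 0.
    rewrite dotBl ?dotZl ?yy //; last exact: l1_scale.
    by rewrite /c divfK // subrr.
  have [g sg gt] := sol_exists lu Du L0 tL lr.
  have Fg s : `|s| < L -> eigK (u s) s2 (g s).
    by apply: (sol_eigK lu Du sg tL); rewrite gt.
  have gy : dot (g 0) (y 0) = 0 by rewrite (sol_dot lu sg sy oL tL) gt.
  have [ru _] := perp _ sg Fg gy t tL; rewrite gt in ru.
  apply: dot_eq0 => //; rewrite {2}/r dotBr ?dotZr ?ry //; last exact: l1_scale.
  by rewrite -Pa // ru mulr0 subrr.
have cN : c != 0 by apply/eqP => c0; apply: aN; rewrite aE c0 scale0r.
have cJN : c^* != 0 by rewrite conjc_eq0.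
have eN : expi (- s2 * t) != 0 by rewrite -normc_eq0 normc_expi oner_eq0.
exists q, (c^* / c / expi (- s2 * t)); split.
- by rewrite !normcM !normcV normc_conj normc_expi divff ?normc_eq0 // invr1 mulr1.
- have := quot 0 oL; rewrite mulr0 y0.
  have -> : expi 0 = 1 :> R[i] by rewrite /expi cos0 sin0.
  by rewrite scale1r.
rewrite aE KopZ // convolZr -quot // !scalerA; congr (_ *: _).
by field; rewrite eN cN.
Qed.

End Invariance.

(** * Square integrable functions of the angle *)

Section AngleFunctions.
Variable R : realType.
Notation mu := (@lebesgue_measure R).
Notation A := (angles R).
Implicit Types (F G H : R -> R[i]) (f g : R -> R).

Lemma mA : measurable A. Proof. exact: measurable_itv. Qed.
Hint Resolve mA : core.

Lemma pi2_gt0 : 0 < 2 * pi :> R. Proof. by rewrite mulr_gt0 // pi_gt0. Qed.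

Lemma muA : mu A = (2 * pi)%:E.
Proof. by rewrite lebesgue_measure_itv /= lte_fin pi2_gt0 -EFinD subr0. Qed.

Definition cme F : Prop :=
  measurable_fun A (fun x => complex.Re (F x)) /\ measurable_fun A (fun x => complex.Im (F x)).

Definition sqint F : \bar R := (\int[mu]_(x in A) (normc (F x) ^+ 2)%:E)%E.

Definition L2a F : Prop := cme F /\ (sqint F < +oo)%E.

Lemma ReM (z w : R[i]) : complex.Re (z * w) = complex.Re z * complex.Re w - complex.Im z * complex.Im w.
Proof. by case: z; case: w. Qed.
Lemma ImM (z w : R[i]) : complex.Im (z * w) = complex.Re z * complex.Im w + complex.Im z * complex.Re w.
Proof. by case: z; case: w. Qed.
Lemma ReJ (z : R[i]) : complex.Re z^* = complex.Re z. Proof. by case: z. Qed.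
Lemma ImJ (z : R[i]) : complex.Im z^* = - complex.Im z. Proof. by case: z. Qed.

Lemma cmeD F G : cme F -> cme G -> cme (fun x => F x + G x).
Proof.
move=> [a b] [c d]; split.
  rewrite (_ : (fun x => _) = (fun x => complex.Re (F x)) \+ (fun x => complex.Re (G x))).
    exact: measurable_funD.
  by apply/funext => x; rewrite ReD.
rewrite (_ : (fun x => _) = (fun x => complex.Im (F x)) \+ (fun x => complex.Im (G x))).
  exact: measurable_funD.
by apply/funext => x; rewrite ImD.
Qed.

Lemma cmeM F G : cme F -> cme G -> cme (fun x => F x * G x).
Proof.
move=> [a b] [c d]; split.
  rewrite (_ : (fun x => _) = (fun x => complex.Re (F x)) \* (fun x => complex.Re (G x)) \-
     (fun x => complex.Im (F x)) \* (fun x => complex.Im (G x))).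
    by apply: measurable_funB; apply: measurable_funM.
  by apply/funext => x; rewrite ReM.
rewrite (_ : (fun x => _) = (fun x => complex.Re (F x)) \* (fun x => complex.Im (G x)) \+
     (fun x => complex.Im (F x)) \* (fun x => complex.Re (G x))).
  by apply: measurable_funD; apply: measurable_funM.
by apply/funext => x; rewrite ImM.
Qed.

Lemma cme_cst c : cme (fun=> c).
Proof. by split; apply: measurable_cst. Qed.

Lemma cmeZ c F : cme F -> cme (fun x => c * F x).
Proof. exact: cmeM (cme_cst c). Qed.

Lemma cme_ext F G : cme F -> F =1 G -> cme G.
Proof. by move=> cF /funext <-. Qed.

Lemma cmeN F : cme F -> cme (fun x => - F x).
Proof. by move=> cF; apply: (cme_ext (cmeZ (-1) cF)) => x; rewrite mulN1r. Qed.

Lemma cmeB F G : cme F -> cme G -> cme (fun x => F x - G x).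
Proof. by move=> cF /cmeN; apply: cmeD cF. Qed.

Lemma cme_conj F : cme F -> cme (fun x => (F x)^*).
Proof.
move=> [a b]; split.
  by rewrite (_ : (fun x => _) = (fun x => complex.Re (F x))) //; apply/funext => x; rewrite ReJ.
rewrite (_ : (fun x => _) = \- (fun x => complex.Im (F x))); first exact: measurable_funN.
by apply/funext => x; rewrite ImJ.
Qed.

Lemma cme_real f : measurable_fun A f -> cme (fun x => (f x)%:C).
Proof. by move=> mf; split; [exact: mf|exact: measurable_cst]. Qed.

Lemma measurable_normc2 F : cme F -> measurable_fun A (fun x => normc (F x) ^+ 2).
Proof.
move=> [a b]; rewrite (_ : (fun x => _) = (fun x => complex.Re (F x) ^+ 2) \+ (fun x => complex.Im (F x) ^+ 2)).
  by apply: measurable_funD; apply: measurable_funX.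
by apply/funext => x; rewrite sqr_normcE.
Qed.

Lemma emeasurable_normc2 F : cme F -> measurable_fun A (fun x => (normc (F x) ^+ 2)%:E).
Proof. move=> cF. apply/measurable_EFinP. apply: measurable_normc2. exact: cF. Qed.

Lemma sqint_ge0 F : (0 <= sqint F)%E.
Proof. by apply: integral_ge0 => x _; rewrite lee_fin sqr_ge0. Qed.

Lemma sqint_ext F G : (forall x, A x -> F x = G x) -> sqint F = sqint G.
Proof. by move=> FG; apply: eq_integral => x; rewrite inE => Ax; rewrite FG. Qed.

Lemma le_sqint F G (c : R) : 0 <= c -> cme F -> cme G ->
  (forall x, A x -> normc (F x) ^+ 2 <= c * normc (G x) ^+ 2) -> (sqint F <= c%:E * sqint G)%E.
Proof.
move=> c0 cF cG H; rewrite -ge0_integralZl_EFin //; last 2 first.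
- by move=> x _; rewrite lee_fin sqr_ge0.
- exact: emeasurable_normc2.
apply: ge0_le_integral => //.
- by move=> x _; rewrite lee_fin sqr_ge0.
- exact: emeasurable_normc2.
- by apply: emeasurable_funM; [exact: measurable_cst|exact: emeasurable_normc2].
Qed.

Lemma sqintD F G : cme F -> cme G ->
  (sqint (fun x => (F x + G x)%R) <= 2%:E * sqint F + 2%:E * sqint G)%E.
Proof.
move=> cF cG; rewrite -!ge0_integralZl_EFin //; try by
  [move=> x _; rewrite lee_fin sqr_ge0|exact: emeasurable_normc2].
have m H' : cme H' -> measurable_fun A (fun x => (2%:E * (normc (H' x) ^+ 2)%:E)%E).
  by move=> cH; apply: emeasurable_funM; [exact: measurable_cst|exact: emeasurable_normc2].
have p H' x : (0 <= 2%:E * (normc (H' x) ^+ 2)%:E :> \bar R)%E.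
  by rewrite -EFinM lee_fin mulr_ge0 // sqr_ge0.
rewrite -ge0_integralD //; [|exact: m|exact: m].
apply: ge0_le_integral => //.
- by move=> x _; rewrite lee_fin sqr_ge0.
- by apply: emeasurable_normc2; exact: cmeD.
- by apply: emeasurable_funD; exact: m.
move=> x _; rewrite -!EFinM -EFinD lee_fin.
have := normcD (F x) (G x); have := normc_ge0 (F x); have := normc_ge0 (G x).
have := normc_ge0 (F x + G x).
move: (normc (F x)) (normc (G x)) (normc _) => a b c c0 b0 a0 cab.
apply: (@le_trans _ _ ((a + b) ^+ 2)).
  by rewrite ler_pXn2r ?nnegrE // addr_ge0.
have := sqr_ge0 (a - b); rewrite !expr2; lra.
Qed.

Lemma L2aD F G : L2a F -> L2a G -> L2a (fun x => F x + G x).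
Proof.
move=> [cF iF] [cG iG]; split; first exact: cmeD.
apply: le_lt_trans (sqintD cF cG) _.
by rewrite lte_add_pinfty // lte_mul_pinfty.
Qed.

Lemma L2aM F G (M : R) : L2a F -> cme G -> (forall x, A x -> normc (G x) <= M) ->
  L2a (fun x => G x * F x).
Proof.
move=> [cF iF] cG GM; split; first exact: cmeM.
have := @le_sqint (fun x => G x * F x) F (M ^+ 2) (sqr_ge0 _) (cmeM cG cF) cF _.
move=> H; apply: le_lt_trans (H _) _; last by rewrite lte_mul_pinfty ?lee_fin ?sqr_ge0.
move=> x Ax; rewrite normcM exprMn ler_wpM2r ?sqr_ge0 //.
have h := normc_ge0 (G x).
by rewrite ler_pXn2r ?nnegrE ?GM // (le_trans h) // GM.
Qed.

Lemma L2aZ c F : L2a F -> L2a (fun x => c * F x).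
Proof. by move=> lF; apply: (L2aM (M := normc c) lF (cme_cst c)). Qed.

Lemma L2a_ext F G : L2a F -> F =1 G -> L2a G.
Proof. by move=> lF /funext <-. Qed.

Lemma L2aN F : L2a F -> L2a (fun x => - F x).
Proof. by move=> lF; apply: (L2a_ext (L2aZ (-1) lF)) => x; rewrite mulN1r. Qed.

Lemma L2aB F G : L2a F -> L2a G -> L2a (fun x => F x - G x).
Proof. by move=> lF /L2aN; apply: L2aD lF. Qed.

Lemma L2a_conj F : L2a F -> L2a (fun x => (F x)^*).
Proof.
move=> [cF iF]; split; first exact: cme_conj.
by rewrite /sqint; under eq_integral do rewrite normc_conj.
Qed.

Lemma L2a_bounded F (M : R) : cme F -> (forall x, A x -> normc (F x) <= M) -> L2a F.
Proof.
move=> cF FM; have l1 : L2a (fun=> 1).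
  split; first exact: cme_cst.
  rewrite /sqint; under eq_integral do rewrite normc1 expr1n.
  rewrite integral_cst // mul1e; by rewrite (_ : _ A = (2 * pi)%:E) ?ltry //; exact: muA.
by apply: (L2a_ext (L2aM l1 cF FM)) => x; rewrite mulr1.
Qed.

(** ** Integration of complex functions of the angle *)

Definition cin F : Prop := mu.-integrable A (EFin \o (fun x => complex.Re (F x))) /\
  mu.-integrable A (EFin \o (fun x => complex.Im (F x))).

Definition ci F : R[i] :=
  ((\int[mu]_(x in A) complex.Re (F x))%R / (2 * pi)) +i*
  ((\int[mu]_(x in A) complex.Im (F x))%R / (2 * pi)).

Lemma int_ext (f g : R -> \bar R) : mu.-integrable A f -> f =1 g -> mu.-integrable A g.
Proof. by move=> If /funext <-. Qed.

Lemma intD (f g : R -> \bar R) : mu.-integrable A f -> mu.-integrable A g ->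
  mu.-integrable A (fun x => f x + g x)%E.
Proof. by move=> If Ig; apply: integrableD => //; exact: mA. Qed.

Lemma intB (f g : R -> \bar R) : mu.-integrable A f -> mu.-integrable A g ->
  mu.-integrable A (fun x => f x - g x)%E.
Proof. by move=> If Ig; apply: integrableB => //; exact: mA. Qed.

Lemma intZ (k : R) (f : R -> \bar R) : mu.-integrable A f ->
  mu.-integrable A (fun x => k%:E * f x)%E.
Proof. by move=> If; apply: integrableZl => //; exact: mA. Qed.

Lemma int_le (f g : R -> \bar R) : measurable_fun A f ->
  (forall x, A x -> (`|f x| <= `|g x|)%E) -> mu.-integrable A g -> mu.-integrable A f.
Proof. by move=> mf fg; apply: le_integrable => //; exact: mA. Qed.

Lemma cin_ext F G : cin F -> F =1 G -> cin G.
Proof. by move=> lF /funext <-. Qed.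

Lemma ci_ext F G : F =1 G -> ci F = ci G.
Proof. by move=> /funext ->. Qed.

Lemma ciD F G : cin F -> cin G -> ci (fun x => F x + G x) = ci F + ci G.
Proof.
move=> [a b] [c d]; rewrite /ci.
under eq_Rintegral do rewrite ReD.
under [X in _ +i* (X / _)]eq_Rintegral do rewrite ImD.
by rewrite !RintegralD // !mulrDl.
Qed.

Lemma integrableZr (k : R) f : mu.-integrable A (EFin \o f) ->
  mu.-integrable A (EFin \o (fun x => k * f x)).
Proof. by move=> h; apply: (int_ext (intZ k h)). Qed.

Lemma cinZ c F : cin F -> cin (fun x => c * F x).
Proof.
move=> [a b]; split.
  apply: (int_ext (intB (integrableZr (complex.Re c) a)
    (integrableZr (complex.Im c) b))) => x /=.
  by rewrite ReM EFinB.
apply: (int_ext (intD (integrableZr (complex.Re c) b)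
    (integrableZr (complex.Im c) a))) => x /=.
by rewrite ImM EFinD.
Qed.

Lemma ciZ c F : cin F -> ci (fun x => c * F x) = c * ci F.
Proof.
move=> [a b]; rewrite /ci.
under eq_Rintegral do rewrite ReM.
under [X in _ +i* (X / _)]eq_Rintegral do rewrite ImM.
rewrite RintegralB ?RintegralD //; try exact: integrableZr.
rewrite !RintegralZl //; case: c => c1 c2 /=.
by apply/eqP; rewrite eq_complex /=; apply/andP; split; apply/eqP; ring.
Qed.

Lemma ciN F : cin F -> ci (fun x => - F x) = - ci F.
Proof. by move=> cF; rewrite -mulN1r -ciZ //; apply: ci_ext => x; rewrite mulN1r. Qed.

Lemma cinN F : cin F -> cin (fun x => - F x).
Proof. by move=> cF; apply: (cin_ext (cinZ (-1) cF)) => x; rewrite mulN1r. Qed.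

Lemma ciB F G : cin F -> cin G -> ci (fun x => F x - G x) = ci F - ci G.
Proof. by move=> cF cG; rewrite ciD ?ciN //; exact: cinN. Qed.

Lemma ci_conj F : cin F -> ci (fun x => (F x)^*) = (ci F)^*.
Proof.
move=> [a b]; rewrite /ci.
under eq_Rintegral do rewrite ReJ.
under [X in _ +i* (X / _)]eq_Rintegral do rewrite ImJ -mulN1r.
by rewrite RintegralZl //= mulN1r mulNr.
Qed.

Lemma cin_prod F G : L2a F -> L2a G -> cin (fun x => F x * (G x)^*).
Proof.
move=> [cF iF] [cG iG]; have [mR mI] := cmeM cF (cme_conj cG).
have h : mu.-integrable A (fun x => (normc (F x) ^+ 2)%:E + (normc (G x) ^+ 2)%:E)%E.
  apply: intD; apply/integrableP; split; try exact: emeasurable_normc2.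
    by under eq_integral do rewrite gee0_abs ?lee_fin ?sqr_ge0 //.
  by under eq_integral do rewrite gee0_abs ?lee_fin ?sqr_ge0 //.
have b x : normc (F x * (G x)^*) <= normc (F x) ^+ 2 + normc (G x) ^+ 2.
  rewrite normcM normc_conj; have := normc_ge0 (F x); have := normc_ge0 (G x).
  move: (normc (F x)) (normc (G x)) => a c c0 a0.
  have := sqr_ge0 (a - c); have := sqr_ge0 a; have := sqr_ge0 c; rewrite !expr2; lra.
split; apply: (int_le _ _ h).
- exact/measurable_EFinP.
- move=> x _; rewrite -EFinD !abse_EFin lee_fin [leRHS]ger0_norm ?addr_ge0 ?sqr_ge0 //.
  exact: le_trans (Re_le_normc _) (b x).
- exact/measurable_EFinP.
- move=> x _; rewrite -EFinD !abse_EFin lee_fin [leRHS]ger0_norm ?addr_ge0 ?sqr_ge0 //.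
  exact: le_trans (Im_le_normc _) (b x).
Qed.

Definition ip F G : R[i] := ci (fun x => F x * (G x)^*).

(** The inequality of Cauchy and Schwarz in additive form, with a free parameter. *)
Lemma ip_small F G (r s e : R) : 0 < e -> L2a F -> L2a G ->
  (sqint F <= r%:E)%E -> (sqint G <= s%:E)%E -> normc (ip F G) <= (e * r + s / e) / (2 * pi).
Proof.
move=> e0 lF lG Fr Gs; have [cF iF] := lF; have [cG iG] := lG.
have [iR iI] := cin_prod lF lG.
have fin H' : (sqint H' < +oo)%E -> sqint H' \is a fin_num.
  by move=> h; rewrite ge0_fin_numE // sqint_ge0.
have iH H' : L2a H' -> mu.-integrable A (EFin \o (fun x => normc (H' x) ^+ 2)).
  move=> [cH iH]; apply/integrableP; split; first exact: emeasurable_normc2.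
  by under eq_integral do rewrite gee0_abs ?lee_fin ?sqr_ge0 //.
pose N x := e / 2 * normc (F x) ^+ 2 + e^-1 / 2 * normc (G x) ^+ 2.
have iN : mu.-integrable A (EFin \o N).
  by apply: (int_ext (intD (integrableZr (e / 2) (iH _ lF))
    (integrableZr (e^-1 / 2) (iH _ lG)))) => x.
have NE : (\int[mu]_(x in A) N x)%R <= e / 2 * r + e^-1 / 2 * s.
  have i1 := iH _ lF; have i2 := iH _ lG.
  rewrite RintegralD //; last 2 first; [exact: integrableZr|exact: integrableZr|].
  rewrite !RintegralZl //.
  apply: lerD; apply: ler_wpM2l; rewrite ?divr_ge0 ?invr_ge0 ?(ltW e0) //.
    by rewrite -lee_fin fineK ?fin.
  by rewrite -lee_fin fineK ?fin.
have b x : normc (F x * (G x)^*) <= N x.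
  rewrite normcM normc_conj /N.
  move: (normc (F x)) (normc (G x)) => a c.
  have := sqr_ge0 (e * a - c).
  have -> : e / 2 * a ^+ 2 + e^-1 / 2 * c ^+ 2 = a * c + (e * a - c) ^+ 2 / (2 * e).
    by field; rewrite gt_eqF.
  by move=> h; rewrite lerDl divr_ge0 // mulr_ge0 // ltW.
have bR : `|(\int[mu]_(x in A) complex.Re (F x * (G x)^*))%R| <= e / 2 * r + e^-1 / 2 * s.
  apply: (le_trans _ NE); apply: le_trans (le_normr_Rintegral _ iR) _; first exact: mA.
  apply: le_Rintegral => //; first exact: (integrable_abse iR).
  by move=> x _; apply: le_trans (Re_le_normc _) (b x).
have bI : `|(\int[mu]_(x in A) complex.Im (F x * (G x)^*))%R| <= e / 2 * r + e^-1 / 2 * s.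
  apply: (le_trans _ NE); apply: le_trans (le_normr_Rintegral _ iI) _; first exact: mA.
  apply: le_Rintegral => //; first exact: (integrable_abse iI).
  by move=> x _; apply: le_trans (Im_le_normc _) (b x).
apply: le_trans (normc_le_ReIm _) _; rewrite /=.
have p0 := pi2_gt0; rewrite !normrM !normfV (gtr0_norm p0) -mulrDl.
rewrite ler_pdivrMr // (le_trans (lerD bR bI)) // le_eqVlt; apply/orP; left; apply/eqP.
by rewrite divfK ?(gt_eqF p0) //; field; rewrite (gt_eqF e0).
Qed.

End AngleFunctions.

(** * Fourier coefficients *)

Section Fourier.
Variable R : realType.
Notation mu := (@lebesgue_measure R).
Notation A := (angles R).
Implicit Types (F G H : R -> R[i]) (f g : R -> R).

Lemma expiD (x y : R) : expi (x + y) = expi x * expi y.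
Proof. by rewrite /expi cosD sinD; apply/eqP; rewrite eq_complex /= [_ * sin y + _]addrC !eqxx. Qed.

Lemma expi0 : expi (0 : R) = 1. Proof. by rewrite /expi cos0 sin0. Qed.

Lemma expiN (x : R) : expi (- x) = (expi x)^*.
Proof. by rewrite /expi cosN sinN. Qed.

Lemma expi_neq0 (x : R) : expi x != 0.
Proof. by rewrite -normc_eq0 normc_expi oner_eq0. Qed.

Lemma expiV (x : R) : (expi x)^-1 = (expi x)^*.
Proof.
apply: (mulfI (expi_neq0 x)); rewrite divff ?expi_neq0 //.
by rewrite mulc_conj normc_expi expr1n.
Qed.

Definition en (n : int) (x : R) : R[i] := expi x ^ n.

Lemma enE n x : en n x = expi (n%:~R * x).
Proof.
have pos (k : nat) : expi x ^+ k = expi (k%:R * x).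
  elim: k => [|k IH]; first by rewrite mul0r expi0.
  by rewrite exprS IH -expiD -[k.+1]add1n natrD mulrDl mul1r.
case: n => k; first by rewrite /en -exprnP pos.
by rewrite /en NegzE -exprnN pos expiV -expiN rmorphN mulNr.
Qed.

Lemma normc_en n x : normc (en n x) = 1.
Proof. by rewrite enE normc_expi. Qed.

Lemma enD n m x : en (n + m) x = en n x * en m x.
Proof. by rewrite /en expfzDr ?expi_neq0. Qed.

Lemma enN n x : en (- n) x = (en n x)^*.
Proof. by rewrite !enE rmorphN mulNr expiN. Qed.

Lemma continuous_cos_mul (k : R) : continuous (fun x : R => cos (k * x)).
Proof.
move=> x; apply: (@continuous_comp _ _ _ (fun x : R => k * x) (@cos R)).
  by apply: cvgM; [exact: cvg_cst|exact: cvg_id].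
exact: continuous_cos.
Qed.

Lemma continuous_sin_mul (k : R) : continuous (fun x : R => sin (k * x)).
Proof.
move=> x; apply: (@continuous_comp _ _ _ (fun x : R => k * x) (@sin R)).
  by apply: cvgM; [exact: cvg_cst|exact: cvg_id].
exact: continuous_sin.
Qed.

Lemma cme_continuous F : continuous (fun x => complex.Re (F x)) ->
  continuous (fun x => complex.Im (F x)) -> cme F.
Proof. by move=> a b; split; apply: measurable_funTS; apply: continuous_measurable_fun. Qed.

Lemma cme_en n : cme (en n).
Proof.
apply: cme_continuous.
  rewrite (_ : (fun x => _) = (fun x => cos (n%:~R * x))); first exact: continuous_cos_mul.
  by apply/funext => x; rewrite enE.
rewrite (_ : (fun x => _) = (fun x => sin (n%:~R * x))); first exact: continuous_sin_mul.
by apply/funext => x; rewrite enE.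
Qed.

Lemma L2a_en n : L2a (en n).
Proof. by apply: (L2a_bounded (M := 1) (cme_en n)) => x _; rewrite normc_en. Qed.

Lemma sin_period (k : int) : sin (k%:~R * (2 * pi)) = 0 :> R.
Proof.
have : expi (2 * pi : R) = 1.
  by rewrite /expi mulrC mulr_natr cos2pi sin2pi.
move=> h; have := enE k (2 * pi); rewrite /en h exp1rz => /(congr1 (@complex.Im R)) /=.
by [].
Qed.

Lemma cos_period (k : int) : cos (k%:~R * (2 * pi)) = 1 :> R.
Proof.
have : expi (2 * pi : R) = 1.
  by rewrite /expi mulrC mulr_natr cos2pi sin2pi.
move=> h; have := enE k (2 * pi); rewrite /en h exp1rz => /(congr1 (@complex.Re R)) /=.
by [].
Qed.

Lemma integral_derivative (f g : R -> R) : continuous g -> (forall x : R, is_derive x 1 f (g x)) ->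
  (\int[mu]_(x in A) g x)%R = f (2 * pi) - f 0.
Proof.
move=> cg Df.
have cf x : {for x, continuous f}.
  by apply: differentiable_continuous; apply/derivable1_diffP; have [] := Df x.
rewrite /Rintegral (continuous_FTC2 (F := f)).
- by rewrite -EFinB.
- exact: pi2_gt0.
- exact: continuous_subspaceT.
- split.
  + by move=> x _; have [] := Df x.
  + exact/cvg_at_right_filter/cf.
  + exact/cvg_at_left_filter/cf.
- by move=> x _; rewrite derive1E; have [_ ->] := Df x.
Qed.

Lemma ci_en n : ci (en n) = (n == 0)%:R.
Proof.
have p0 := @pi2_gt0 R.
have [->|n0] := eqVneq n 0.
  rewrite (ci_ext (G := fun=> 1)); last by move=> x; rewrite /en expr0z.
  rewrite /ci /= !Rintegral_cst; try exact: mA.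
  have E : fine (mu A) = 2 * pi by rewrite muA.
  by rewrite mul0r mul0r mul1r (_ : fine _ = 2 * pi) // divff ?gt_eqF.
have k0 : n%:~R != 0 :> R by rewrite intr_eq0.
set k : R := n%:~R in k0 *.
have Dk (x : R) : is_derive x 1 (fun s : R => k * s) k.
  by apply: rder_is_derive; have := rderZ k (rder_id x); rewrite mulr1.
have Ds (x : R) : is_derive x 1 (fun x => k^-1 * sin (k * x)) (cos (k * x)).
  apply: rder_is_derive.
  have /is_derive_rder H := @is_derive1_comp _ (@sin R) (fun s => k * s) x _ _ (is_derive_sin _) (Dk x).
  by have := rderZ k^-1 H; rewrite mulrCA mulVf // mulr1.
have Dc (x : R) : is_derive x 1 (fun x => - k^-1 * cos (k * x)) (sin (k * x)).
  apply: rder_is_derive.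
  have /is_derive_rder H := @is_derive1_comp _ (@cos R) (fun s => k * s) x _ _ (is_derive_cos _) (Dk x).
  by have := rderZ (- k^-1) H; rewrite mulNr mulNr mulrN mulrCA mulVf // mulr1 opprK.
have Is := integral_derivative (@continuous_cos_mul k) Ds.
have Ic := integral_derivative (@continuous_sin_mul k) Dc.
rewrite /= sin_period !mulr0 sin0 mulr0 subrr in Is.
rewrite /= cos_period mulr0 cos0 subrr in Ic.
rewrite /ci.
under eq_Rintegral do rewrite enE /=.
under [X in _ +i* (X / _)]eq_Rintegral do rewrite enE /=.
by rewrite Is Ic !mul0r.
Qed.

Definition fc F (n : int) : R[i] := ip F (en n).

Lemma ipDl F G H : L2a F -> L2a G -> L2a H -> ip (fun x => F x + G x) H = ip F H + ip G H.
Proof.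
move=> lF lG lH; rewrite /ip -ciD; try exact: cin_prod.
by apply: ci_ext => x; rewrite mulrDl.
Qed.

Lemma ipZl c F G : L2a F -> L2a G -> ip (fun x => c * F x) G = c * ip F G.
Proof.
move=> lF lG; rewrite /ip -ciZ; last exact: cin_prod.
by apply: ci_ext => x; rewrite mulrA.
Qed.

Lemma ipBl F G H : L2a F -> L2a G -> L2a H -> ip (fun x => F x - G x) H = ip F H - ip G H.
Proof.
move=> lF lG lH; rewrite /ip -ciB; try exact: cin_prod.
by apply: ci_ext => x; rewrite mulrBl.
Qed.

Lemma ipC F G : L2a F -> L2a G -> ip F G = (ip G F)^*.
Proof.
move=> lF lG; rewrite /ip -ci_conj; last exact: cin_prod.
by apply: ci_ext => x; rewrite conjcM conjcK mulrC.
Qed.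

Lemma ipDr F G H : L2a F -> L2a G -> L2a H -> ip H (fun x => F x + G x) = ip H F + ip H G.
Proof.
by move=> lF lG lH; rewrite ipC ?ipDl ?conjcD -?ipC //; exact: L2aD.
Qed.

Lemma ipBr F G H : L2a F -> L2a G -> L2a H -> ip H (fun x => F x - G x) = ip H F - ip H G.
Proof.
move=> lF lG lH; rewrite ipC ?ipBl ?conjcD ?conjcN -?ipC //; exact: L2aB.
Qed.

Lemma L2a0 : L2a (fun=> 0 : R[i]).
Proof. by apply: (L2a_bounded (M := 0) (cme_cst _)) => x _; rewrite normc0. Qed.

Lemma L2a_sum (I : Type) (r : seq I) (F : I -> R -> R[i]) :
  (forall i, L2a (F i)) -> L2a (fun x => \sum_(i <- r) F i x).
Proof.
move=> H; elim: r => [|i r IH].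
  by apply: (L2a_ext L2a0) => x; rewrite big_nil.
by apply: (L2a_ext (L2aD (H i) IH)) => x; rewrite big_cons.
Qed.

Lemma ip_ext F F' G G' : F =1 F' -> G =1 G' -> ip F G = ip F' G'.
Proof. by move=> /funext -> /funext ->. Qed.

Lemma ip0l G : ip (fun=> 0) G = 0.
Proof.
rewrite /ip (ci_ext (G := fun=> 0)); last by move=> x; rewrite mul0r.
by rewrite /ci /= Rintegral_cst ?mul0r //; exact: mA.
Qed.

Lemma ip_suml (I : Type) (r : seq I) (F : I -> R -> R[i]) G :
  (forall i, L2a (F i)) -> L2a G ->
  ip (fun x => \sum_(i <- r) F i x) G = \sum_(i <- r) ip (F i) G.
Proof.
move=> H lG; elim: r => [|i r IH].
  by rewrite big_nil -[RHS](ip0l G); apply: ip_ext => // x; rewrite big_nil.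
rewrite big_cons -IH -ipDl //; last exact: L2a_sum.
by apply: ip_ext => // x; rewrite big_cons.
Qed.

Lemma fc_en n m : fc (en n) m = (n == m)%:R.
Proof.
rewrite /fc /ip (ci_ext (G := en (n - m))); first by rewrite ci_en subr_eq0.
by move=> x; rewrite enD enN.
Qed.

(** ** Trigonometric polynomials *)

Definition trig F : Prop := exists (N : nat) (p : {poly R[i]}), forall x,
  F x = p.[expi x] * en (- N%:Z) x.

Lemma trigE F (N : nat) (p : {poly R[i]}) : (forall x, F x = p.[expi x] * en (- N%:Z) x) ->
  F =1 fun x => \sum_(k < size p) p`_k * en (k%:Z - N%:Z) x.
Proof.
move=> FE x; rewrite FE horner_coef mulr_suml; apply: eq_bigr => k _.
by rewrite enD -mulrA.
Qed.

Lemma L2a_trig F : trig F -> L2a F.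
Proof.
move=> [N [p /trigE /funext ->]]; apply: L2a_sum => k; exact/L2aZ/L2a_en.
Qed.

Lemma trigD F G : trig F -> trig G -> trig (fun x => F x + G x).
Proof.
move=> [N [p FE]] [M [q GE]]; exists (N + M)%N, (p * 'X^M + q * 'X^N) => x.
rewrite FE GE hornerD !hornerM !hornerXn PoszD opprD enD mulrDl.
rewrite -!mulrA; congr (_ * _ + _ * _); rewrite ?[en (- N%:Z) x * en (- M%:Z) x]mulrC !mulrA.
  by rewrite -[expi x ^+ M]/(en M x) -enD subrr /en expr0z mul1r.
by rewrite mulrAC -[expi x ^+ N]/(en N x) -enD subrr /en expr0z mul1r.
Qed.

Lemma trigM F G : trig F -> trig G -> trig (fun x => F x * G x).
Proof.
move=> [N [p FE]] [M [q GE]]; exists (N + M)%N, (p * q) => x.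
by rewrite FE GE hornerM PoszD opprD enD mulrACA.
Qed.

Lemma trig_cst c : trig (fun=> c).
Proof. by exists 0%N, c%:P => x; rewrite hornerC oppr0 /en expr0z mulr1. Qed.

Lemma trigZ c F : trig F -> trig (fun x => c * F x).
Proof. exact: trigM (trig_cst c). Qed.

Lemma trig_ext F G : trig F -> F =1 G -> trig G.
Proof. by move=> tF /funext <-. Qed.

Lemma trigX F n : trig F -> trig (fun x => F x ^+ n).
Proof.
move=> tF; elim: n => [|n IH]; first exact: trig_cst.
by apply: (trig_ext (trigM tF IH)) => x; rewrite exprS.
Qed.

Lemma trig_en n : trig (en n).
Proof.
case: n => k.
  by exists 0%N, 'X^k => x; rewrite hornerXn oppr0 /en expr0z mulr1.
by exists k.+1, 1 => x; rewrite hornerE mul1r -NegzE.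
Qed.

Lemma sqint_fin F : L2a F -> exists2 r : R, 0 <= r & (sqint F <= r%:E)%E.
Proof.
move=> [_ iF]; exists (fine (sqint F)); first by rewrite fine_ge0 // sqint_ge0.
by rewrite fineK // ge0_fin_numE // sqint_ge0.
Qed.

Lemma ip_sqr F : L2a F -> ip F F = (fine (sqint F) / (2 * pi))%:C.
Proof.
move=> lF; rewrite /ip /ci; apply/eqP; rewrite eq_complex /=; apply/andP; split; apply/eqP.
  by under eq_Rintegral do rewrite mulc_conj.
by under eq_Rintegral do rewrite mulc_conj; rewrite Rintegral_cst ?mul0r //; exact: mA.
Qed.

End Fourier.

(** * Density of trigonometric polynomials *)

Section Density.
Variable R : realType.
Notation mu := (@lebesgue_measure R).
Notation A := (angles R).
Implicit Types (F G H : R -> R[i]) (f g : R -> R).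

Definition dens F : Prop := L2a F /\ forall e, 0 < e ->
  exists2 P, trig P & (sqint (fun x => (F x - P x)%R) <= e%:E)%E.

Lemma sqint_distC F G : sqint (fun x => F x - G x) = sqint (fun x => G x - F x).
Proof. by apply: eq_integral => x _; rewrite normc_distC. Qed.

Lemma sqint_triangle F G H (a b : R) : cme F -> cme G -> cme H ->
  (sqint (fun x => (F x - G x)%R) <= a%:E)%E -> (sqint (fun x => (G x - H x)%R) <= b%:E)%E ->
  (sqint (fun x => (F x - H x)%R) <= (2 * a + 2 * b)%:E)%E.
Proof.
move=> cF cG cH FG GH.
have := sqintD (cmeB cF cG) (cmeB cG cH).
rewrite (@sqint_ext _ _ (fun x => F x - H x)); last by move=> x _; rewrite addrA subrK.
move=> h; apply: le_trans h _.
have -> : (2 * a + 2 * b)%:E = (2%:E * a%:E + 2%:E * b%:E)%E by rewrite -!EFinM -EFinD.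
by apply: leeD; apply: lee_wpmul2l; rewrite ?lee_fin.
Qed.

Lemma dens_trig F : trig F -> dens F.
Proof.
move=> tF; split; first exact: L2a_trig.
move=> e e0; exists F => //.
rewrite (@sqint_ext _ _ (fun=> 0)); last by move=> x _; rewrite subrr.
rewrite /sqint; under eq_integral do rewrite normc0 expr0n.
by rewrite integral0 lee_fin ltW.
Qed.

Lemma dens_lim F : L2a F -> (forall e, 0 < e -> exists2 G, dens G &
  (sqint (fun x => (F x - G x)%R) <= e%:E)%E) -> dens F.
Proof.
move=> lF H; split=> // e e0; have e4 : 0 < e / 4 by rewrite divr_gt0.
have [G [lG aG] FG] := H _ e4; have [P tP GP] := aG _ e4.
exists P => //.
have := sqint_triangle lF.1 lG.1 (L2a_trig tP).1 FG GP.
by rewrite (_ : 2 * (e / 4) + 2 * (e / 4) = e) //; field.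
Qed.

Lemma densD F G : dens F -> dens G -> dens (fun x => F x + G x).
Proof.
move=> [lF aF] [lG aG]; split; first exact: L2aD.
move=> e e0; have e4 : 0 < e / 4 by rewrite divr_gt0.
have [P tP FP] := aF _ e4; have [Q tQ GQ] := aG _ e4.
exists (fun x => P x + Q x); first exact: trigD.
have := sqintD (cmeB lF.1 (L2a_trig tP).1) (cmeB lG.1 (L2a_trig tQ).1).
rewrite (@sqint_ext _ _ (fun x => F x + G x - (P x + Q x))); last first.
  by move=> x _; rewrite opprD addrACA.
move=> h; apply: le_trans h _.
have -> : e%:E = (2%:E * (e / 4)%:E + 2%:E * (e / 4)%:E)%E.
  by rewrite -!EFinM -EFinD; congr (_%:E); field.
by apply: leeD; apply: lee_wpmul2l; rewrite ?lee_fin.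
Qed.

Lemma densZ c F : dens F -> dens (fun x => c * F x).
Proof.
move=> [lF aF]; split; first exact: L2aZ.
move=> e e0; have c0 : 0 < normc c ^+ 2 + 1 by rewrite ltr_wpDl ?sqr_ge0.
have [P tP FP] := aF _ (divr_gt0 e0 c0).
exists (fun x => c * P x); first exact: trigZ.
have cFP := cmeB lF.1 (L2a_trig tP).1.
have := @le_sqint _ (fun x => c * F x - c * P x) _ _ (sqr_ge0 (normc c)) _ cFP _.
move=> h; apply: le_trans (h _ _) _.
- by apply: cmeB; apply: cmeZ; [exact: lF.1|exact: (L2a_trig tP).1].
- by move=> x _; rewrite -mulrBr normcM exprMn.
apply: le_trans (lee_wpmul2l _ FP) _; first by rewrite lee_fin sqr_ge0.
rewrite -EFinM lee_fin mulrA ler_pdivrMr // [_ * e]mulrC ler_wpM2l ?(ltW e0) //.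
by rewrite lerDl.
Qed.

Lemma dens_ext F G : dens F -> F =1 G -> dens G.
Proof. by move=> dF /funext <-. Qed.

Lemma dens_sum (I : Type) (r : seq I) (F : I -> R -> R[i]) :
  (forall i, dens (F i)) -> dens (fun x => \sum_(i <- r) F i x).
Proof.
move=> H; elim: r => [|i r IH].
  by apply: (dens_ext (dens_trig (trig_cst 0))) => x; rewrite big_nil.
by apply: (dens_ext (densD (H i) IH)) => x; rewrite big_cons.
Qed.

Lemma dominated_sqint (Fn : nat -> R -> R[i]) F g : (forall n, cme (Fn n)) -> cme F ->
  mu.-integrable A (EFin \o g) ->
  (forall n x, A x -> normc (Fn n x - F x) ^+ 2 <= g x) ->
  {ae mu, forall x, A x -> (fun n => normc (Fn n x - F x) ^+ 2) @ \oo --> 0} ->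
  forall e, 0 < e -> exists n, (sqint (fun x => (F x - Fn n x)%R) <= e%:E)%E.
Proof.
move=> cFn cF ig Hg Hc e e0.
pose f n x := (normc (Fn n x - F x) ^+ 2)%:E.
have mf n : measurable_fun A (f n) by apply: emeasurable_normc2; exact: cmeB.
have cf : {ae mu, forall x, A x -> f ^~ x @ \oo --> (cst 0%E : R -> \bar R) x}.
  move: Hc; apply: filterS; first exact: (ae_filter_ringOfSetsType mu).
  move=> x Hx Ax; apply: (@cvg_comp _ _ _ _ (@EFin R)); first exact: Hx.
  by [].
have bf : {ae mu, forall x n, A x -> (`|f n x| <= (EFin \o g) x)%E}.
  by apply: aeW => x n Ax; rewrite gee0_abs ?lee_fin ?sqr_ge0 // Hg.
have [_ _ ] := @dominated_convergence _ _ R mu A (@mA R) f (cst 0%E) (EFin \o g) mf (measurable_cst _) cf ig bf.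
rewrite integral0.
move=> /fine_cvgP [fin_] /cvgrPdist_le /(_ _ e0) H2.
have [n [n1 n2]] := filter_ex (filterI fin_ H2).
exists n; rewrite sqint_distC -[sqint _]fineK // lee_fin.
by apply: le_trans n2; rewrite /= sub0r normrN ler_norm.
Qed.

Lemma bernoulli_ineq (y : R) m : 0 <= y -> 1 + m%:R * y <= (1 + y) ^+ m.
Proof.
move=> y0; elim: m => [|m IH]; first by rewrite mul0r addr0.
rewrite exprS; have y1 : 0 <= 1 + y by rewrite addr_ge0.
apply: le_trans (ler_wpM2l y1 IH).
have : 0 <= m%:R * y * y by rewrite !mulr_ge0.
by rewrite -addn1 natrD; lra.
Qed.

Lemma bernoulli_ineq2 (y : R) m : 0 <= y -> y <= 1 -> 1 - m%:R * y <= (1 - y) ^+ m.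
Proof.
move=> y0 y1; elim: m => [|m IH]; first by rewrite mul0r subr0.
rewrite exprS; have y2 : 0 <= 1 - y by rewrite subr_ge0.
apply: le_trans (ler_wpM2l y2 IH).
have : 0 <= m%:R * y * y by rewrite !mulr_ge0.
by rewrite -addn1 natrD; lra.
Qed.

(** Polynomials which separate [q < 1/2], where [(2 q)^n] tends to 0, from [q > 1/2],
    where [(2 q)^n] tends to infinity: this is the device of Brosowski and Deutsch. *)
Definition peak n (q : R) : R := (1 - q ^+ n) ^+ (2 ^ n).

Lemma peak_bounds n q : 0 <= q -> q <= 1 -> 0 <= peak n q <= 1.
Proof.
move=> q0 q1; have a : 0 <= q ^+ n <= 1 by rewrite exprn_ge0 // exprn_ile1.
have /andP[a0 a1] := a.
by rewrite /peak exprn_ge0 ?subr_ge0 // exprn_ile1 ?subr_ge0 // lerBlDr lerDl.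
Qed.

Lemma peak_lt q : 0 <= q -> q < 2^-1 -> (fun n => peak n q) @ \oo --> (1 : R).
Proof.
move=> q0 q2; have q1 : q <= 1 by lra.
apply: (squeeze_cvgr (f := fun n => 1 - (2 * q) ^+ n) (h := fun=> 1)).
- near=> n; have /andP[_ ->] := peak_bounds n q0 q1; rewrite andbT.
  have := bernoulli_ineq2 (2 ^ n) (exprn_ge0 n q0) (exprn_ile1 n q0 q1).
  by rewrite natrX -exprMn.
- rewrite -[X in _ --> X]subr0; apply: cvgB; first exact: cvg_cst.
  by apply: cvg_expr; rewrite ger0_norm ?mulr_ge0 //; lra.
exact: cvg_cst.
Unshelve. all: by end_near. Qed.

Lemma peak_gt q : 2^-1 < q -> q <= 1 -> (fun n => peak n q) @ \oo --> (0 : R).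
Proof.
move=> q2 q1; have q0 : 0 <= q by lra.
have q20 : 0 < 2 * q by lra.
apply: (squeeze_cvgr (f := fun=> 0) (h := fun n => (2 * q)^-1 ^+ n)).
- near=> n; have /andP[-> _] := peak_bounds n q0 q1 => /=.
  set y := q ^+ n; have y0 : 0 < y by rewrite exprn_gt0 //; lra.
  have y1 : y <= 1 by exact: exprn_ile1.
  rewrite exprVn -[leRHS]mul1r ler_pdivlMr ?exprn_gt0 //.
  have := bernoulli_ineq (2 ^ n) (ltW y0); rewrite natrX => B.
  have : (1 - y) ^+ (2 ^ n) * (1 + y) ^+ (2 ^ n) <= 1.
    rewrite -exprMn exprn_ile1 //; first by rewrite mulr_ge0 ?subr_ge0 // addr_ge0 // ltW.
    by have := sqr_ge0 y; rewrite expr2; lra.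
  apply: le_trans; rewrite /peak ler_wpM2l ?exprn_ge0 ?subr_ge0 // exprMn.
  by apply: le_trans B; rewrite lerDr.
- exact: cvg_cst.
by apply: cvg_expr; rewrite ger0_norm ?invr_ge0 ?(ltW q20) // invf_lt1 //; lra.
Unshelve. all: by end_near. Qed.

Lemma trig_peak (q : R -> R) n : trig (fun x => (q x)%:C) -> trig (fun x => (peak n (q x))%:C).
Proof.
move=> tq.
apply: (trig_ext (trigX (2 ^ n) (trigD (trig_cst 1) (trigZ (-1) (trigX n tq))))) => x.
by rewrite /peak rmorphXn rmorphB rmorphXn mulN1r.
Qed.

(** A trigonometric polynomial in [x], with values in [0, 1], which for [b] in the
    interval ]0, 2 pi] is below 1/2 on ]0, b[ and above 1/2 on ]b, 2 pi[. *)
Definition arc (b x : R) : R := 2^-1 + 2^-1 * (sin (x / 2) * sin ((x - b) / 2)).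

Lemma trig_cos_shift (c : R) : trig (fun x => (cos (x - c))%:C).
Proof.
have := trigD (trigZ (expi (- c) / 2) (trig_en R 1)) (trigZ (expi c / 2) (trig_en R (-1))).
move=> h; apply: (trig_ext h) => x.
rewrite !enE mulr1z mulrN1z mul1r mulNr mul1r.
have -> : expi (- c) / 2 * expi x = expi (x - c) / 2 by rewrite expiD; ring.
have -> : expi c / 2 * expi (- x) = (expi (x - c))^* / 2.
  by rewrite -expiN opprB expiD; ring.
rewrite -mulrDl /expi; apply: (mulIf (x := 2%:R)); first by rewrite pnatr_eq0.
rewrite divfK ?pnatr_eq0 //.
apply/eqP; rewrite eq_complex /=; apply/andP; split; apply/eqP; ring.
Qed.

Lemma trig_arc b : trig (fun x => (arc b x)%:C).
Proof.
have H := trigD (trig_cst (2^-1 + 2^-1 / 2 * cos (b / 2))%:C)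
  (trigZ (- (2^-1 / 2))%:C (trig_cos_shift (b / 2))).
apply: (trig_ext H) => x; rewrite -rmorphM -rmorphD; congr (_%:C).
have -> : cos (b / 2) = cos (x / 2 - (x - b) / 2) by congr cos; field.
have -> : cos (x - b / 2) = cos (x / 2 + (x - b) / 2) by congr cos; field.
by rewrite cosB cosD /arc; field.
Qed.

Lemma arc_bounds b x : 0 <= arc b x <= 1.
Proof.
have bnd (y : R) : -1 <= sin y <= 1 by rewrite sin_geN1 sin_le1.
have : -1 <= sin (x / 2) * sin ((x - b) / 2) <= 1.
  rewrite -ler_norml normrM; apply: mulr_ile1 => //; by rewrite ler_norml bnd.
by rewrite /arc => /andP[h1 h2]; apply/andP; split; lra.
Qed.

Definition ind (B : set R) (x : R) : R[i] := (\1_B x)%:C.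

Lemma cme_ind (B : set R) : measurable B -> cme (ind B).
Proof. by move=> mB; apply: cme_real; apply: measurable_indic. Qed.

Lemma ind01 (B : set R) x : normc (ind B x) <= 1.
Proof. by rewrite /ind normc_real indicE; case: (_ \in _) => /=; rewrite ?normr0 ?normr1. Qed.

Lemma L2a_ind (B : set R) : measurable B -> L2a (ind B).
Proof. by move=> mB; apply: (L2a_bounded (M := 1) (cme_ind mB)) => x _; exact: ind01. Qed.

Lemma integrable_cst (c : R) : mu.-integrable A (EFin \o (fun=> c)).
Proof.
apply/integrableP; split; first exact: measurable_cst.
rewrite /= integral_cst //; last exact: mA.
by rewrite lte_mul_pinfty // (_ : _ A = (2 * pi)%:E) ?ltry //; exact: muA.
Qed.

(** The indicator is the bounded limit, almost everywhere, of the trigonometric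
    polynomials [peak n (arc b x)]. *)
Lemma dens_ray (b : R) : dens (ind `]-oo, b[%classic).
Proof.
have mB : measurable (`]-oo, b[%classic : set R) by exact: measurable_itv.
apply: dens_lim (L2a_ind mB) _ => e e0.
have [b0|b0] := leP b 0.
  exists (fun=> 0); first exact/dens_trig/trig_cst.
  rewrite (@sqint_ext _ _ (fun=> 0)); last first.
    move=> x; rewrite /angles /= in_itv /= => /andP[x0 _].
    rewrite subr0 /ind indicE memNset //= in_itv /=.
    by apply/negP; rewrite -leNgt (le_trans b0).
  rewrite /sqint; under eq_integral do rewrite normc0 expr0n.
  by rewrite integral0 lee_fin ltW.
have [b2|b2] := ltP (2 * pi) b.
  exists (fun=> 1); first exact/dens_trig/trig_cst.
  rewrite (@sqint_ext _ _ (fun=> 0)); last first.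
    move=> x; rewrite /angles /= in_itv /= => /andP[_ x0].
    by rewrite /ind indicE mem_set //= ?subrr // in_itv /= (le_lt_trans x0).
  rewrite /sqint; under eq_integral do rewrite normc0 expr0n.
  by rewrite integral0 lee_fin ltW.
suff [n Hn] : exists n, (sqint (fun x => (ind `]-oo, b[%classic x - (peak n (arc b x))%:C)%R) <= e%:E)%E.
  by exists (fun x => (peak n (arc b x))%:C) => //; apply/dens_trig/trig_peak/trig_arc.
apply: (dominated_sqint (g := fun=> 1)) => //.
- by move=> n; apply: (L2a_trig (trig_peak n (trig_arc b))).1.
- exact: cme_ind.
- exact: integrable_cst.
- move=> n x _; have /andP[q0 q1] := arc_bounds b x; have /andP[h0 h1] := peak_bounds n q0 q1.
  rewrite /ind -rmorphB normc_real real_normK ?num_real // indicE.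
  rewrite -[leRHS](expr1n _ 2) -ler_sqrt ?sqr_ge0 // !sqrtr_sqr normr1 ler_norml.
  by case: (_ \in _) => /=; apply/andP; split; lra.
exists [set 0; b; 2 * pi]; split.
- by apply: measurableU; [apply: measurableU|]; exact: measurable_set1.
- by apply: countable_lebesgue_measure0; apply: finite_set_countable; rewrite !finite_setU; do !split.
move=> x /= Hx; apply: contrapT => N; apply: Hx => Ax.
have x0 : x <> 0 by move=> E; apply: N; left; left.
have xb : x <> b by move=> E; apply: N; left; right.
have x2 : x <> 2 * pi by move=> E; apply: N; right.
move: Ax; rewrite /angles /= in_itv /= => /andP[p0 p2].
have {}p0 : 0 < x by rewrite lt_neqAle p0 andbT eq_sym; apply/eqP.
have {}p2 : x < 2 * pi by rewrite lt_neqAle p2 andbT; apply/eqP.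
have /andP[q0 q1] := arc_bounds b x.
have sx : 0 < sin (x / 2).
  by apply: sin_gt0_pi; rewrite divr_gt0 //= ltr_pdivrMr // mulrC.
suff c : (fun n => peak n (arc b x)) @ \oo --> (\1_(`]-oo, b[%classic) x : R).
  pose v n := peak n (arc b x) - \1_(`]-oo, b[%classic) x.
  have c' : v @ \oo --> (0 : R).
    rewrite -(subrr (\1_(`]-oo, b[%classic) x : R)); apply: cvgB; first exact: c.
    exact: cvg_cst.
  rewrite (_ : (fun n => _) = (fun n => v n * v n)); last first.
    by apply/funext => n; rewrite /ind -rmorphB normc_real real_normK ?num_real.
  by rewrite -[X in _ --> X](mulr0 0); apply: cvgM.
have [xb'|bx] := ltP x b.
  rewrite indicE mem_set /= ?in_itv //=; apply: peak_lt => //.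
  have : sin ((x - b) / 2) < 0.
    have : 0 < sin ((b - x) / 2).
      apply: sin_gt0_pi; rewrite divr_gt0 ?subr_gt0 //= ltr_pdivrMr // mulrC.
      by apply: lt_le_trans b2; rewrite ltrBlDr ltrDl.
    by rewrite -[(x - b) / 2]opprK sinN oppr_lt0 -mulNr opprB.
  by move=> h; rewrite /arc gtrDl pmulr_rlt0 ?invr_gt0 // pmulr_rlt0.
rewrite indicE memNset /= ?in_itv /=; last by apply/negP; rewrite -leNgt.
have {}bx : b < x by rewrite lt_neqAle bx andbT eq_sym; apply/eqP.
apply: peak_gt => //.
have h : 0 < sin ((x - b) / 2).
  apply: sin_gt0_pi; rewrite divr_gt0 ?subr_gt0 //= ltr_pdivrMr // mulrC.
  by apply: lt_trans p2; rewrite ltrBlDr ltrDl.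
by rewrite /arc ltrDl !mulr_gt0 ?invr_gt0.
Qed.

End Density.

Section DensityAll.
Variable R : realType.
Notation mu := (@lebesgue_measure R).
Notation A := (angles R).
Implicit Types (F G H : R -> R[i]) (f g : R -> R).

Lemma dens_cst (c : R[i]) : dens (fun _ : R => c).
Proof. exact/dens_trig/trig_cst. Qed.

Lemma dens_bigcup (F : nat -> set R) : (forall n, measurable (F n)) -> trivIset setT F ->
  (forall n, dens (ind (F n))) -> dens (ind (\bigcup_n F n)).
Proof.
move=> mF tF dF; have mU : measurable (\bigcup_n F n) by exact: bigcupT_measurable.
apply: dens_lim (L2a_ind mU) _ => e e0.
pose Fn n x := \sum_(k < n) ind (F k) x.
have dFn n : dens (Fn n) by apply: dens_sum => k; exact: dF.
suff [n Hn] : exists n, (sqint (fun x => (ind (\bigcup_n F n) x - Fn n x)%R) <= e%:E)%E.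
  by exists (Fn n).
have E n x : (exists2 m, Fn n x = (m < n)%N%:R & ind (\bigcup_n F n) x = 1) \/
    (Fn n x = 0 /\ ind (\bigcup_n F n) x = 0).
  have [[m _ Fm]|xN] := pselect ((\bigcup_n F n) x); [left|right].
    exists m; last by rewrite /ind indicE mem_set //; exists m.
    have i k : ind (F k) x = (k == m)%:R.
      rewrite /ind indicE; have [->|/eqP km] := eqVneq k m; first by rewrite mem_set.
      rewrite memNset // => Fk; apply: km; apply: tF => //.
      by exists x.
    rewrite /Fn (eq_bigr (fun k : 'I_n => (k == m :> nat)%:R)) //.
    have [mn|nm] := ltnP m n.
      by rewrite (bigD1 (Ordinal mn)) //= eqxx big1 ?addr0 // => k /negPf; rewrite -val_eqE /= => ->.
    by rewrite big1 // => k _; rewrite ltn_eqF // (leq_trans (ltn_ord k)).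
  split; last by rewrite /ind indicE memNset.
  by rewrite /Fn big1 // => k _; rewrite /ind indicE memNset // => Fk; apply: xN; exists k.
apply: (dominated_sqint (g := fun=> 1)) => //.
- by move=> n; have [[]] := dFn n.
- exact: cme_ind.
- exact: integrable_cst.
- move=> n x _; have [[m -> ->]|[-> ->]] := E n x.
    by case: (m < n)%N; rewrite ?subrr ?sub0r ?normcN ?normc0 ?normc1 ?expr0n ?expr1n.
  by rewrite subrr normc0 expr0n.
apply: aeW => x _.
have [[m _ Fm]|xN] := pselect ((\bigcup_n F n) x); last first.
  rewrite (_ : (fun n => _) = (fun=> 0)); first exact: cvg_cst.
  apply/funext => n; have [[k _]|[-> ->]] := E n x; last by rewrite subrr normc0 expr0n.
  rewrite /ind indicE memNset // => /eqP; rewrite eq_sym.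
  by rewrite (oner_eq0 R[i]).
have e1 : ind (\bigcup_n F n) x = 1 by rewrite /ind indicE mem_set //; exists m.
apply: cvg_near_cst.
exists m.+1 => // n /= mn.
have i k : ind (F k) x = (k == m)%:R.
  rewrite /ind indicE; have [->|/eqP km] := eqVneq k m; first by rewrite mem_set.
  rewrite memNset // => Fk; apply: km; apply: tF => //.
  by exists x.
rewrite e1 /Fn (eq_bigr (fun k : 'I_n => (k == m :> nat)%:R)) //.
rewrite (bigD1 (Ordinal mn)) //= eqxx big1 ?addr0 => [|k /negPf]; first by rewrite subrr normc0 expr0n.
by rewrite -val_eqE /= => ->.
Qed.

(** The sets with approximable indicator form a Dynkin system containing the rays. *)
Lemma dens_ind (B : set R) : measurable B -> dens (ind B).
Proof.
move=> mB.
pose G := [set B : set R | exists x, B = `]-oo, x[%classic].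
apply: (@dynkin_induction _ (measurableTypeR R) G (fun B => dens (ind B))).
- exact: RGenInftyO.measurableE.
- move=> _ _ [x ->] [y ->]; exists (Num.min x y); apply/seteqP; split => z /=; rewrite !in_itv /= lt_min.
    by move=> [-> ->].
  by move/andP.
- by apply: (dens_ext (dens_cst 1)) => x; rewrite /ind indicE mem_set.
- by move=> _ [x ->]; exact: dens_ray.
- move=> S mS dS; apply: (dens_ext (densD (dens_cst 1) (densZ (-1) dS))) => x.
  rewrite /ind !indicE in_setC mulN1r; case: (x \in S) => /=; first by rewrite subrr.
  by rewrite subr0.
- by move=> F mF tF dF; exact: dens_bigcup.
have mB' : (@ocitv R).-sigma.-measurable B := mB.
by rewrite (RGenInftyO.measurableE R) in mB'.
Qed.

Import HBNNSimple.

Lemma dens_nnsfun (g : {nnsfun R >-> R}) : dens (fun x => (g x)%:C).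
Proof.
rewrite (_ : (fun x => _) = (fun x : R => \sum_(y <- finmap.enum_fset (fset_set (range g))) y%:C * ind (g @^-1` [set y]) x)).
  apply: dens_sum => y; apply/densZ/dens_ind.
  by have := @measurable_funPT _ _ _ _ g measurableT _ (measurable_set1 y); rewrite setTI.
apply/funext => x; rewrite [in LHS](fimfunE g) fsbig_finite //= rmorph_sum.
by apply: eq_bigr => y _; rewrite rmorphM.
Qed.

Lemma dens_nonneg f : measurable_fun A f -> (forall x, 0 <= f x) ->
  L2a (fun x => (f x)%:C) -> dens (fun x => (f x)%:C).
Proof.
move=> mf f0 lf; apply: dens_lim => // e e0.
have mEf : measurable_fun A (EFin \o f) by exact/measurable_EFinP.
pose g := nnsfun_approx (@mA R) mEf.
have E0 x : A x -> (0 <= (EFin \o f) x)%E by rewrite lee_fin f0.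
have cg x : A x -> (fun n => g n x) @ \oo --> f x.
  move=> Ax; have /fine_cvgP [_] := cvg_nnsfun_approx (@mA R) mEf E0 Ax.
  by [].
have gf n x : A x -> g n x <= f x.
  move=> Ax; have nd := nd_nnsfun_approx (@mA R) mEf.
  rewrite -(cvg_lim _ (cg x Ax)) //; apply: nondecreasing_cvgn_le.
    by move=> a b /nd /lefP /(_ x).
  by apply/cvg_ex; exists (f x); exact: cg.
suff [n Hn] : exists n, (sqint (fun x => ((f x)%:C - (g n x)%:C)%R) <= e%:E)%E.
  by exists (fun x => (g n x)%:C) => //; exact: (dens_nnsfun (g n)).
apply: (dominated_sqint (g := fun x => normc (f x)%:C ^+ 2)) => //.
- by move=> n; have [[]] := dens_nnsfun (g n).
- apply/integrableP; split; first exact: (emeasurable_normc2 lf.1).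
  under eq_integral do rewrite gee0_abs ?lee_fin ?sqr_ge0 //.
  exact: lf.2.
- move=> n x Ax; rewrite -rmorphB !normc_real !real_normK ?num_real //.
  have := gf n x Ax; have : 0 <= g n x by [].
  move: (g n x) (f x) => a b a0 ab; rewrite -ler_sqrt ?sqr_ge0 // !sqrtr_sqr.
  by rewrite (ger0_norm (le_trans a0 ab)) ler_norml; apply/andP; split; lra.
apply: aeW => x Ax.
have c' : (fun n => g n x - f x) @ \oo --> (0 : R).
  by rewrite -(subrr (f x)); apply: cvgB; [exact: cg|exact: cvg_cst].
rewrite (_ : (fun n => _) = (fun n => (g n x - f x) * (g n x - f x))); last first.
  by apply/funext => n; rewrite -rmorphB normc_real real_normK ?num_real.
by rewrite -[X in _ --> X](mulr0 0); apply: cvgM.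
Qed.

Lemma dens_real f : measurable_fun A f -> L2a (fun x => (f x)%:C) -> dens (fun x => (f x)%:C).
Proof.
move=> mf lf.
have part (h : R -> R) : measurable_fun A h -> (forall x, 0 <= h x) ->
    (forall x, h x <= `|f x|) -> dens (fun x => (h x)%:C).
  move=> mh h0 hf; apply: dens_nonneg => //; split; first exact: cme_real.
  apply: le_lt_trans (@le_sqint _ _ _ 1 ler01 (cme_real mh) lf.1 _) _; last first.
    by rewrite mul1e; exact: lf.2.
  move=> x _; rewrite mul1r !normc_real -ler_sqrt ?sqr_ge0 // !sqrtr_sqr !normr_id.
  by rewrite ger0_norm.
have d1 := part (fun x => Num.max (f x) 0) _ _ _.
have d2 := part (fun x => Num.max (- f x) 0) _ _ _.
apply: (dens_ext (densD (d1 _ _ _) (densZ (-1) (d2 _ _ _)))).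
- by apply: measurable_maxr => //; exact: measurable_cst.
- by move=> x; rewrite le_max lexx orbT.
- by move=> x; rewrite ge_max ler_norm normr_ge0.
- by apply: measurable_maxr; [exact: measurable_funN|exact: measurable_cst].
- by move=> x; rewrite le_max lexx orbT.
- by move=> x; rewrite ge_max normr_ge0 andbT -normrN ler_norm.
move=> x; rewrite mulN1r -rmorphB; congr (_%:C).
by case: (leP (f x) 0) => h; [rewrite max_l|rewrite max_r]; rewrite ?oppr_ge0 ?oppr_le0 ?(ltW h) //; lra.
Qed.

Lemma dens_L2a F : L2a F -> dens F.
Proof.
move=> lF; have [[mR mI] iF] := lF.
have half f : measurable_fun A f -> (forall x, `|f x| <= normc (F x)) -> dens (fun x => (f x)%:C).
  move=> mf fF; apply: dens_real => //; split; first exact: cme_real.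
  apply: le_lt_trans (@le_sqint _ _ _ 1 ler01 (cme_real mf) lF.1 _) _; last by rewrite mul1e.
  by move=> x _; rewrite mul1r normc_real ler_pXn2r ?nnegrE ?normc_ge0.
have dR := half _ mR (fun x => Re_le_normc (F x)).
have dI := half _ mI (fun x => Im_le_normc (F x)).
apply: (dens_ext (densD dR (densZ (Complex 0 1) dI))) => x.
by rewrite [RHS]complexE.
Qed.

(** ** Consequences: orthogonality and uniqueness in terms of Fourier coefficients *)

Lemma fcZ c F n : L2a F -> fc (fun x => c * F x) n = c * fc F n.
Proof. by move=> lF; apply: ipZl => //; exact: L2a_en. Qed.

Lemma fcD F G n : L2a F -> L2a G -> fc (fun x => F x + G x) n = fc F n + fc G n.
Proof. by move=> lF lG; apply: ipDl => //; exact: L2a_en. Qed.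

Lemma fcB F G n : L2a F -> L2a G -> fc (fun x => F x - G x) n = fc F n - fc G n.
Proof. by move=> lF lG; apply: ipBl => //; exact: L2a_en. Qed.

(** [G] is approximated by its projection [S] on finitely many frequencies, at least
    as well as by any trigonometric polynomial, and [F] is orthogonal to [S]. *)
Lemma ip_fc0 F G : L2a F -> L2a G -> (forall n, fc F n * fc G n = 0) -> ip F G = 0.
Proof.
move=> lF lG FG; apply: normc_small => e e0.
have [r r0 Fr] := sqint_fin lF.
have p0 := @pi2_gt0 R.
pose e1 := e * pi / (r + 1).
have e10 : 0 < e1 by rewrite divr_gt0 ?mulr_gt0 ?pi_gt0 // ltr_wpDl.
have [_ /(_ (e * pi * e1))] := dens_L2a lG.
have e2 : 0 < e * pi * e1 by apply: mulr_gt0 => //; apply: mulr_gt0 => //; exact: pi_gt0.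
move=> /(_ e2) [P [N [p PE]] GP].
have {PE}PE := trigE PE; pose m (k : nat) : int := k%:Z - N%:Z.
pose S x := \sum_(k < size p) fc G (m k) * en (m k) x.
have lS : L2a S by apply: L2a_sum => k; apply/L2aZ/L2a_en.
have lP : L2a P.
  by apply: (L2a_ext (F := fun x => \sum_(k < size p) p`_k * en (m k) x)) => // ;
    apply: L2a_sum => k; apply/L2aZ/L2a_en.
have fS (j : 'I_(size p)) : fc S (m j) = fc G (m j).
  rewrite /fc /S ip_suml => [|k|]; [|exact/L2aZ/L2a_en|exact: L2a_en].
  rewrite (bigD1 j) //= ipZl; try exact: L2a_en.
  rewrite -[ip (en _) _]/(fc _ _) fc_en eqxx mulr1 big1 ?addr0 // => k kj.
  rewrite ipZl; try exact: L2a_en.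
  rewrite -[ip (en _) _]/(fc _ _) fc_en /m.
  have -> : (k%:Z - N%:Z == j%:Z - N%:Z) = false.
    by rewrite (inj_eq (addIr _)) eqz_nat; exact: (negPf kj).
  by rewrite mulr0.
have lGS : L2a (fun x => G x - S x) by exact: L2aB.
have lSP : L2a (fun x => S x - P x) by exact: L2aB.
have orth (c : 'I_(size p) -> R[i]) :
    ip (fun x => \sum_(k < size p) c k * en (m k) x) (fun x => G x - S x) = 0.
  rewrite ip_suml => [|k|//]; last exact/L2aZ/L2a_en.
  rewrite big1 // => k _; rewrite ipZl //; last exact: L2a_en.
  rewrite ipC //; last exact: L2a_en.
  rewrite ipBl //; last exact: L2a_en.
  by rewrite -[ip G _]/(fc G _) -[ip S _]/(fc S _) fS subrr conjc0 mulr0.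
have SPE : (fun x => S x - P x) =1 fun x => \sum_(k < size p) (fc G (m k) - p`_k) * en (m k) x.
  by move=> x; rewrite PE /S -sumrB; apply: eq_bigr => k _; rewrite mulrBl.
have pyth : (sqint (fun x => (G x - S x)%R) <= sqint (fun x => (G x - P x)%R))%E.
  have lGP : L2a (fun x => G x - P x) by exact: L2aB.
  have fin H : L2a H -> sqint H \is a fin_num.
    by move=> [_ h]; rewrite ge0_fin_numE // sqint_ge0.
  have E : ip (fun x => G x - P x) (fun x => G x - P x) =
      ip (fun x => G x - S x) (fun x => G x - S x) + ip (fun x => S x - P x) (fun x => S x - P x).
    have D : (fun x => G x - P x) =1 (fun x => (G x - S x) + (S x - P x)).
      by move=> x; rewrite addrA subrK.
    rewrite (ip_ext D D) ipDl //; last exact: L2aD.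
    rewrite (ipDr lGS lSP lGS) (ipDr lGS lSP lSP).
    have z : ip (fun x => S x - P x) (fun x => G x - S x) = 0.
      by rewrite (ip_ext SPE (fun=> erefl)) orth.
    by rewrite (ipC lGS lSP) z conjc0 addr0 add0r.
  move: E; rewrite !ip_sqr // => /(congr1 (@complex.Re R)) /= E.
  rewrite -(fineK (fin _ lGS)) -(fineK (fin _ lGP)) lee_fin.
  rewrite -(@ler_pM2r _ (2 * pi)^-1) ?invr_gt0 // E lerDl divr_ge0 ?(ltW p0) //.
  by rewrite fine_ge0 // sqint_ge0.
have -> : ip F G = ip F (fun x => G x - S x).
  rewrite ipBr // (_ : ip F S = 0) ?subr0 //.
  rewrite ipC // /S ip_suml => [|k|//]; last exact/L2aZ/L2a_en.
  rewrite big1 ?conjc0 // => k _; rewrite ipZl //; last exact: L2a_en.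
  rewrite (ipC (L2a_en R (m k)) lF) -[ip F _]/(fc F (m k)).
  have /eqP := FG (m k); rewrite mulf_eq0 => /orP[/eqP -> | /eqP ->].
    by rewrite conjc0 mulr0.
  by rewrite mul0r.
apply: le_trans (ip_small e10 lF lGS Fr (le_trans pyth GP)) _.
rewrite ler_pdivrMr // mulfK ?gt_eqF //.
have : e1 * r <= e * pi.
  rewrite /e1 mulrAC ler_pdivrMr ?ltr_wpDl // ler_wpM2l ?mulr_ge0 ?(ltW e0) ?(ltW (pi_gt0 R)) //.
  by rewrite lerDl.
by move=> h; lra.
Qed.

Lemma fc_eq0 F : L2a F -> (forall n, fc F n = 0) -> {ae mu, forall x, A x -> F x = 0}.
Proof.
move=> lF F0; have FF n : fc F n * fc F n = 0 by rewrite F0 mul0r.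
have := ip_fc0 lF lF FF; rewrite ip_sqr // => /(congr1 (@complex.Re R)) /= /eqP.
have p0 := @pi2_gt0 R.
rewrite mulf_eq0 invr_eq0 (gt_eqF p0) orbF => /eqP s0.
have {}s0 : sqint F = 0%E.
  by rewrite -[sqint F]fineK ?s0 // ge0_fin_numE ?sqint_ge0 //; exact: lF.2.
have mN := emeasurable_normc2 lF.1.
have : (\int[mu]_(x in A) `|(normc (F x) ^+ 2)%:E| = 0)%E.
  by rewrite -s0; apply: eq_integral => x _; rewrite gee0_abs ?lee_fin ?sqr_ge0.
move=> /(ae_eq_integral_abs mu (@mA R) mN) h.
have {h} : {ae mu, forall x, A x -> (normc (F x) ^+ 2)%:E = 0%E} by exact: h.
apply: filterS; first exact: (ae_filter_ringOfSetsType mu).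
move=> x H Ax; have /= := H Ax; move=> [] /eqP.
by rewrite sqrf_eq0 normc_eq0 => /eqP.
Qed.

End DensityAll.

(** * From functions on the circle to sequences of coefficients *)

Section Realization.
Variable R : realType.
Notation mu := (@lebesgue_measure R).
Notation A := (angles R).
Implicit Types (F G H : R -> R[i]) (x y : nat -> R[i]) (f g h u : R[i] -> R[i]).

Definition rz x : R[i] -> R[i] := fun z => csum (fun k => x k * z ^+ k).

Lemma l1_powers x (z : R[i]) : l1 x -> normc z <= 1 -> l1 (fun k => x k * z ^+ k).
Proof.
move=> [B xB] z1; exists (B * 1); apply: bd_mul => // k.
elim: k => [|k IH]; first by rewrite expr0 normc1.
by rewrite exprS normcM mulr_ile1 ?normc_ge0.
Qed.

Lemma rzM x y (z : R[i]) : l1 x -> l1 y -> normc z <= 1 -> rz x z * rz y z = rz (convol x y) z.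
Proof.
move=> lx ly z1; have [B xB] := l1_powers lx z1; have [C yC] := l1_powers ly z1.
pose g i j := (x i * z ^+ i) * (y j * z ^+ j).
have gB N : \sum_(i < N) \sum_(j < N) normc (g i j) <= B * C.
  under eq_bigr => i _ do (under eq_bigr do rewrite normcM; rewrite -mulr_sumr).
  rewrite -mulr_suml ler_pM ?sumr_ge0 // => i _; exact: normc_ge0.
rewrite [rz (convol _ _) z](_ : _ = csum (fun p => \sum_(i < p.+1) g i (p - i)%N)); last first.
  apply: csum_ext => p; rewrite /convol mulr_suml; apply: eq_bigr => i _.
  have ip : (i <= p)%N by rewrite -ltnS.
  have -> : z ^+ p = z ^+ i * z ^+ (p - i) by rewrite -exprD subnKC.
  by rewrite /g; ring.
rewrite -(csum_triangle gB) mulrC -csumZ; last by exists B.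
apply: csum_ext => i; rewrite mulrC -csumZ //; last by exists C.
Qed.

Lemma en_nat (k : nat) (t : R) : expi t ^+ k = en k t. Proof. by []. Qed.

Lemma rz_tail x : l1 x -> forall e, 0 < e -> exists N0, forall N, (N0 <= N)%N -> forall t : R,
  normc (rz x (expi t) - \sum_(k < N) x k * en k t) <= e.
Proof.
move=> lx e e0; have [N0 H] := l1_tail lx e0; exists N0 => N NN t.
have z1 : normc (expi t) <= 1 by rewrite normc_expi.
have lp := l1_powers lx z1.
apply/ler_addgt0Pl => d dd; have [M HM] := csumP lp dd.
have {HM} HM := HM (maxn M N) (leq_maxl _ _).
set P := maxn M N in HM; have NP : (N <= P)%N by rewrite leq_maxr.
rewrite -[rz x _](subrK (\sum_(k < P) x k * expi t ^+ k)) -addrA.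
apply: le_trans (normcD _ _) _; apply: lerD; first by rewrite normc_distC.
apply: le_trans (H N P NN NP).
rewrite -!(big_mkord xpredT (fun k => x k * expi t ^+ k)).
rewrite (@big_cat_nat _ _ _ N 0 P) //= addrAC subrr add0r.
apply: le_trans (normc_sum _ _ _) _; apply: ler_sum => k _.
by rewrite normcM en_nat normc_en mulr1.
Qed.

Lemma rz_bound x B (t : R) : bd x B -> normc (rz x (expi t)) <= B.
Proof.
move=> xB; apply: normc_csum => N.
by under eq_bigr do rewrite normcM en_nat normc_en mulr1; exact: xB.
Qed.

Lemma cme_rz x : l1 x -> cme (fun t => rz x (expi t)).
Proof.
move=> lx.
have cS N : cme (fun t => \sum_(k < N) x k * en k t).
  have : L2a (fun t => \sum_(k < N) x k * en k t).
    by apply: L2a_sum => k; apply/L2aZ/L2a_en.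
  by case.
have cv (P : R[i] -> R) : (forall z w, P (z - w) = P z - P w) -> (forall z, `|P z| <= normc z) ->
   forall t, A t -> (fun N => P (\sum_(k < N) x k * en k t)) @ \oo --> P (rz x (expi t)).
  move=> PB Pn t _; apply/cvgrPdist_le => e e0; have [N0 H] := rz_tail lx e0.
  exists N0 => // N /= NN; rewrite -PB; exact: le_trans (Pn _) (H N NN t).
split.
  apply: (@measurable_fun_cvg _ _ _ A (fun N t => complex.Re (\sum_(k < N) x k * en k t))).
    by move=> N; have [] := cS N.
  apply: (cv (@complex.Re R)); [exact: ReB|exact: Re_le_normc].
apply: (@measurable_fun_cvg _ _ _ A (fun N t => complex.Im (\sum_(k < N) x k * en k t))).
  by move=> N; have [] := cS N.
apply: (cv (@complex.Im R)); [exact: ImB|exact: Im_le_normc].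
Qed.

Lemma L2a_rz x : l1 x -> L2a (fun t => rz x (expi t)).
Proof.
by move=> lx; have [B xB] := lx; apply: (L2a_bounded (M := B) (cme_rz lx)) => t _; exact: rz_bound.
Qed.

Lemma L2a_rzM x G : l1 x -> L2a G -> L2a (fun t => rz x (expi t) * G t).
Proof.
move=> lx lG; have [B xB] := lx.
by apply: (L2aM (M := B) lG (cme_rz lx)) => t _; exact: rz_bound.
Qed.

Lemma L2a_enM n G : L2a G -> L2a (fun t => en n t * G t).
Proof. by move=> lG; apply: (L2aM (M := 1) lG (cme_en R n)) => t _; rewrite normc_en. Qed.

(** The partial sums of [rz x] converge uniformly on the circle, so that integration
    against square integrable functions is term by term. *)
Lemma ip_series x G H : l1 x -> L2a G -> L2a H ->
  l1 (fun k => x k * ip (fun t => en k t * G t) H) /\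
  ip (fun t => rz x (expi t) * G t) H = csum (fun k => x k * ip (fun t => en k t * G t) H).
Proof.
move=> lx lG lH; have [B xB] := lx.
have [r r0 Gr] := sqint_fin lG; have [s s0 Hs] := sqint_fin lH.
have p0 := @pi2_gt0 R.
have sq F e : 0 <= e -> L2a (fun t => F t * G t) -> (forall t, normc (F t) <= e) ->
    (sqint (fun t => (F t * G t)%R) <= (e ^+ 2 * r)%:E)%E.
  move=> e0 [cFG _] Fe; apply: le_trans (@le_sqint _ _ _ _ (sqr_ge0 e) cFG lG.1 _) _.
    move=> t _; rewrite normcM exprMn ler_wpM2r ?sqr_ge0 //.
    by rewrite ler_pXn2r ?nnegrE ?normc_ge0.
  have -> : (e ^+ 2 * r)%:E = ((e ^+ 2)%:E * r%:E)%E by [].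
  by apply: lee_wpmul2l => //; rewrite lee_fin sqr_ge0.
have small F e : 0 < e -> L2a (fun t => F t * G t) -> (forall t, normc (F t) <= e) ->
    normc (ip (fun t => F t * G t) H) <= e * ((r + s) / (2 * pi)).
  move=> e0 lFG Fe; have ei : 0 < e^-1 by rewrite invr_gt0.
  apply: le_trans (ip_small ei lFG lH (sq _ _ (ltW e0) lFG Fe) Hs) _.
  rewrite le_eqVlt; apply/orP; left; apply/eqP.
  by move: (2 * pi) p0 => q p0; field; rewrite (gt_eqF e0) (gt_eqF p0).
have lterm : l1 (fun k => x k * ip (fun t => en k t * G t) H).
  exists (B * (1 * ((r + s) / (2 * pi)))); apply: bd_mul => // k.
  by apply: small => //; [exact: L2a_enM|move=> t; rewrite normc_en].
split=> //; symmetry; apply: csum_eq => // e e0.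
set C := (r + s) / (2 * pi) in small.
have C0 : 0 <= C by rewrite divr_ge0 ?addr_ge0 // ltW.
have C1 : 0 < C + 1 by rewrite ltr_wpDl.
have [N0 HN] := rz_tail lx (divr_gt0 e0 C1); exists N0 => N /HN HN'.
pose S t := \sum_(k < N) x k * en k t.
have lSG : L2a (fun t => S t * G t).
  apply: (L2a_ext (F := fun t => \sum_(k < N) x k * (en k t * G t))).
    by apply: L2a_sum => k; apply/L2aZ/L2a_enM.
  by move=> t; rewrite /S mulr_suml; apply: eq_bigr => k _; rewrite mulrA.
have -> : \sum_(k < N) x k * ip (fun t => en k t * G t) H = ip (fun t => S t * G t) H.
  rewrite (ip_ext (F' := fun t => \sum_(k < N) x k * (en k t * G t)) (G' := H)) //; last first.
    by move=> t; rewrite /S mulr_suml; apply: eq_bigr => k _; rewrite mulrA.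
  rewrite ip_suml // => [|k]; last exact/L2aZ/L2a_enM.
  by apply: eq_bigr => k _; rewrite ipZl //; exact: L2a_enM.
have lxG := L2a_rzM lx lG.
rewrite normc_distC -ipBl //.
rewrite (ip_ext (F' := fun t => (rz x (expi t) - S t) * G t) (G' := H)) //; last first.
  by move=> t; rewrite mulrBl.
apply: le_trans (small _ _ (divr_gt0 e0 C1) _ HN') _.
  by apply: (L2a_ext (L2aB lxG lSG)) => t; rewrite mulrBl.
by rewrite mulrAC ler_pdivrMr // ler_wpM2l ?(ltW e0) // lerDl.
Qed.

(** ** Functions with summable coefficients *)

Lemma csum_single x n : (forall k, k != n -> x k = 0) -> csum x = x n.
Proof.
move=> H; rewrite (csum_finite (N := n.+1)) => [|k nk]; last by rewrite H // gtn_eqF.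
rewrite big_ord_recr /= big1 ?add0r // => k _.
by rewrite H // ltn_eqF.
Qed.

Lemma csum_drop x n : l1 x -> (forall k, (k < n)%N -> x k = 0) -> csum x = csum (fun k => x (n + k)%N).
Proof.
move=> lx H; elim: n H => [//|n IH] H.
rewrite IH => [|k kn]; last by rewrite H // ltnW.
have lt : l1 (fun k => x (n + k)%N) := l1_tl n lx.
rewrite csum_shift // addn0 H // add0r; apply: csum_ext => k.
by rewrite addSnnS.
Qed.

Definition L2aE f : L2 f <-> L2a (fun t => f (expi t)).
Proof. by split=> [[a b c]|[[a b] c]]. Qed.

Definition coef f : nat -> R[i] := fun k => fourier f k.

Lemma innerE f g : inner f g = ip (fun t => f (expi t)) (fun t => g (expi t)).
Proof. by []. Qed.

Lemma fourierE f n : fourier f n = fc (fun t => f (expi t)) n.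
Proof. by []. Qed.

Lemma fc_rz x n : l1 x -> fc (fun t => rz x (expi t)) n =
  if n is Posz k then x k else 0.
Proof.
move=> lx; have l1' : L2a (fun=> 1 : R[i]) by apply: (L2a_ext (L2a_en R 0)) => t; rewrite /en expr0z.
have [lt E] := ip_series lx l1' (L2a_en R n).
rewrite /fc (ip_ext (F' := fun t => rz x (expi t) * 1) (G' := en n)) //; last by move=> t; rewrite mulr1.
rewrite E.
have T (k : nat) : ip (fun t => en k t * 1) (en n) = (Posz k == n)%:R.
  by rewrite -fc_en; apply: ip_ext => // t; rewrite mulr1.
case: n {lt E} T => [n|n] T.
  rewrite (csum_single (n := n)) => [|k kn]; first by rewrite T eqxx mulr1.
  by rewrite T eqz_nat (negPf kn) mulr0.
by rewrite -[RHS](csum0 R); apply: csum_ext => k; rewrite T mulr0.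
Qed.

Lemma hardy_rz x : l1 x -> hardy (rz x).
Proof.
move=> lx; split; first exact/L2aE/L2a_rz.
by case=> // n _; rewrite fourierE fc_rz.
Qed.

Lemma coef_rz x : l1 x -> coef (rz x) = x.
Proof. by move=> lx; apply/funext => k; rewrite /coef fourierE fc_rz. Qed.

Lemma ci_ae F G : cme F -> cme G -> {ae mu, forall t, A t -> F t = G t} -> ci F = ci G.
Proof.
move=> [a b] [c d] FG; rewrite /ci /Rintegral; congr (_ +i* _); congr (fine _ / _).
  apply: ae_eq_integral; [exact: mA|exact/measurable_EFinP|exact/measurable_EFinP|].
  move: FG; apply: filterS; first exact: (ae_filter_ringOfSetsType mu).
  by move=> t H At; rewrite H.
apply: ae_eq_integral; [exact: mA|exact/measurable_EFinP|exact/measurable_EFinP|].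
move: FG; apply: filterS; first exact: (ae_filter_ringOfSetsType mu).
by move=> t H At; rewrite H.
Qed.

Lemma eq_aeE f g : eq_ae f g <-> {ae mu, forall t, A t -> f (expi t) = g (expi t)}.
Proof.
split; apply: filterS; try exact: (ae_filter_ringOfSetsType mu).
  by move=> t H At; apply: H; rewrite inE.
by move=> t H; rewrite inE => At; apply: H.
Qed.

Lemma ip_ae f g F G : eq_ae f g -> L2 f -> L2 g -> cme F -> cme G ->
  ip (fun t => f (expi t) * F t) G = ip (fun t => g (expi t) * F t) G.
Proof.
move=> /eq_aeE fg /L2aE [cf _] /L2aE [cg _] cF cG; apply: ci_ae.
- by apply: cmeM; [exact: cmeM|exact: cme_conj].
- by apply: cmeM; [exact: cmeM|exact: cme_conj].
move: fg; apply: filterS; first exact: (ae_filter_ringOfSetsType mu).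
by move=> t H At; rewrite H.
Qed.

Lemma fourier_ae f g n : eq_ae f g -> L2 f -> L2 g -> fourier f n = fourier g n.
Proof.
move=> fg lf lg; have := ip_ae fg lf lg (cme_cst 1) (cme_en R n).
by rewrite !(ip_ext (F' := _) (G' := en n) (fun t => mulr1 _) (fun=> erefl)).
Qed.

Lemma ae_fourier f g : L2 f -> L2 g -> (forall n, fourier f n = fourier g n) -> eq_ae f g.
Proof.
move=> lf lg H; have lf' := (L2aE f).1 lf; have lg' := (L2aE g).1 lg.
have Z n : fc (fun t => f (expi t) - g (expi t)) n = 0.
  by rewrite fcB // -!fourierE H subrr.
apply/eq_aeE; have := fc_eq0 (L2aB lf' lg') Z.
apply: filterS; first exact: (ae_filter_ringOfSetsType mu).
by move=> t h At; apply/eqP; rewrite -subr_eq0 h.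
Qed.

Lemma hardy_ae_rz f x : hardy f -> coef f = x -> l1 x -> eq_ae f (rz x).
Proof.
move=> [lf f0] fx lx; have [lr r0] := hardy_rz lx.
apply: ae_fourier => // -[n|n]; last by rewrite f0 // r0.
by rewrite -[LHS]/(coef f n) fx -[RHS]/(coef (rz x) n) coef_rz.
Qed.

Lemma hardy_pow (k : nat) : hardy (fun z : R[i] => z ^+ k).
Proof.
split; first by apply/L2aE; exact: (L2a_en R k).
by case=> // n _; rewrite fourierE -[fc _ _]/(fc (en k) (Negz n)) fc_en.
Qed.

Lemma coef_ae f g : hardy f -> hardy g -> eq_ae f g -> coef f = coef g.
Proof. by move=> [lf _] [lg _] fg; apply/funext => k; apply: fourier_ae. Qed.

Lemma ip_hardy f g : hardy f -> hardy g -> l1 (coef f) -> l1 (coef g) ->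
  inner f g = dot (coef f) (coef g).
Proof.
move=> hf hg lcf lcg; have [lf _] := hf; have [lg _] := hg.
have fE := hardy_ae_rz hf erefl lcf.
have [lr _] := hardy_rz lcf.
have lg' := (L2aE g).1 lg.
have l1' : L2a (fun=> 1 : R[i]) by apply: (L2a_ext (L2a_en R 0)) => t; rewrite /en expr0z.
have [lt E] := ip_series lcf l1' lg'.
have := ip_ae fE lf lr l1'.1 lg'.1; rewrite E innerE.
rewrite (ip_ext (F' := fun t => f (expi t)) (G' := fun t => g (expi t))) //; last by move=> t; rewrite mulr1.
move=> ->; apply: csum_ext => k; congr (_ * _).
rewrite (ip_ext (F' := en k) (G' := fun t => g (expi t))) //; last by move=> t; rewrite mulr1.
by rewrite ipC //; exact: L2a_en.
Qed.

(** ** The Szegö projector and the backward shift on coefficients *)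

(** [rz x] is a projection of [f] because the difference has frequencies disjoint from
    those of Hardy functions; testing against the powers identifies any other one. *)
Lemma szego_spec f x : L2 f -> l1 x -> (forall k : nat, fourier f k = x k) ->
  hardy (szego f) /\ coef (szego f) = x.
Proof.
move=> lf lx fx; have lf' := (L2aE f).1 lf.
have ex : exists g, hardy g /\ forall h, hardy h -> inner (fun z => f z - g z) h = 0.
  exists (rz x); split; first exact: hardy_rz.
  move=> h [lh h0]; have lr := L2a_rz lx; have lh' := (L2aE h).1 lh.
  apply: ip_fc0 => //; first exact: L2aB.
  case=> n; last by rewrite -[fc (fun t => h _) _]fourierE h0 // mulr0.
  by rewrite fcB // -fourierE fx fc_rz // subrr mul0r.
have [hg Hg] := xgetPex (fun=> 0) ex; split=> //.
apply/funext => k; have [lg _] := hg; have lg' := (L2aE _).1 lg.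
have := Hg _ (hardy_pow k); rewrite innerE ipBl //; last exact: (L2a_en R k).
move/eqP; rewrite subr_eq0 eq_sym => /eqP E.
rewrite -fx; exact: E.
Qed.

Lemma shift_adj_spec h : hardy h -> l1 (coef h) ->
  hardy (shift_adj h) /\ coef (shift_adj h) = sh (coef h).
Proof.
move=> hh lx; have [lh h0] := hh; have lh' := (L2aE h).1 lh.
have lsx := l1_sh lx.
have fcs F n : L2a F -> fc (fun t => en (-1) t * F t) n = fc F (n + 1).
  move=> lF; rewrite /fc /ip; apply: ci_ext => t.
  by rewrite -!enN opprD enD [_ * F t]mulrC -!mulrA [en _ t * en _ t]mulrC.
have ex : exists g, hardy g /\ forall f, hardy f -> inner (Defs.shift f) h = inner f g.
  exists (rz (sh (coef h))); split; first exact: hardy_rz.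
  move=> f [lf f0]; have lf' := (L2aE f).1 lf; have lr := L2a_rz lsx.
  have lzh := L2a_enM (-1) lh'.
  have -> : inner (Defs.shift f) h = ip (fun t => f (expi t)) (fun t => en (-1) t * h (expi t)).
    apply: ci_ext => t; rewrite /Defs.shift conjcM enN conjcK.
    by rewrite -[expi t]/(en 1 t) mulrCA mulrA.
  apply/eqP; rewrite -subr_eq0 -ipBr //; apply/eqP.
  apply: ip_fc0 => //; first exact: L2aB.
  case=> n; last by rewrite -[fc (fun t => f _) _]fourierE f0 // mul0r.
  rewrite fcB // fcs // fc_rz // /sh /coef fourierE.
  by rewrite -PoszD addn1 subrr mulr0.
have [hg Hg] := xgetPex (fun=> 0) ex; split=> //.
apply/funext => k; have [lg _] := hg; have lg' := (L2aE _).1 lg.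
have := Hg _ (hardy_pow k); rewrite !innerE => E.
rewrite /sh /coef !fourierE /fc ipC //; last exact: (L2a_en R k).
rewrite [in RHS]ipC //; last exact: (L2a_en R k.+1).
congr (conjc _); apply: etrans (esym E) _.
by apply: ip_ext => // t; rewrite /Defs.shift -exprS.
Qed.

End Realization.

(** * Hankel operators on coefficients *)

Section HankelCoefficients.
Variable R : realType.
Notation mu := (@lebesgue_measure R).
Notation A := (angles R).
Implicit Types (F G H : R -> R[i]) (x y : nat -> R[i]) (f g h u : R[i] -> R[i]).

Lemma L2a_ae F G : cme F -> L2a G -> {ae mu, forall t, A t -> F t = G t} -> L2a F.
Proof.
move=> cF [cG iG] FG; split=> //.
suff -> : sqint F = sqint G by [].
apply: ae_eq_integral; [exact: (@mA R)|exact: emeasurable_normc2|exact: emeasurable_normc2|].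
move: FG; apply: filterS; first exact: (ae_filter_ringOfSetsType mu).
by move=> t H At; rewrite H.
Qed.

(** Bessel's inequality, from [0 <= |F - S|^2] for the partial Fourier sum [S]. *)
Lemma bessel_fc F : L2a F -> exists C : R, forall N, \sum_(k < N) normc (fc F k) ^+ 2 <= C.
Proof.
move=> lF; exists (complex.Re (ip F F)) => N.
pose S t := \sum_(k < N) fc F k * en k t.
have lt (k : 'I_N) : L2a (fun t => fc F k * en k t) by apply/L2aZ/L2a_en.
have lS : L2a S by exact: L2a_sum.
pose q : R := \sum_(k < N) normc (fc F k) ^+ 2.
have qE : q%:C = \sum_(k < N) fc F k * (fc F k)^*.
  by rewrite /q rmorph_sum; apply: eq_bigr => k _; rewrite mulc_conj.
have SF : ip S F = q%:C.
  rewrite ip_suml // qE; apply: eq_bigr => k _.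
  by rewrite ipZl //; [congr (_ * _); rewrite ipC //; exact: L2a_en|exact: L2a_en].
have FS : ip F S = q%:C by rewrite ipC // SF conjc_real.
have SS : ip S S = q%:C.
  rewrite {1}/S ip_suml // qE; apply: eq_bigr => k _.
  rewrite ipZl //; last exact: L2a_en.
  rewrite ipC //; last exact: L2a_en.
  congr (_ * _^*); rewrite ip_suml //; last exact: L2a_en.
  rewrite (bigD1 k) //= ipZl; [|exact: L2a_en|exact: L2a_en].
  rewrite -[ip (en k) (en k)]/(fc (en k) k) fc_en eqxx mulr1 big1 ?addr0 // => j jk.
  rewrite ipZl; [|exact: L2a_en|exact: L2a_en].
  by rewrite -[ip (en j) (en k)]/(fc (en j) k) fc_en eqz_nat [_ == _ :> nat](negPf jk) mulr0.
have := ip_sqr (L2aB lF lS).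
rewrite ipBl // ?ipBr //; try exact: L2aB.
rewrite FS SS SF subrr subr0 => /(congr1 (@complex.Re R)); rewrite ReB /= => E.
rewrite -subr_ge0 -/q E divr_ge0 // ?(ltW (@pi2_gt0 R)) // fine_ge0 //.
exact: sqint_ge0.
Qed.

Lemma ip_conj_en h (k n : int) : L2 h ->
  ip (fun t => en k t * (h (expi t))^*) (en n) = (fourier h (k - n))^*.
Proof.
move=> /L2aE lh; rewrite fourierE /fc /ip -ci_conj; last by apply: cin_prod => //; exact: L2a_en.
apply: ci_ext => t; rewrite conjcM conjcK -enN -mulrA mulrC -mulrA; congr (_ * _).
by rewrite -enD addrC.
Qed.

(** Almost everywhere [u] is the sum of its series, which is integrated term by term
    against [conj h]. *)
Lemma fourier_hankel u h : hardy u -> l1 (coef u) -> hardy h ->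
  L2 (fun z => u z * (h z)^*) /\
  forall n : nat, fourier (fun z => u z * (h z)^*) n = corr (coef h) (coef u) n.
Proof.
move=> hu lx hh; have [lh h0] := hh; have [lu u0] := hu.
have lh' := (L2aE h).1 lh; have lu' := (L2aE u).1 lu.
have uE := hardy_ae_rz hu erefl lx; have [lr _] := hardy_rz lx.
have lhJ := L2a_conj lh'.
have lxh := L2a_rzM lx lhJ.
have cp : cme (fun t => u (expi t) * (h (expi t))^*) by apply: cmeM; [case: lu'|case: lhJ].
split.
  apply/L2aE; apply: (L2a_ae cp lxh).
  have := (eq_aeE u (rz (coef u))).1 uE.
  apply: filterS; first exact: (ae_filter_ringOfSetsType mu).
  by move=> t H At; rewrite H.
move=> n; have [lt E] := ip_series lx lhJ (L2a_en R n).
rewrite fourierE /fc (ip_ae uE lu lr lhJ.1 (cme_en R n)) E.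
rewrite (@csum_drop _ _ n) //; last first.
  move=> k kn; rewrite ip_conj_en // h0 ?conjc0 ?mulr0 //.
  by rewrite subr_lt0 ltz_nat.
apply: csum_ext => k; rewrite ip_conj_en // /coef.
congr (_ * (fourier h _)^*).
by rewrite PoszD [_ + Posz k]addrC addrK.
Qed.

(** ** Weighted summability and square summable arguments *)

(** The condition under which the Hankel operators map square summable sequences to
    summable ones and are Hilbert-Schmidt: the [p]-th antidiagonal of the Hankel matrix
    carries [p + 1] entries, and [p + 1] coefficients of a square summable sequence sum
    to at most a multiple of [sqrt (p + 1)]. *)
Definition wl1 x : Prop :=
  exists B, forall N, \sum_(p < N) Num.sqrt p.+1%:R * normc (x p) <= B.

Lemma sqrt_succ_ge1 (p : nat) : 1 <= Num.sqrt p.+1%:R :> R.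
Proof. by rewrite -{1}(sqrtr1 R) ler_sqrt // ler1n. Qed.

Lemma wl1_l1 x : wl1 x -> l1 x.
Proof.
move=> [B H]; exists B => N; apply: le_trans (H N).
by apply: ler_sum => p _; rewrite ler_peMl ?normc_ge0 // sqrt_succ_ge1.
Qed.

Lemma wl1_sh x : wl1 x -> wl1 (sh x).
Proof.
move=> [B H]; exists B => N; apply: le_trans (H N.+1).
rewrite big_ord_recl /= ler_wpDl ?mulr_ge0 ?sqrtr_ge0 ?normc_ge0 //.
apply: ler_sum => p _; rewrite /sh ler_wpM2r ?normc_ge0 // ler_sqrt ?ler_nat //.
Qed.

Lemma rect_le_triangle (g : nat -> nat -> R) P M : (forall i j, 0 <= g i j) ->
  \sum_(n < P) \sum_(m < M) g n m <= \sum_(p < P + M) \sum_(i < p.+1) g i (p - i)%N.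
Proof.
move=> g0; rewrite sum_triangle big_split_ord /=.
apply: ler_wpDr; first by apply: sumr_ge0 => i _; apply: sumr_ge0.
apply: ler_sum => i _.
have /subnKC <- : (M <= P + M - i)%N by rewrite addnC -addnBA ?leq_addr // ltnW.
by rewrite big_split_ord /= lerDl sumr_ge0.
Qed.

Lemma l1_corr_sqr x y (C : R) : wl1 x -> (forall N, \sum_(k < N) normc (y k) ^+ 2 <= C) ->
  l1 (corr y x).
Proof.
move=> [B xB] yC; pose D := (C + 1) / 2.
have D0 : 0 <= D by rewrite divr_ge0 // addr_ge0 //; have := yC 0%N; rewrite big_ord0.
pose g (n r : nat) : R[i] := x (n + r)%N * (y r)^*.
have row p : \sum_(i < p.+1) normc (y (p - i)%N) <= D * Num.sqrt p.+1%:R.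
  set q := Num.sqrt _; have q0 : 0 < q by rewrite sqrtr_gt0 ltr0n.
  have qq : q ^+ 2 = p.+1%:R by rewrite sqr_sqrtr ?ler0n.
  have E : \sum_(i < p.+1) normc (y (p - i)%N) = \sum_(i < p.+1) normc (y i).
    by rewrite (reindex_inj rev_ord_inj) /=; apply: eq_bigr => i _; rewrite subSS subKn // -ltnS.
  rewrite E.
  have T (i : 'I_p.+1) : normc (y i) <= (q * normc (y i) ^+ 2 + q^-1) / 2.
    rewrite ler_pdivlMr // -subr_ge0.
    have -> : q * normc (y i) ^+ 2 + q^-1 - normc (y i) * 2 = q^-1 * (q * normc (y i) - 1) ^+ 2.
      by field; rewrite gt_eqF.
    by rewrite mulr_ge0 ?sqr_ge0 // invr_ge0 ltW.
  apply: le_trans (ler_sum _ (fun i _ => T i)) _.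
  rewrite -mulr_suml big_split /= -mulr_sumr sumr_const card_ord -[_ *+ p.+1]mulr_natl -qq.
  have -> : q ^+ 2 * q^-1 = q by field; rewrite gt_eqF.
  rewrite /D mulrAC ler_pM2r ?invr_gt0 // mulrDl mul1r lerD2r mulrC ler_wpM2r ?yC //.
  exact: ltW.
apply: (@l1_ext _ (fun n => csum (g n))) => //.
exists (D * B); apply: double_csum => N.
apply: le_trans (@rect_le_triangle (fun i j => normc (g i j)) N N _) _.
  by move=> i j; exact: normc_ge0.
apply: le_trans (_ : \sum_(p < N + N) D * (Num.sqrt p.+1%:R * normc (x p)) <= _); last first.
  by rewrite -mulr_sumr ler_wpM2l.
apply: ler_sum => p _; rewrite mulrA; apply: le_trans (ler_wpM2r (normc_ge0 _) (row p)).
rewrite mulr_suml; apply: ler_sum => i _.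
by rewrite /g normcM normc_conj subnKC ?(mulrC (normc (x _))) // -ltnS.
Qed.

Lemma wl1_hs x : wl1 x -> exists C : R, forall P M,
  \sum_(n < P) \sum_(m < M) normc (x (n + m).+1) ^+ 2 <= C.
Proof.
move=> /wl1_sh [B xB]; exists (B * B) => P M.
apply: le_trans (@rect_le_triangle (fun i j => normc (x (i + j).+1) ^+ 2) P M _) _.
  by move=> i j; exact: sqr_ge0.
pose a p : R := Num.sqrt p.+1%:R * normc (sh x p).
have a0 p : 0 <= a p by rewrite mulr_ge0 ?sqrtr_ge0 ?normc_ge0.
have aB p : a p <= B.
  by apply: le_trans (xB p.+1); rewrite big_ord_recr /= lerDr sumr_ge0 // => i _; exact: a0.
apply: le_trans (_ : \sum_(p < P + M) B * a p <= _); last first.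
  rewrite -mulr_sumr ler_wpM2l ?xB //; exact: le_trans (aB 0%N).
apply: ler_sum => p _; apply: le_trans (ler_wpM2r (a0 p) (aB p)).
rewrite (eq_bigr (fun=> normc (x p.+1) ^+ 2)) => [|i _]; last by rewrite subnKC // -ltnS.
rewrite sumr_const card_ord -[_ *+ p.+1]mulr_natl /a /sh -expr2 exprMn sqr_sqrtr ?ler0n //.
Qed.

(** ** The Hankel operators and their eigenspaces *)

Variables (u : R[i] -> R[i]) (x : nat -> R[i]).
Hypotheses (hu : hardy u) (ux : coef u = x) (wx : wl1 x).

Lemma coef_L2_corr h : hardy h -> l1 (corr (coef h) x).
Proof.
by move=> [lh _]; have [C H] := bessel_fc ((L2aE h).1 lh); exact: l1_corr_sqr wx H.
Qed.

Lemma Hankel_spec h : hardy h -> hardy (Hankel u h) /\ coef (Hankel u h) = Hop x (coef h).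
Proof.
move=> hh; have lx := wl1_l1 wx; rewrite -ux in lx.
have [lp E] := fourier_hankel hu lx hh.
by apply: szego_spec; [exact: lp|exact: coef_L2_corr|rewrite -ux; exact: E].
Qed.

Lemma sHankel_spec h : hardy h -> hardy (sHankel u h) /\ coef (sHankel u h) = Kop x (coef h).
Proof.
move=> hh; have [hH cH] := Hankel_spec hh.
have lH : l1 (coef (Hankel u h)) by rewrite cH; exact: coef_L2_corr.
have [hs cs] := shift_adj_spec hH lH; split=> //.
by rewrite /sHankel cs cH /Hop sh_corr.
Qed.

Lemma hardyZ c h : hardy h -> hardy (fun z => c * h z) /\ coef (fun z => c * h z) = c *: coef h.
Proof.
move=> [lh h0]; have lh' := (L2aE h).1 lh; split; last first.
  by apply/funext => k; rewrite /coef fourierE fcZ.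
split; first exact/L2aE/L2aZ.
by move=> n n0; rewrite fourierE fcZ // -fourierE h0 // mulr0.
Qed.

Lemma hardyD g h : hardy g -> hardy h ->
  hardy (fun z => g z + h z) /\ coef (fun z => g z + h z) = coef g + coef h.
Proof.
move=> [lg g0] [lh h0]; have lh' := (L2aE h).1 lh; have lg' := (L2aE g).1 lg.
split; last by apply/funext => k; rewrite /coef fourierE fcD.
split; first exact/L2aE/L2aD.
by move=> n n0; rewrite fourierE fcD // -!fourierE h0 // g0 // addr0.
Qed.

Lemma ae_coef g h : hardy g -> hardy h -> coef g = coef h -> eq_ae g h.
Proof.
move=> [lg g0] [lh h0] gh; apply: ae_fourier => // -[n|n]; last by rewrite g0 // h0.
exact: (congr1 (fun c => c n) gh).
Qed.

(** For [s <> 0], the equation itself shows that the coefficients of an eigenvector are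
    summable, as the image of a Hankel operator. *)
Lemma F_spec (s : R) h : 0 < s -> F_ u s h <-> hardy h /\ eigK x (s ^+ 2) (coef h).
Proof.
move=> s0; split=> -[hh E]; split=> //.
  have [h1 c1] := sHankel_spec hh; have [h2 c2] := sHankel_spec h1.
  have [h3 c3] := hardyZ (s ^+ 2)%:C hh.
  have := coef_ae h2 h3 E; rewrite c2 c1 c3 => e; split=> //.
  have : l1 ((s ^+ 2)%:C *: coef h) by rewrite -e -c1 /Kop -sh_corr; apply/l1_sh/coef_L2_corr.
  move=> /(l1_scale (s ^+ 2)%:C^-1); rewrite scalerA mulVf ?scale1r //.
  by rewrite eq_complex /= negb_and sqrf_eq0 gt_eqF.
have [lc e] := E.
have [h1 c1] := sHankel_spec hh; have [h2 c2] := sHankel_spec h1.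
have [h3 c3] := hardyZ (s ^+ 2)%:C hh.
by apply: ae_coef => //; rewrite c2 c1 c3.
Qed.

Lemma E_spec (s : R) (f : nat -> R[i]) : eigH x (s ^+ 2) f -> E_ u s (rz f).
Proof.
move=> [lf e]; have hh := hardy_rz lf; split=> //.
have [h1 c1] := Hankel_spec hh; have [h2 c2] := Hankel_spec h1.
have [h3 c3] := hardyZ (s ^+ 2)%:C hh.
by apply: ae_coef => //; rewrite c2 c1 c3 coef_rz.
Qed.

Lemma K_component_spec (s : R) : 0 < s -> hardy (K_component u s) /\
  eigK x (s ^+ 2) (coef (K_component u s)) /\
  forall f : nat -> R[i], eigK x (s ^+ 2) f -> dot f x = dot f (coef (K_component u s)).
Proof.
move=> s0; have [C HS] := wl1_hs wx; have lx := wl1_l1 wx.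
have [a ea Ha] := eigK_proj lx (exprn_gt0 2 s0) HS lx; have [la _] := ea.
have lu' := (L2aE u).1 hu.1.
have ex : exists g, F_ u s g /\ forall h, F_ u s h -> inner (fun z => u z - g z) h = 0.
  exists (rz a); split; first by apply/(F_spec _ s0); rewrite coef_rz //; split=> //; exact: hardy_rz.
  move=> h /(F_spec _ s0) [hh eh]; have [lh _] := eh.
  rewrite innerE ipBl //; [|exact: L2a_rz|by apply/L2aE; case: hh].
  rewrite -2!innerE ip_hardy ?ux // ip_hardy ?coef_rz //; last exact: hardy_rz.
  by rewrite -dotBl // Ha.
have [Fg Hg] := xgetPex (fun=> 0) ex; have [hg eg] := (F_spec _ s0).1 Fg.
split=> //; split=> // f ef; have [lf _] := ef; have [lg _] := eg.
have hf := hardy_rz lf.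
have Ff : F_ u s (rz f) by apply/(F_spec _ s0); rewrite coef_rz.
have := Hg _ Ff; rewrite innerE ipBl //; [|by apply/L2aE; case: hg|by apply/L2aE; case: hf].
rewrite -2!innerE ip_hardy ?ux ?coef_rz // ip_hardy ?coef_rz // => /eqP; rewrite subr_eq0 => /eqP E.
by rewrite dotC // E -dotC.
Qed.

End HankelCoefficients.

(** * Sobolev regularity and the equation satisfied by the coefficients *)

Section SobolevWeights.
Variables (R : realType) (s : R).
Hypothesis s1 : 1 < s.
Implicit Types (x y : nat -> R[i]) (f g h : R[i] -> R[i]).

Definition sobw (k : nat) : R := (1 + k%:R ^+ 2) `^ s.

Lemma sobw_gt0 k : 0 < sobw k.
Proof. by rewrite powR_gt0 // ltr_pwDl // sqr_ge0. Qed.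

Lemma powR4_gt4 : 4 < 4 `^ s :> R.
Proof.
have -> : s = 1 + (s - 1) by rewrite addrC subrK.
rewrite powRD; last by rewrite pnatr_eq0 implybT.
rewrite powRr1 // ltr_pMr // /powR pnatr_eq0 /= expR_gt1 mulr_gt0 ?subr_gt0 //.
by rewrite ln_gt0 // ltr1n.
Qed.

(** On the dyadic block [2 ^ J <= k + 1 <= 2 ^ (J + 1)] the weight is at least
    [(4 ^ J / 2) ^ s], because [(k + 1) ^ 2 <= 2 (1 + k ^ 2)]; the block thus contributes
    a term of a geometric series of ratio [4 / 4 ^ s < 1]. *)
Lemma sobw_dyadic J k : (2 ^ J <= k.+1)%N -> (k.+1 <= 2 ^ J.+1)%N ->
  k.+1%:R / sobw k <= 2 * 2 `^ s * (4 / 4 `^ s) ^+ J / (2 ^ J)%:R.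
Proof.
move=> lo hi; have q0 : 0 < (4 `^ s : R) by rewrite powR_gt0.
have h0 : 0 < (2 `^ s : R) by rewrite powR_gt0.
have w0 := sobw_gt0 k.
have t0 : 0 < (2 ^ J)%:R :> R by rewrite ltr0n expn_gt0.
have Q : (4 `^ s) ^+ J <= 2 `^ s * sobw k.
  have -> : (4 `^ s) ^+ J = (4 ^+ J) `^ s :> R.
    elim: J {lo hi t0} => [|J IH]; first by rewrite !expr0 powR1.
    by rewrite !exprS powRM ?exprn_ge0 // IH.
  rewrite /sobw -powRM ?addr_ge0 ?sqr_ge0 //.
  apply: ge0_ler_powR; rewrite ?nnegrE ?exprn_ge0 ?mulr_ge0 ?addr_ge0 ?sqr_ge0 //.
    by rewrite ltW // (lt_trans _ s1).
  have -> : 4 ^+ J = ((2 ^ J)%:R) ^+ 2 :> R.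
    by rewrite natrX -!exprM mulnC exprM; congr (_ ^+ _); rewrite -natrX.
  apply: le_trans (_ : (k.+1%:R) ^+ 2 <= _).
    by rewrite ler_pXn2r ?nnegrE ?ler0n // ler_nat.
  rewrite -natr1 -subr_ge0.
  have -> : 2 * (1 + k%:R ^+ 2) - (k%:R + 1) ^+ 2 = (k%:R - 1) ^+ 2 :> R by ring.
  exact: sqr_ge0.
rewrite ler_pdivrMr //.
apply: le_trans (_ : (2 ^ J.+1)%:R <= _); first by rewrite ler_nat.
have -> : (2 ^ J.+1)%:R = 2 * (2 ^ J)%:R :> R by rewrite expnS natrM.
have E4 : (4 : R) ^+ J = (2 ^ J)%:R ^+ 2.
  by rewrite natrX -!exprM mulnC exprM; congr (_ ^+ _); rewrite -natrX.
rewrite expr_div_n E4.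
have QJ : 0 < (4 `^ s) ^+ J :> R by rewrite exprn_gt0.
set q := (4 `^ s) ^+ J in Q QJ *; set a := (2 ^ J)%:R in t0 *.
have -> : 2 * 2 `^ s * (a ^+ 2 / q) / a * sobw k = 2 * a * ((2 `^ s * sobw k) / q).
  by field; rewrite !gt_eqF.
rewrite ler_peMr ?mulr_ge0 ?(ltW t0) //.
by rewrite ler_pdivlMr // mul1r.
Qed.

Lemma sobw_sum : exists W, forall N, \sum_(k < N) k.+1%:R / sobw k <= W.
Proof.
pose r : R := 4 / 4 `^ s; have q0 : 0 < (4 `^ s : R) by rewrite powR_gt0.
have r0 : 0 < r by rewrite divr_gt0.
have r1 : r < 1 by rewrite ltr_pdivrMr // mul1r powR4_gt4.
pose M : R := 2 * 2 `^ s; have M0 : 0 < M by rewrite mulr_gt0 // powR_gt0.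
pose a k : R := k.+1%:R / sobw k.
have a0 k : 0 <= a k by rewrite divr_ge0 // ltW // sobw_gt0.
have block J : \sum_(k < (2 ^ J).-1) a k <= M * \sum_(j < J) r ^+ j.
  elim: J => [|J IH]; first by rewrite expn0 !big_ord0 mulr0.
  have t0 : (0 < 2 ^ J)%N by rewrite expn_gt0.
  have -> : (2 ^ J.+1).-1 = ((2 ^ J).-1 + 2 ^ J)%N.
    by rewrite expnS mul2n -addnn -{1}(prednK t0) addSn.
  rewrite big_split_ord /= big_ord_recr /= mulrDr; apply: lerD => //.
  apply: le_trans (_ : \sum_(i < 2 ^ J) (M * r ^+ J / (2 ^ J)%:R) <= _).
    apply: ler_sum => i _; apply: sobw_dyadic.
      by rewrite -addSn prednK // leq_addr.
    by rewrite -addSn prednK // expnS mul2n -addnn leq_add2l ltnW.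
  rewrite sumr_const card_ord -[_ *+ (2 ^ J)]mulr_natl mulrC divfK // pnatr_eq0 -lt0n //.
exists (M / (1 - r)) => N.
apply: le_trans (_ : \sum_(k < (2 ^ N).-1) a k <= _).
  have /subnKC <- : (N <= (2 ^ N).-1)%N by rewrite -ltnS prednK ?expn_gt0 // ltn_expl.
  by rewrite big_split_ord /= lerDl sumr_ge0.
apply: le_trans (block N) _; rewrite ler_pM2l //.
rewrite -[leRHS]mul1r ler_pdivlMr ?subr_gt0 //.
have -> : (\sum_(j < N) r ^+ j) * (1 - r) = 1 - r ^+ N.
  have := subrXX 1 r N; rewrite expr1n => ->; rewrite mulrC; congr (_ * _).
  by apply: eq_bigr => i _; rewrite expr1n mul1r.
by rewrite gerBl exprn_ge0 // ltW.
Qed.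

Lemma sob_sum f (E : R) : (sobolev_sqnorm s f <= E%:E)%E ->
  forall N, \sum_(k < N) sobw k * normc (coef f k) ^+ 2 <= E.
Proof.
move=> fE N; rewrite -lee_fin; apply: le_trans fE.
apply: esum_ge; exists (Posz @` `I_N); first by split=> //; exact/finite_image/finite_II.
rewrite fsbig_image; last by move=> a b _ _ [].
rewrite -fsbig_ord sumEFin //.
Qed.

(** By [2 a b <= a ^ 2 + b ^ 2], with the weight split between the two factors. *)
Lemma sob_wl1 f : (sobolev_sqnorm s f < +oo)%E -> wl1 (coef f).
Proof.
move=> fin; have [W HW] := sobw_sum.
have [E fE] : exists E : R, (sobolev_sqnorm s f <= E%:E)%E.
  move: fin; case: (sobolev_sqnorm s f) => [E| |] // _; first by exists E.
  by exists 0; rewrite leNye.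
exists ((W + E) / 2) => N.
apply: le_trans (_ : \sum_(k < N) ((k.+1%:R / sobw k + sobw k * normc (coef f k) ^+ 2) / 2) <= _).
  apply: ler_sum => k _; have w0 := sobw_gt0 k; set c := normc _; set w := sobw k in w0 *.
  set q := Num.sqrt _; have <- : q ^+ 2 = k.+1%:R by rewrite sqr_sqrtr.
  rewrite ler_pdivlMr // -subr_ge0.
  have -> : q ^+ 2 / w + w * c ^+ 2 - q * c * 2 = w^-1 * (q - w * c) ^+ 2.
    by field; rewrite gt_eqF.
  by rewrite mulr_ge0 ?sqr_ge0 // invr_ge0 ltW.
rewrite -mulr_suml ler_pM2r ?invr_gt0 // big_split /= lerD ?HW //.
exact: sob_sum.
Qed.

Lemma sob_small (e : R) : 0 < e -> exists2 E : R, 0 < E & forall f,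
  (sobolev_sqnorm s f <= E%:E)%E -> bd (coef f) e.
Proof.
move=> e0; have [W HW] := sobw_sum.
have W0 : 0 <= W by have := HW 0%N; rewrite big_ord0.
have W1 : 0 < W + 1 by rewrite ltr_wpDl.
pose d := e / (W + 1); have d0 : 0 < d by rewrite divr_gt0.
exists (d * e); first by rewrite mulr_gt0.
move=> f fE N.
apply: le_trans (_ : \sum_(k < N) ((d * (k.+1%:R / sobw k) +
    sobw k * normc (coef f k) ^+ 2 / d) / 2) <= _).
  apply: ler_sum => k _; have w0 := sobw_gt0 k; set c := normc _; set w := sobw k in w0 *.
  rewrite ler_pdivlMr //.
  apply: le_trans (_ : d * (1 / w) + w * c ^+ 2 / d <= _); last first.
    by rewrite lerD2r ler_pM2l // ler_pM2r ?invr_gt0 // ler1n.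
  rewrite -subr_ge0.
  have -> : d * (1 / w) + w * c ^+ 2 / d - c * 2 = (d * w)^-1 * (d - w * c) ^+ 2.
    by field; rewrite !gt_eqF.
  by rewrite mulr_ge0 ?sqr_ge0 // invr_ge0 ltW // mulr_gt0.
rewrite -mulr_suml big_split /= -mulr_sumr -mulr_suml ler_pdivrMr // mulrDr mulr1.
apply: lerD; last first.
  rewrite ler_pdivrMr // [e * d]mulrC.
  exact: sob_sum.
apply: le_trans (_ : d * W <= _); first by rewrite ler_pM2l // HW.
by rewrite /d mulrAC ler_pdivrMr // ler_pM2l // lerDl.
Qed.

End SobolevWeights.

Section Equation.
Variables (R : realType) (alpha s : R) (u : R -> R[i] -> R[i]).
Hypotheses (s1 : 1 < s) (sol_u : szego_solution alpha s u).
Notation A := (angles R).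
Implicit Types (x y : nat -> R[i]) (f g h : R[i] -> R[i]).

Lemma sol_hardy t : hardy (u t).
Proof. by have [[_ h] _] := sol_u t. Qed.

Lemma sol_wl1 t : wl1 (coef (u t)).
Proof. by have [[[_ f] _] _] := sol_u t; exact: sob_wl1 f. Qed.

(** [|f|^2 f] is almost everywhere the product of [f ^ 2], which has summable
    coefficients, with [conj f]: a Hankel product. *)
Lemma cubic_spec f : hardy f -> l1 (coef f) ->
  hardy (szego (fun w => (normc (f w) ^+ 2)%:C * f w)) /\
  coef (szego (fun w => (normc (f w) ^+ 2)%:C * f w)) = Top (coef f) (coef f).
Proof.
move=> hf lx; set x := coef f in lx *; have [lf _] := hf; have lf' := (L2aE f).1 lf.
have lxx := l1_conv lx lx; have hr := hardy_rz lxx.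
have lc : l1 (coef (rz (convol x x))) by rewrite coef_rz.
have [lp Ep] := fourier_hankel hr lc hf; rewrite coef_rz // in Ep.
have ae : eq_ae (fun w => (normc (f w) ^+ 2)%:C * f w) (fun z => rz (convol x x) z * (f z)^*).
  apply/eq_aeE; have := (eq_aeE _ _).1 (hardy_ae_rz hf erefl lx).
  apply: filterS; first exact: (ae_filter_ringOfSetsType (@lebesgue_measure R)).
  move=> t H At; rewrite -rzM ?normc_expi // -H // -mulc_conj.
  by rewrite mulrAC.
have lq : L2 (fun w => (normc (f w) ^+ 2)%:C * f w).
  apply/L2aE; apply: (L2a_ae _ ((L2aE _).1 lp)); last exact: (eq_aeE _ _).1 ae.
  apply: cmeM; last by case: lf'.
  apply: (@cme_ext _ (fun t => f (expi t) * (f (expi t))^*)) => [|t]; last by rewrite mulc_conj.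
  by apply: cmeM; [|apply: cme_conj]; case: lf'.
apply: szego_spec => //; first exact: l1_Top.
by move=> k; rewrite (fourier_ae _ ae lq lp) Ep.
Qed.

Lemma hardy_cst (c : R[i]) : hardy (fun=> c) /\ coef (fun=> c) = c *: delta0 R.
Proof.
have E : (fun _ : R[i] => c) = (fun z => c * z ^+ 0) by apply/funext => z; rewrite expr0 mulr1.
have [h e] := hardyZ c (hardy_pow R 0); rewrite E; split=> //; rewrite e; congr (_ *: _).
apply/funext => k; rewrite /coef fourierE -[fc _ _]/(fc (en 0) k) fc_en.
by rewrite /delta0 eq_sym.
Qed.

Lemma inner_one f : inner f (fun=> 1) = coef f 0%N.
Proof. by rewrite /coef /fourier; congr (inner _ _); apply/funext => z; rewrite expr0z. Qed.

Lemma sol_rhs t v : hardy v ->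
  eq_ae (fun z => 'i * v z)
    (fun z => szego (fun w => (normc (u t w) ^+ 2)%:C * u t w) z + alpha%:C * inner (u t) (fun=> 1)) ->
  coef v = flow_rhs alpha (fun t => coef (u t)) t.
Proof.
move=> hv e; have lx := wl1_l1 (sol_wl1 t).
have [h1 c1] := hardyZ 'i hv.
have [h2 c2] := cubic_spec (sol_hardy t) lx.
have [h3 c3] := hardy_cst (alpha%:C * inner (u t) (fun=> 1)).
have [h4 c4] := hardyD h2 h3.
have := coef_ae h1 h4 e; rewrite c1 c4 c2 c3 inner_one /flow_rhs => <-.
rewrite scalerA.
have -> : - 'i * 'i = 1 :> R[i].
  apply/eqP; rewrite eq_complex /=.
  by rewrite !(mulr0, mul0r, mulr1, oppr0, subr0, addr0, mulNr, sub0r, opprK) !eqxx.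
by rewrite scale1r.
Qed.

(** Convergence of the difference quotients for the Sobolev norm implies convergence
    for the l^1 norm of the coefficients. *)
Lemma sol_dcurve t : dcurve (fun t => coef (u t)) t (flow_rhs alpha (fun t => coef (u t)) t).
Proof.
have [_ [v [[_ hv] dv ev]]] := sol_u t.
rewrite -(sol_rhs hv ev) => e e0; have [E E0 HE] := sob_small s1 e0.
have N0 : nbhs (0 : \bar R) [set y | (y < E%:E)%E].
  by apply: open_nbhs_nbhs; split; [exact: open_ereal_lt_ereal|rewrite /= lte_fin].
have /nbhs_ballP[d /= d0 Hd] := dv _ N0.
exists (d / 2); first by rewrite divr_gt0.
move=> h hd; have [->|hN] := eqVneq h 0.
  rewrite normr0 mulr0 addr0 subrr rmorph0 scale0r subr0; exact: bd0.
have hd' : ball (0 : R) d h.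
  by rewrite /ball /= sub0r normrN; apply: le_lt_trans hd _; rewrite ltr_pdivrMr // ltr_pMr // ltr1n.
have /ltW /HE B := Hd _ hd' hN.
have hC : h%:C != 0 by rewrite eq_complex /= negb_and hN.
set w := (fun z => _) in B.
have -> : coef (u (t + h)) - coef (u t) - h%:C *: coef v = h%:C *: coef w.
  have l1' := (L2aE _).1 (sol_hardy (t + h)).1; have l2' := (L2aE _).1 (sol_hardy t).1.
  have lv := (L2aE _).1 hv.1.
  apply/funext => k; rewrite -[RHS]/(h%:C * coef w k) /coef [fourier w k]fourierE /w.
  rewrite fcB //; last first.
    by apply: (L2a_ext (L2aZ h%:C^-1 (L2aB l1' l2'))) => x; rewrite mulrC.
  have -> : fc (fun r => (u (t + h) (expi r) - u t (expi r)) / h%:C) k =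
      h%:C^-1 * (fourier (u (t + h)) k - fourier (u t) k).
    rewrite !fourierE -fcB // -fcZ; last exact: L2aB.
    by congr (fc _ _); apply/funext => x; rewrite mulrC.
  by rewrite mulrBr mulrA mulfV // mul1r -fourierE.
have := bd_scale h%:C B; rewrite normc_real mulrC //.
Qed.

End Equation.

(** * Blaschke products *)

Section Blaschke.
Variable R : realType.
Implicit Types (x y : nat -> R[i]) (z : R[i]) (P Q : {poly R[i]}).

Lemma expi_onto z : normc z = 1 -> exists th : R, z = expi th.
Proof.
case: z => a b n1; have E : a ^+ 2 + b ^+ 2 = 1.
  by have := sqr_normcE (Complex a b); rewrite n1 expr1n.
have a1 : -1 <= a <= 1.
  by rewrite -ler_norml -(expr_le1 (n := 2)) // ?normr_ge0 // real_normK ?num_real // -E lerDl sqr_ge0.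
have sE : sin (acos a) = `|b|.
  by rewrite sin_acos // -E addrC addKr sqrtr_sqr.
have [b0|b0] := leP 0 b.
  by exists (acos a); rewrite /expi acosK // sE ger0_norm.
by exists (- acos a); rewrite /expi cosN sinN acosK // sE ltr0_norm // opprK.
Qed.

Definition pseq P : nat -> R[i] := fun k => P`_k.

Lemma l1_pseq P : l1 (pseq P).
Proof.
exists (\sum_(k < size P) normc P`_k) => N.
apply: le_trans (_ : \sum_(k < maxn N (size P)) normc P`_k <= _).
  have /subnKC <- := leq_maxl N (size P).
  by rewrite big_split_ord /= lerDl sumr_ge0 // => i _; exact: normc_ge0.
have /subnKC <- := leq_maxr N (size P).
rewrite big_split_ord /= [X in _ + X]big1 ?addr0 // => i _.
by rewrite nth_default ?leq_addr // normc0.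
Qed.

Lemma rz_pseq P z : rz (pseq P) z = P.[z].
Proof.
rewrite /rz (csum_finite (N := size P)) ?horner_coef // => k kP.
by rewrite /pseq nth_default // mul0r.
Qed.

(** The zeros of the denominator are the reflections of those of the numerator
    across the unit circle. *)
Lemma reciprocal_neq0 (d : nat) P z : P \is monic -> size P = d.+1 ->
  (forall w, root P w -> normc w < 1) -> normc z <= 1 -> (reciprocal_poly d P).[z] != 0.
Proof.
move=> mP sP rP z1; rewrite /reciprocal_poly horner_poly.
have [->|zN] := eqVneq z 0.
  rewrite big_ord_recl /= subn0 expr0 mulr1 big1 ?addr0 => [|i _]; last by rewrite expr0n mulr0.
  by move: mP; rewrite monicE lead_coefE sP /= => /eqP ->; rewrite conjc1 oner_neq0.
apply/negP => /eqP E; have cz : z^* != 0 by rewrite conjc_eq0.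
have E' : \sum_(i < d.+1) ((P`_(d - i))^* * z ^+ i)^* = 0 by rewrite -conjc_sum E conjc0.
have : root P (z^*)^-1.
  rewrite rootE horner_coef sP; apply/eqP; apply: (mulfI (expf_neq0 d cz)).
  rewrite mulr0 mulr_sumr; apply: etrans E'; rewrite (reindex_inj rev_ord_inj) /=.
  apply: eq_bigr => i _; rewrite subSS conjcM conjcK.
  have id : (i <= d)%N by rewrite -ltnS.
  rewrite mulrCA; congr (_ * _).
  rewrite -{1}(subnK id) exprD exprVn mulrAC mulfV ?expf_neq0 // mul1r.
  by rewrite rmorphXn.
move=> /rP; rewrite normcV normc_conj; apply/negP; rewrite -leNgt.
by rewrite invf_ge1 // normc_gt0.
Qed.

End Blaschke.

(** * The evolution of the Blaschke product *)

Section Evolution.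
Variables (R : realType) (alpha s : R) (u : R -> R[i] -> R[i]) (sigma : R).
Hypotheses (s1 : 1 < s) (sol_u : szego_solution alpha s u) (sigma0 : 0 < sigma).
Notation x t := (coef (u t)).
Notation k t := (K_component (u t) sigma).
Notation s2 := (sigma ^+ 2).

Let wx t : wl1 (x t) := sol_wl1 s1 sol_u t.
Let hx t : hardy (u t) := sol_hardy sol_u t.
Let lx t : l1 (x t) := wl1_l1 (wx t).

Lemma component_coef t : hardy (k t) /\ component (fun t => x t) s2 t (coef (k t)).
Proof. by have [a [b c]] := K_component_spec (hx t) erefl (wx t) sigma0. Qed.

Lemma component_neq0 t : Sigma_K (u t) sigma -> coef (k t) <> 0.
Proof.
move=> [_ no] k0; apply: no => h /(F_spec (hx t) erefl (wx t) _ sigma0) [hh eh].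
have [lh _] := eh; have [_ [_ Hc]] := component_coef t.
by rewrite ip_hardy // dotC // Hc // k0 dot0r conjc0.
Qed.

(** If [u 0] were orthogonal to the eigenspace of [K ^ 2], then [eigH_dominant] would
    give two eigenvectors [f] and [H f] of [H ^ 2], the first one orthogonal to [u 0]
    and the second one not; hence they are independent, and time 0 is a crossing. *)
Lemma component_neq0_init u0 : sobolev_plus s u0 -> eq_ae (u 0) u0 ->
  K_singular_value u0 sigma -> ~ crossing_times u sigma 0 -> coef (k 0) <> 0.
Proof.
move=> [[_ fin] hu0] e0 [_ [h Fh hN]] nc k0.
have cE : coef u0 = x 0 by rewrite (coef_ae (hx 0) hu0 e0).
have [hh eh] := (F_spec hu0 cE (wx 0) h sigma0).1 Fh.
have hn : coef h <> 0.
  move=> h0; apply: hN; have [hc cc] := hardy_cst (0 : R[i]).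
  by apply: ae_coef => //; rewrite h0 cc scale0r.
have perp f : eigK (x 0) s2 f -> dot f (x 0) = 0.
  by move=> ef; have [_ [_ Hc]] := component_coef 0; rewrite Hc // k0 dot0r.
have [f [Ef EHf fN fu Hfu]] := eigH_dominant (lx 0) (exprn_gt0 2 sigma0) eh hn perp.
have [lf _] := Ef; have [lHf _] := EHf.
have E1 := E_spec (hx 0) erefl (wx 0) Ef; have E2 := E_spec (hx 0) erefl (wx 0) EHf.
apply: nc; split.
  split=> // no; have := no _ E2; rewrite ip_hardy ?coef_rz //; last exact: hardy_rz.
  by rewrite dotC // => /(congr1 (@conjc R)); rewrite conjcK conjc0 => /eqP; rewrite (negPf Hfu).
exists (fun j : 'I_2 => if j == 0 then rz f else rz (Hop (x 0) f)).
  by move=> j; case: (j == 0).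
move=> c; set w := (fun z : R[i] => \sum_(j < 2) _) => wz.
have [h1 c1] := hardyZ (c 0) (hardy_rz lf).
have [h2 c2] := hardyZ (c 1) (hardy_rz lHf).
have [h3 c3] := hardyD h1 h2; have [hc cc] := hardy_cst (0 : R[i]).
have wE : w = fun z => c 0 * rz f z + c 1 * rz (Hop (x 0) f) z.
  have <- : lift ord0 ord0 = 1 :> 'I_2 by exact/val_inj.
  by apply/funext => z; rewrite /w big_ord_recl big_ord1 /=.
rewrite wE in wz; have := coef_ae h3 hc wz; rewrite c3 c1 c2 cc !coef_rz // scale0r => Z.
have c10 : c 1 = 0.
  have := congr1 (fun y => dot y (x 0)) Z.
  rewrite dotDl ?dotZl ?dot0l ?fu ?mulr0 ?add0r; try exact: l1_scale; try exact: (lx 0); try done.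
  by move=> /eqP; rewrite mulf_eq0 (negPf Hfu) orbF => /eqP.
have c00 : c 0 = 0.
  apply/eqP/negP => /negP cN; apply: fN; move: Z; rewrite c10 scale0r addr0.
  move=> /(congr1 (fun y => (c 0)^-1 *: y)); rewrite scalerA mulVf // scale1r => ->.
  by rewrite scaler0.
by move=> j; case: (unliftP 0 j) => [i ->|-> //]; rewrite (ord1 i) -c10; congr c; exact/val_inj.
Qed.

(** Clearing the denominator turns the relation [K a = sigma Psi a] almost everywhere
    into an identity between products of sequences of coefficients. *)
Lemma blaschke_coef t Psi : finite_blaschke Psi ->
  eq_ae (sHankel (u t) (k t)) (fun z => sigma%:C * Psi z * k t z) ->
  exists P Q c, [/\ c != 0, forall z, normc z <= 1 -> Q.[z] != 0,
    forall z, normc z <= 1 -> sigma%:C * Psi z = c * (P.[z] / Q.[z]) &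
    convol (pseq Q) (Kop (x t) (coef (k t))) = c *: convol (pseq P) (coef (k t))].
Proof.
move=> [d [psi [P [mP sP rP PsiE]]]] e; have [hk [[lk _] _]] := component_coef t.
set Q := reciprocal_poly d P in PsiE.
have QN z : normc z <= 1 -> Q.[z] != 0 by exact: reciprocal_neq0.
pose c := sigma%:C * expi (- psi).
exists P, Q, c; split=> //.
- by rewrite mulf_neq0 ?expi_neq0 // eq_complex /= negb_and gt_eqF.
- by move=> z z1; rewrite PsiE // /c mulrA.
have [hK cK] := sHankel_spec (hx t) erefl (wx t) hk.
have lK : l1 (Kop (x t) (coef (k t))) by apply: l1_Kop.
have lL := l1_conv (l1_pseq Q) lK; have lP := l1_conv (l1_pseq P) lk.
have lR := l1_scale c lP.
rewrite -(coef_rz lL) -(coef_rz lR); apply: coef_ae; [exact: hardy_rz|exact: hardy_rz|].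
have aK := (eq_aeE _ _).1 (hardy_ae_rz hK cK lK).
have ak := (eq_aeE _ _).1 (hardy_ae_rz hk erefl lk).
apply/eq_aeE; move: ((eq_aeE _ _).1 e) aK ak.
apply: filterS3; first exact: (ae_filter_ringOfSetsType (@lebesgue_measure R)).
move=> th He HK Hk Ath; have n1 : normc (expi th) <= 1 by rewrite normc_expi.
rewrite -rzM ?rz_pseq //; last exact: l1_pseq.
rewrite -HK // He // PsiE //.
have -> : rz (c *: convol (pseq P) (coef (k t))) (expi th) =
    c * rz (convol (pseq P) (coef (k t))) (expi th).
  rewrite /rz -csumZ; last exact: l1_powers.
  by apply: csum_ext => j; rewrite mulrA.
rewrite -rzM ?rz_pseq //; last exact: l1_pseq.
rewrite -Hk // /c; field; exact: QN.
Qed.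

(** The quotients [sigma Psi] of [K a] by [a] at both times are, up to a phase, the same
    power series [th], since power series have no zero divisors. *)
Lemma blaschke_evolution t (Psi0 Psit : R[i] -> R[i]) :
  coef (k 0) <> 0 -> coef (k t) <> 0 ->
  finite_blaschke Psi0 -> eq_ae (sHankel (u 0) (k 0)) (fun z => sigma%:C * Psi0 z * k 0 z) ->
  finite_blaschke Psit -> eq_ae (sHankel (u t) (k t)) (fun z => sigma%:C * Psit z * k t z) ->
  exists psi : R, forall z, normc z <= 1 -> Psit z = expi psi * Psi0 z.
Proof.
move=> k0 kt b0 e0 bt et.
have [h0 comp0] := component_coef 0; have [ht compt] := component_coef t.
have la0 := eigK_l1 comp0.1; have lat := eigK_l1 compt.1.
have Du := sol_dcurve s1 sol_u.
have [th [gamma [g1 K0E KtE]]] :=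
  component_quotient lx (exprn_gt0 2 sigma0) Du comp0 k0 compt kt.
have [psi gE] := expi_onto g1; exists psi => z z1; rewrite -gE.
have [P0 [Q0 [c0 [c0N Q0N Psi0E C0]]]] := blaschke_coef b0 e0.
have [Pt [Qt [ct [ctN QtN PsitE Ct]]]] := blaschke_coef bt et.
have q0 : convol (pseq Q0) th = c0 *: pseq P0.
  apply/eqP; rewrite -subr_eq0; apply/eqP; apply: (conv_eq0 _ k0).
  by rewrite -scaleN1r convolDl !convolZl scaleN1r -convolA -K0E C0 subrr.
have qt : gamma *: convol (pseq Qt) th = ct *: pseq Pt.
  apply/eqP; rewrite -subr_eq0; apply/eqP; apply: (conv_eq0 _ kt).
  by rewrite -scaleN1r convolDl !convolZl scaleN1r -convolA -convolZr -KtE Ct subrr.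
have key : (gamma * c0) *: convol (pseq Qt) (pseq P0) = ct *: convol (pseq Q0) (pseq Pt).
  rewrite -scalerA -convolZr -q0 convolA (convolC (pseq Qt)) -convolA.
  by rewrite -[RHS]convolZr -qt convolZr.
have rzZ c y : l1 y -> rz (c *: y) z = c * rz y z.
  move=> ly; rewrite /rz -csumZ; last exact: l1_powers.
  by apply: csum_ext => j; rewrite mulrA.
have lc P Q : l1 (convol (pseq P) (pseq Q)) by apply: l1_conv; exact: l1_pseq.
have := congr1 (fun y => rz y z) key.
rewrite !rzZ // -!rzM ?rz_pseq //; try exact: l1_pseq.
move=> kz; have sN : sigma%:C != 0 by rewrite eq_complex /= negb_and gt_eqF.
apply: (mulfI sN); rewrite PsitE // [RHS]mulrCA Psi0E //.
have Q0z := Q0N z z1; have Qtz := QtN z z1.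
apply: (mulIf (mulf_neq0 Q0z Qtz)).
have -> : ct * (Pt.[z] / Qt.[z]) * (Q0.[z] * Qt.[z]) = ct * (Q0.[z] * Pt.[z]) by field.
have -> : gamma * (c0 * (P0.[z] / Q0.[z])) * (Q0.[z] * Qt.[z]) =
    gamma * c0 * (Qt.[z] * P0.[z]) by field.
by rewrite kz.
Qed.

End Evolution.

Theorem proposition4p2 (R : realType) (alpha s : R)
    (u0 : R[i] -> R[i]) (u : R -> R[i] -> R[i]) (sigma : R)
    (Omega : set R) (Psi : R -> R[i] -> R[i])
    (halpha : alpha != 0) (hs : 1 < s) (hu0 : sobolev_plus s u0)
    (hu : szego_solution alpha s u) (hinit : eq_ae (u 0) u0)
    (hmean : exists t : R, inner (fun=> 1) (u t) != 0)
    (hsigma : 0 < sigma) (hsing : K_singular_value u0 sigma)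
    (hOmega : open Omega) (hinterval : is_interval Omega)
    (hcross : Omega `<=` ~` crossing_times u sigma)
    (hcross0 : ~ crossing_times u sigma 0)
    (hSigma : forall t, Omega t -> Sigma_K (u t) sigma)
    (hPsi : forall t, Omega t \/ t = 0 ->
       finite_blaschke (Psi t) /\
       eq_ae (sHankel (u t) (K_component (u t) sigma))
             (fun z => sigma%:C * Psi t z * K_component (u t) sigma z)) :
  exists psi : R -> R, forall t, Omega t ->
    forall z : R[i], Normc.normc z <= 1 -> Psi t z = expi (psi t) * Psi 0 z.
Proof.
suff H t : exists p : R, Omega t -> forall z : R[i], Normc.normc z <= 1 -> Psi t z = expi p * Psi 0 z.
  by have [psi Hpsi] := choice H; exists psi.
have [Ot|nO] := pselect (Omega t); last by exists 0.
have [b0 e0] := hPsi 0 (or_intror erefl); have [bt et] := hPsi t (or_introl Ot).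
have k0 := component_neq0_init hs hu hsigma hu0 hinit hsing hcross0.
have kt := component_neq0 hs hu hsigma (hSigma t Ot).
have [p Hp] := blaschke_evolution hs hu hsigma k0 kt b0 e0 bt et.
by exists p.
Qed.
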